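(* Let $T \in \mathbb{Z}[z]$ be a Salem polynomial of degree $m$ with simple roots, none of which lies in $\{1,-1\}$. For each $P \in \mathcal{P}_T$ write the Hurwitz alternant $h_P(z)$ uniquely associated with $P$ as a Stieltjes continued fraction $h_P(z) = [f_1/f_2/\ldots/f_m](z)$. Let $\mathcal{F}_T$, resp. $\mathcal{F}_T^{+}$, be the set of all $m$-tuples ${}^{t}(f_1,\ldots,f_m) \in (\mathbb{Q}_{>0})^m$ such that $[f_1/f_2/\ldots/f_m](z) = h_P(z)$ for $P$ running over $\mathcal{P}_T$, resp. $\mathcal{P}_T^{+}$. Then: (i) $\mathcal{F}_T$ is discrete and has no accumulation point in $(\mathbb{R}_{>0})^m$; (ii) $\mathcal{F}_T$ has affine dimension equal to $m$ (i.e. its affine hull is $\mathbb{R}^m$); (iii) the set $\mathcal{F}_T^{+} \cup \{0\}$ is a commutative semigroup with neutral element $0 \in \mathbb{R}^m$, whose internal law is the image, under the mapping $P \mapsto h_P$ (each $h_P$ being identified with its $m$-tuple $(f_1,\ldots,f_m)$, and $T$ corresponding to $0$), of the law $$(P, P^{\dagger}) \mapsto P \oplus P^{\dagger} := P + P^{\dagger} - T$$ on $\mathcal{P}_T^{+} \cup \{T\}$; (iv) the intersection of $\mathcal{F}_T$ with the hypersurface $$\{{}^{t}(x_1,\ldots,x_m) \in \mathbb{R}^m \mid [x_1/x_2/\ldots/x_m](1) = 1\}$$ is empty.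
   Context: For a polynomial $P$ of degree $n$, its reciprocal polynomial is $P^{*}(z) = z^{n} P(1/z)$; $P$ is reciprocal if $P^*=P$. An expansive polynomial is a polynomial with coefficients in a real subfield of $\mathbb{C}$, of degree $\geq 1$, all of whose complex roots have modulus strictly greater than $1$. A Salem polynomial is a monic reciprocal polynomial with integer coefficients having exactly one zero (of multiplicity $1$) of modulus $>1$, this zero being a real number $>1$, and having at least one zero on the unit circle. For $T$ of degree $m$ as in the statement: - $\mathcal{P}_T^{+}$ is the set of monic expansive polynomials $P \in \mathbb{Z}[z]$ of degree $m$ with $P(0) > 0$ and $(z-1)T(z) = zP(z) - P^{*}(z)$; - $\mathcal{P}_T^{-}$ is the set of monic expansive polynomials $P \in \mathbb{Z}[z]$ of degree $m$ with $P(0) < 0$ and $(z+1)T(z) = zP(z) + P^{*}(z)$; - $\mathcal{P}_T := \mathcal{P}_T^{+} \cup \mathcal{P}_T^{-}$. Stieltjes continued fraction: $$[f_1/f_2/\ldots/f_m](z) = \cfrac{f_1}{1+\cfrac{f_2 z}{1+\cfrac{f_3 z}{1+\cfrac{\ddots}{1+f_m z}}}}.$$ Hurwitz alternant: given an expansive polynomial $P$ of degree $m$, put $H(z) = (z+1)^m P\!\left(\frac{z-1}{z+1}\right) = \sum_{i=0}^{m} h_i z^i$, all of whose roots have negative real part. The Hurwitz alternant of $P$ is $$h_P(z) = \frac{\sum_{i=0}^{\lfloor (m-1)/2\rfloor} h_{2i+1} z^i}{\sum_{i=0}^{\lfloor m/2\rfloor} h_{2i} z^i}.$$ By a classical theorem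 of Hurwitz, $h_P$ is uniquely of the form $[f_1/\ldots/f_m](z)$ with all $f_j>0$ (and $f_j \in \mathbb{Q}_{>0}$ when $P \in \mathbb{Z}[z]$). *)

(* Defs.v *)
From HB Require Import structures.
From mathcomp Require Import all_boot all_order all_algebra.
From mathcomp Require Import all_classical all_reals all_analysis.
From mathcomp Require Import complex.

Set Implicit Arguments.
Unset Strict Implicit.
Unset Printing Implicit Defensive.

Import Order.TTheory GRing.Theory Num.Theory.
Import numFieldNormedType.Exports.

Local Open Scope classical_set_scope.
Local Open Scope ring_scope.

(* P^*(z) = z ^ (deg P) * P (1 / z); recall that deg P = (size P).-1. *)
Definition reciprocal (A : nzRingType) (P : {poly A}) : {poly A} :=
  \poly_(i < size P) P`_((size P).-1 - i).

(* Complex roots are roots in R[i]; the norm and the order below are those of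
   R[i], in which a comparison holds only between numbers that differ by a
   real, so that 1 < `|z| says that the modulus of z is larger than 1. *)
Definition expansive (R : realType) (P : {poly R}) : Prop :=
  (1 < size P)%N /\
  forall z : R[i], root (map_poly (real_complex R) P) z -> 1 < `|z|.

Definition polyC_of_int (R : realType) (P : {poly int}) : {poly R[i]} :=
  map_poly (intmul 1) P.

Definition polyR_of_int (R : realType) (P : {poly int}) : {poly R} :=
  map_poly (intmul 1) P.

Definition polyQ_of_int (P : {poly int}) : {poly rat} :=
  map_poly (intmul 1) P.

Definition salem_poly (R : realType) (T : {poly int}) : Prop :=
  [/\ T \is monic,
      reciprocal T = T,
      exists beta : R,
        [/\ 1 < beta,
            mup (real_complex R beta) (polyC_of_int R T) = 1%N &
            forall z : R[i], root (polyC_of_int R T) z -> 1 < `|z| ->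
              z = real_complex R beta] &
      exists2 z : R[i], root (polyC_of_int R T) z & `|z| = 1].

Definition simple_roots (R : realType) (T : {poly int}) : Prop :=
  forall z : R[i], root (polyC_of_int R T) z -> mup z (polyC_of_int R T) = 1%N.

Definition PTplus (R : realType) (T : {poly int}) : set {poly int} :=
  [set P | [/\ P \is monic, size P = size T, expansive (polyR_of_int R P),
               0 < P.[0] & ('X - 1) * T = 'X * P - reciprocal P]].

Definition PTminus (R : realType) (T : {poly int}) : set {poly int} :=
  [set P | [/\ P \is monic, size P = size T, expansive (polyR_of_int R P),
               P.[0] < 0 & ('X + 1) * T = 'X * P + reciprocal P]].

Definition PT (R : realType) (T : {poly int}) : set {poly int} :=
  PTplus R T `|` PTminus R T.

(* [f_1/f_2/.../f_m](z) = f_1 / (1 + z * [f_2/.../f_m](z)), and the empty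
   continued fraction is 0; here z is an element of any field. *)
Definition stieltjes_cf (F : fieldType) (z : F) (f : seq F) : F :=
  foldr (fun a g => a / (1 + z * g)) 0 f.

(* The same continued fraction as an element of the field K(z) of rational
   functions.  There every denominator is nonzero, whatever f is, because its
   value at z = 0 is 1. *)
Definition stieltjes (K : fieldType) (m : nat) (f : 'cV[K]_m) :
    {fraction {poly K}} :=
  stieltjes_cf (FracField.tofrac 'X)
    [seq FracField.tofrac (f j 0)%:P | j <- enum 'I_m].

(* H(z) = (z+1)^m P((z-1)/(z+1)) with m = deg P, after clearing
   denominators. *)
Definition hurwitz_poly (A : comNzRingType) (P : {poly A}) : {poly A} :=
  \sum_(i < size P) P`_i *: (('X - 1) ^+ i * ('X + 1) ^+ ((size P).-1 - i)).

(* odd_poly H = \sum_i h_(2i+1) 'X^i and even_poly H = \sum_i h_(2i) 'X^i. *)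
Definition hurwitz_alternant (K : fieldType) (P : {poly K}) :
    {fraction {poly K}} :=
  FracField.tofrac (odd_poly (hurwitz_poly P)) /
  FracField.tofrac (even_poly (hurwitz_poly P)).

(* x is a tuple of positive rationals, viewed in R^m, representing h_P. *)
Definition stieltjes_tuple_of (R : realType) (m : nat) (P : {poly int})
    (x : 'cV[R]_m) : Prop :=
  exists f : 'cV[rat]_m,
    [/\ forall j, 0 < f j 0,
        stieltjes f = hurwitz_alternant (polyQ_of_int P) &
        x = map_mx ratr f].

Definition FT (R : realType) (m : nat) (T : {poly int}) : set 'cV[R]_m :=
  [set x | exists2 P, PT R T P & stieltjes_tuple_of P x].
Arguments FT R m T : clear implicits.

Definition FTplus (R : realType) (m : nat) (T : {poly int}) : set 'cV[R]_m :=
  [set x | exists2 P, PTplus R T P & stieltjes_tuple_of P x].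
Arguments FTplus R m T : clear implicits.

(* The correspondence P |-> h_P on P_T^+ \cup {T}, in coordinates; T itself,
   which is not expansive, corresponds to 0. *)
Definition salem_tuple (R : realType) (m : nat) (T P : {poly int})
    (x : 'cV[R]_m) : Prop :=
  (PTplus R T P /\ stieltjes_tuple_of P x) \/ (P = T /\ x = 0).
Arguments salem_tuple [R m] T P x.

Definition oplus (T P P' : {poly int}) : {poly int} := P + P' - T.

Definition commutative_semigroup_on (V : Type) (S : set V) (op : V -> V -> V)
    (e : V) : Prop :=
  [/\ S e,
      forall x y, S x -> S y -> S (op x y),
      forall x y z, S x -> S y -> S z -> op x (op y z) = op (op x y) z,
      forall x y, S x -> S y -> op x y = op y x &
      forall x, S x -> op e x = x].

Definition affine_hull (R : realType) (V : lmodType R) (A : set V) : set V :=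
  [set x | exists (n : nat) (a : 'I_n -> R) (y : 'I_n -> V),
     [/\ forall i, A (y i), \sum_i a i = 1 & x = \sum_i a i *: y i]].

Definition positive_orthant (R : realType) (m : nat) : set 'cV[R]_m :=
  [set x | forall j, 0 < x j 0].
Arguments positive_orthant R m : clear implicits.

(* The rational function r is defined at a and takes the value v there. *)
Definition ratfun_value (K : fieldType) (r : {fraction {poly K}}) (a v : K) :
    Prop :=
  exists p q : {poly K},
    [/\ q.[a] != 0, r = FracField.tofrac p / FracField.tofrac q &
        v = p.[a] / q.[a]].

Definition hypersurface (R : realType) (m : nat) : set 'cV[R]_m :=
  [set x | ratfun_value (stieltjes x) 1 1].
Arguments hypersurface R m : clear implicits.

(* Main.v *)
(* Put H_P(z) = (z+1)^m P((z-1)/(z+1)). As m is even and T is reciprocal,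
   H_T(z) = t(z^2), and the equation relating P to T becomes H_P(z) = t(w) + w k(w) + z k(w)
   on P_T^+ and H_P(z) = t(w) + k(w) + z k(w) on P_T^-, where w = z^2 and k is an arbitrary
   polynomial of degree less than m/2; so h_P = k / (t + w k), resp. k / (t + k).

   P is expansive iff H_P is Hurwitz stable, iff h_P is a Stieltjes fraction with
   positive terms. The direct part is the Routh algorithm, each step of which preserves
   stability because roots cannot cross the imaginary axis along a segment of
   polynomials; the converse holds because z h_P(z^2) has positive real part
   where z does.

   (i) On P_T^+ the coefficient h_0 of H_P is T(-1), and on P_T^- the leading one is
   T(1). A bound on the f_j and on their inverses thus bounds the integer
   polynomial H_P.

   (ii) The points of F_T^+ satisfy f_2 + ... + f_m - f_1 = constant, hence they do not
   suffice; those of F_T^- do. There f_1 = K/(t_0 + K), f_2 = t_0 s_2/(t_0 + K) and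
   f_j = s_j for j >= 3, where K is proportional to k(0) and 1, s_2, ..., s_m are the
   terms of the fraction k/t with both constant terms normalised to 1. An
   affine relation on F_T is therefore an affine relation between s_3, ..., s_m, first for
   the integer directions k, then for the real ones by density. The roots of t
   being fixed, let k acquire one of the negative roots -1/b of t: the pair (k, t) degenerates
   to one with a root less, while the last two terms tend to 0 and to b. An
   induction on the number of roots kills all the coefficients.

   (iii) For P in P_T^+, differentiating the fraction gives k(w) t'(w) > 0 at every
   negative root w of t, a condition which is additive in k. It prevents the roots of
   t + (w + z)(k + e k') from reaching the imaginary axis for e in [0, 1].

   (iv) h_P(1) = 1 would mean H_P(-1) = 0, but H_P(-1) = (-2)^m. *)
Require Import Defs.
From mathcomp Require Import all_boot all_order all_algebra.
From mathcomp Require Import all_classical all_reals all_analysis.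
From mathcomp Require Import complex.
From mathcomp Require Import ring lra zify.
Import Order.TTheory GRing.Theory Num.Theory.
Import numFieldNormedType.Exports.
Local Open Scope classical_set_scope.
Local Open Scope ring_scope.
Set Implicit Arguments.
Unset Strict Implicit.
Unset Printing Implicit Defensive.

Local Notation Re := (@complex.Re _).
Local Notation Im := (@complex.Im _).

(** * Continued fractions *)

(* [f_1/f_2/.../f_m] = cfN f / cfD f, both without a common factor when no f_j is 0. *)
Fixpoint cfN (F : fieldType) (f : seq F) : {poly F} :=
  if f is a :: l then a *: cfD l else 0
with cfD (F : fieldType) (f : seq F) : {poly F} :=
  if f is _ :: l then cfD l + 'X * cfN l else 1.

Lemma cfN_cons (F : fieldType) (a : F) l : cfN (a :: l) = a *: cfD l.
Proof. by []. Qed.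

Lemma cfD_cons (F : fieldType) (a : F) l : cfD (a :: l) = cfD l + 'X * cfN l.
Proof. by []. Qed.

Lemma cfD_coef0 (F : fieldType) (f : seq F) : (cfD f)`_0 = 1.
Proof.
elim: f => [|a l IH] /=; first by rewrite coefC.
by rewrite coefD coefXM /= addr0.
Qed.

Lemma cfN_coef0 (F : fieldType) (f : seq F) : (cfN f)`_0 = f`_0.
Proof. by case: f => [|a l] /=; rewrite ?coefC // coefZ cfD_coef0 mulr1. Qed.

Lemma cfD_neq0 (F : fieldType) (f : seq F) : cfD f != 0.
Proof.
apply/eqP => /(congr1 (fun p : {poly F} => p`_0)).
by rewrite cfD_coef0 coef0 => /eqP; rewrite oner_eq0.
Qed.

Lemma size_cf (F : fieldType) (f : seq F) :
  (size (cfN f) <= uphalf (size f))%N /\ (size (cfD f) <= (size f)./2.+1)%N.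
Proof.
elim: f => [|a l [IHN IHD]] /=; first by rewrite size_poly0 size_poly1.
split; first by rewrite (leq_trans (size_scale_leq _ _)).
rewrite (leq_trans (size_polyD _ _)) // geq_max; apply/andP; split; first by lia.
by rewrite (leq_trans (size_polyMleq _ _)) // size_polyX add2n.
Qed.

Lemma cf_map (F K : fieldType) (phi : {rmorphism F -> K}) (f : seq F) :
  cfN (map phi f) = map_poly phi (cfN f) /\ cfD (map phi f) = map_poly phi (cfD f).
Proof.
elim: f => [|a l [IHN IHD]] /=; first by rewrite rmorph0 rmorph1.
by rewrite map_polyZ rmorphD rmorphM /= map_polyX IHN IHD.
Qed.

(* The two arguments stand for the continued fraction N / D, of which each step
   removes the first term. *)
Fixpoint cf_expand (F : fieldType) (m : nat) (N D : {poly F}) : seq F :=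
  if m is m'.+1 then
    let s := N`_0 / D`_0 in
    s :: cf_expand m' (drop_poly 1 (s *: D - N)) N
  else [::].

Lemma size_cf_expand (F : fieldType) m (N D : {poly F}) : size (cf_expand m N D) = m.
Proof. by elim: m N D => //= m IH N D; rewrite IH. Qed.

Lemma mulX_drop (F : fieldType) (p : {poly F}) : p`_0 = 0 -> 'X * drop_poly 1 p = p.
Proof.
move=> p0; apply/polyP => -[|i]; rewrite coefXM //=.
by rewrite coef_drop_poly addn1.
Qed.

Lemma mulXI (F : fieldType) : injective (fun p : {poly F} => 'X * p).
Proof. by apply: mulfI; rewrite polyX_eq0. Qed.

Lemma coef0_step (F : fieldType) (N D : {poly F}) : D`_0 != 0 ->
  ((N`_0 / D`_0) *: D - N)`_0 = 0.
Proof. by move=> D0; rewrite coefB coefZ divfK // subrr. Qed.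

(** The common factor [c] cancels in each quotient of constant terms. The padding by zeros is what a
    fraction with a common linear factor produces ([j = 2]). *)
Lemma cf_expand_cf (F : fieldType) (f : seq F) (c : {poly F}) j :
  c`_0 != 0 -> {in f, forall a, a != 0} ->
  cf_expand (size f + j) (c * cfN f) (c * cfD f) = f ++ nseq j 0.
Proof.
elim: f c => [|a l IH] c c0 Hf /=.
  rewrite mulr0 mulr1 add0n.
  (* After one more step both polynomials are 0, and the terms rely on [0 / 0 = 0]. *)
  elim: j c {c0 Hf} => //= j IH c.
  by rewrite coef0 mul0r scale0r subr0 linear0 IH.
have a0 : a != 0 by apply: Hf; rewrite mem_head.
rewrite -scalerAr; set s := _ / _.
have -> : s = a.
  rewrite /s coefZ !coef0M coefD coefXM /= addr0 cfD_coef0 mulr1.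
  by rewrite mulfK.
congr (_ :: _).
have -> : drop_poly 1 (a *: (c * (cfD l + 'X * cfN l)) - a *: (c * cfD l)) = (a *: c) * cfN l.
  apply: mulXI; rewrite mulX_drop.
    by rewrite mulrDr scalerDr addrC addKr -scalerAl mulrCA scalerAr.
  by rewrite coefB !coefZ !coef0M coefD coefXM /= addr0 subrr.
rewrite scalerAl IH //.
- by rewrite coefZ mulf_neq0.
- by move=> b bl; apply: Hf; rewrite inE bl orbT.
Qed.

(** One step of the expansion turns the cross equation for [(N, D)] into the one for [(M, N)], with
    one term less. No coprimality is assumed: the size bounds leave room for a constant common
    factor only. *)
Lemma cf_proportional (F : fieldType) (f : seq F) (N D : {poly F}) :
  {in f, forall a, a != 0} ->
  N * cfD f = cfN f * D ->
  (size N <= uphalf (size f))%N -> (size D <= (size f)./2.+1)%N ->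
  N = D`_0 *: cfN f /\ D = D`_0 *: cfD f.
Proof.
elim: f N D => [|a l IH] N D /= Hf.
  rewrite mulr1 mul0r => -> _ sD; split; first by rewrite scaler0.
  by rewrite {1}(size1_polyC sD) -mul_polyC mulr1.
move=> E sN sD; have U := uphalf_half (size l).
have a0 : a != 0 by apply: Hf; rewrite mem_head.
have D0 : N`_0 = a * D`_0.
  move/(congr1 (fun p : {poly F} => p`_0)): E.
  by rewrite !coef0M coefD coefXM /= coefZ cfD_coef0 addr0 !mulr1.
have Z : (a *: D - N)`_0 = 0 by rewrite coefB coefZ D0 subrr.
set M := drop_poly 1 (a *: D - N).
have EM : 'X * M = a *: D - N by apply: mulX_drop.
have sM : (size M <= uphalf (size l))%N.
  rewrite size_drop_poly leq_subLR add1n (leq_trans (size_polyD _ _)) // size_polyN.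
  rewrite geq_max (leq_trans (size_scale_leq _ _)) //=.
  by move: sN U; move: (size N) (size l) => *; lia.
have [] := IH M N.
- by move=> b bl; apply: Hf; rewrite inE bl orbT.
- apply: mulXI; rewrite mulrA EM mulrBl -scalerAl [D * _]mulrC scalerAl -E.
  ring.
- exact: sM.
- exact: sN.
rewrite D0 => EM' EN; split.
  by rewrite EN scalerA mulrC.
apply: (scalerI a0).
rewrite -[a *: D in LHS](subrK N) -EM EM' EN -scalerAr -scalerDr scalerA.
by rewrite [cfD l + _]addrC.
Qed.

(** The size bounds drop along the expansion until the numerator is 0 and the denominator constant.
    Nonzero terms keep the constant coefficient of every successive denominator nonzero. *)
Lemma cf_expandP (F : fieldType) m (N D : {poly F}) :
  D`_0 != 0 -> (size N <= uphalf m)%N -> (size D <= m./2.+1)%N ->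
  {in cf_expand m N D, forall a, a != 0} ->
  N = D`_0 *: cfN (cf_expand m N D) /\ D = D`_0 *: cfD (cf_expand m N D).
Proof.
elim: m N D => [|m IH] N D /= D0 sN sD Hs.
  rewrite scaler0 -mul_polyC mulr1 -(size1_polyC sD); split=> //.
  by apply/eqP; rewrite -size_poly_leq0.
have U := uphalf_half m; set s := N`_0 / D`_0.
have s0 : s != 0 by apply: Hs; rewrite mem_head.
set M := drop_poly 1 (s *: D - N).
have EM : 'X * M = s *: D - N by apply: mulX_drop; exact: coef0_step.
have EN0 : N`_0 = s * D`_0 by rewrite divfK.
have [] := IH M N.
- by rewrite EN0 mulf_neq0.
- rewrite size_drop_poly leq_subLR add1n (leq_trans (size_polyD _ _)) // size_polyN.
  rewrite geq_max (leq_trans (size_scale_leq _ _)) //=.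
  by move: sN U; move: (size N) => *; lia.
- by move: sN U; move: (size N) => *; lia.
- by move=> b bl; apply: Hs; rewrite inE bl orbT.
set f := cf_expand m M N; rewrite EN0 => EM' EN; split.
  by rewrite EN scalerA mulrC.
apply: (scalerI s0).
rewrite -[s *: D in LHS](subrK N) -EM EM' EN -scalerAr -scalerDr scalerA.
by rewrite [cfD f + _]addrC.
Qed.

(** A linear relation between the terms once the denominator is prescribed: it controls the last
    term in [admissible_extend] and eliminates [s2] in [FT_relation_trivial]. *)
Lemma cfD_coef1 (F : fieldType) (a : F) l : (cfD (a :: l))`_1 = \sum_(b <- l) b.
Proof.
elim: l a => [|b l IH] a; first by rewrite /= big_nil mulr0 addr0 coefC.
by rewrite cfD_cons coefD coefXM IH cfN_coef0 /= big_cons addrC.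
Qed.

(* If r is the fraction, r is decreasing and w r(w) increasing on the real line. *)
Lemma cf_wronskian_pos (F : realFieldType) (f : seq F) (w : F) :
  {in f, forall a, 0 < a} -> (0 < size f)%N ->
  let N := cfN f in let D := cfD f in
  let A := (N * deriv D - deriv N * D).[w] in
  0 <= A /\ 0 < (N * D).[w] - w * A.
Proof.
elim: f => // a [|b l] IH Hf _.
  rewrite /= mulr0 addr0 alg_polyC !derivC !mulr0 mul0r !mulr1 subr0 horner0.
  by rewrite hornerC mulr0 subr0; split=> //; apply: Hf; rewrite mem_head.
have a0 : 0 < a by apply: Hf; rewrite mem_head.
have [|//|] := IH.
  by move=> c cl; apply: Hf; rewrite inE cl orbT.
have := cfD_coef0 (b :: l); cbv zeta; rewrite [cfN (a :: _)]cfN_cons [cfD (a :: _)]cfD_cons.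
move: (cfN (b :: l)) (cfD (b :: l)) => N D D0 A0 B0.
set A := (_ - _).[w] in A0 B0.
have -> : (a *: D * deriv (D + 'X * N) - deriv (a *: D) * (D + 'X * N)).[w] =
   a * ((N * D).[w] - w * A).
  rewrite /A !(derivD, poly.derivM, derivX, derivZ) mul1r.
  by rewrite !(hornerD, hornerN, hornerM, hornerZ, hornerX); ring.
have -> : (a *: D * (D + 'X * N)).[w] - w * (a * ((N * D).[w] - w * A)) =
   a * (D.[w] ^+ 2 + w ^+ 2 * A).
  by rewrite /A !(hornerD, hornerN, hornerM, hornerZ, hornerX); ring.
split; first by rewrite mulr_ge0 ?(ltW a0) ?(ltW B0).
rewrite pmulr_rgt0 //.
(* At [w = 0] positivity comes from [D(0) = 1]. Elsewhere the sum vanishes only if [D(w)] and the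
   inner Wronskian both do, against the induction hypothesis. *)
have [->|w0] := eqVneq w 0.
  by rewrite expr0n mul0r addr0 horner_coef0 D0 expr1n.
have wA0 : 0 <= w ^+ 2 * A by rewrite mulr_ge0 ?sqr_ge0.
rewrite lt0r addr_ge0 ?sqr_ge0 // andbT paddr_eq0 ?sqr_ge0 //.
apply/negP => /andP[].
rewrite sqrf_eq0 => /eqP Dw0.
rewrite mulf_eq0 sqrf_eq0 (negbTE w0) /= => /eqP AE.
by move: B0; rewrite AE mulr0 subr0 hornerM Dw0 mulr0 ltxx.
Qed.

(** The coefficients are polynomials in the terms with nonnegative coefficients, hence monotone in
    each term. *)
Lemma cf_coef_le (F : numFieldType) (f g : seq F) :
  size f = size g -> (forall i, 0 <= f`_i <= g`_i) ->
  forall i, 0 <= (cfN f)`_i <= (cfN g)`_i /\ 0 <= (cfD f)`_i <= (cfD g)`_i.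
Proof.
elim: f g => [|a l IH] [|b k] //=.
  by move=> _ _ i; rewrite !coefC if_same; case: (i == 0%N); rewrite ?lexx ?ler01.
move=> [sz] H.
have {}IH := IH k sz (fun i => H i.+1).
have /andP[a0 ab] := H 0%N; rewrite /= in a0 ab.
move=> i; rewrite !coefZ !coefD !coefXM; split.
  have [_ /andP[d0 d1]] := IH i.
  by rewrite mulr_ge0 //= ler_pM.
have [_ /andP[d0 d1]] := IH i.
case: i d0 d1 => [|i] d0 d1 /=; first by rewrite !addr0 d0.
have [/andP[n0 n1] _] := IH i.
by rewrite addr_ge0 //= lerD.
Qed.

Lemma cf_lead_gt0 (F : numFieldType) (f : seq F) : {in f, forall a, 0 < a} ->
  ((0 < size f)%N -> 0 < (cfN f)`_((size f).-1./2)) /\ 0 < (cfD f)`_((size f)./2).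
Proof.
elim: f => [|a l IH] Hf; first by split=> //=; rewrite coefC ltr01.
have a0 : 0 < a by apply: Hf; rewrite mem_head.
have Hl : {in l, forall a, 0 < a} by move=> b bl; apply: Hf; rewrite inE bl orbT.
have [IHN IHD] := IH Hl.
split; first by rewrite /= coefZ mulr_gt0.
have nn i : 0 <= (cfN l)`_i /\ 0 <= (cfD l)`_i.
  have h j : 0 <= l`_j <= l`_j.
    rewrite lexx andbT; have [jl|jl] := ltnP j (size l); last by rewrite nth_default ?lexx.
    by rewrite ltW // Hl // mem_nth.
  by have [/andP[? _] /andP[? _]] := cf_coef_le erefl h i.
rewrite cfD_cons coefD coefXM.
(* For odd [size l] the degree rises and the top coefficient involves ['X * cfN l]; otherwise
   [cfD l] suffices. *)
have [ol|el] := boolP (odd (size l)).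
  have -> : ((size (a :: l))./2 = (size l).-1./2.+1)%N by rewrite /=; lia.
  by rewrite /= ltr_wpDl ?(nn _).2 // IHN //; lia.
have -> : ((size (a :: l))./2 = (size l)./2)%N by rewrite /=; lia.
by rewrite ltr_wpDr //; case: (_ == _) => //; exact: (nn _).1.
Qed.

Lemma cf_step_div (K : fieldType) (a x N D : K) : D != 0 ->
  a / (1 + x * (N / D)) = a * D / (D + x * N).
Proof.
move=> D0; have -> : 1 + x * (N / D) = (D + x * N) / D.
  by rewrite mulrDl divff // mulrA.
by rewrite invfM invrK [_^-1 * D]mulrC mulrA.
Qed.

Lemma stieltjes_cfE (K : fieldType) (s : seq K) :
  stieltjes_cf (FracField.tofrac 'X) [seq FracField.tofrac a%:P | a <- s] =
  FracField.tofrac (cfN s) / FracField.tofrac (cfD s).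
Proof.
elim: s => [|a s IH] /=; first by rewrite rmorph0 mul0r.
rewrite IH.
have D0 : FracField.tofrac (cfD s) != 0 by rewrite tofrac_eq0 cfD_neq0.
rewrite -mul_polyC !rmorphM rmorphD rmorphM.
exact: cf_step_div.
Qed.

(** * Column vectors as sequences of terms, and the Hurwitz alternant *)

Definition col_seq (T : Type) (m : nat) (f : 'cV[T]_m) : seq T :=
  [seq f j 0 | j <- enum 'I_m].

Lemma size_col_seq (T : Type) m (f : 'cV[T]_m) : size (col_seq f) = m.
Proof. by rewrite size_map size_enum_ord. Qed.

Lemma nth_col_seq (T : Type) m (f : 'cV[T]_m) x0 (j : 'I_m) :
  nth x0 (col_seq f) j = f j 0.
Proof. by rewrite (nth_map j) ?size_enum_ord // nth_ord_enum. Qed.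

Lemma col_seq_map (T S : Type) (phi : T -> S) m (f : 'cV[T]_m) :
  col_seq (map_mx phi f) = map phi (col_seq f).
Proof. by rewrite -map_comp; apply: eq_map => j; rewrite /= mxE. Qed.

Lemma col_seqP (T : eqType) m (f : 'cV[T]_m) (P : T -> Prop) :
  (forall j, P (f j 0)) <-> {in col_seq f, forall a, P a}.
Proof.
split=> [H a /mapP[j _ ->] //|H j]; apply: H; apply/mapP.
by exists j; rewrite ?mem_enum.
Qed.

Lemma col_seq_inj (T : Type) m : injective (@col_seq T m).
Proof.
move=> f g E; apply/matrixP => j k; rewrite ord1.
by rewrite -(nth_col_seq f (f j 0)) E nth_col_seq.
Qed.

Definition seq_col (F : fieldType) m (s : seq F) : 'cV[F]_m := \col_j s`_j.

Lemma seq_colK (F : fieldType) m (s : seq F) : size s = m -> col_seq (seq_col m s) = s.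
Proof.
move=> sm; apply: (@eq_from_nth _ 0); rewrite size_col_seq // => i im.
by rewrite (nth_col_seq _ _ (Ordinal im)) mxE.
Qed.

Lemma stieltjesE (K : fieldType) m (f : 'cV[K]_m) :
  stieltjes f = FracField.tofrac (cfN (col_seq f)) / FracField.tofrac (cfD (col_seq f)).
Proof. by rewrite -stieltjes_cfE /stieltjes /col_seq -[in RHS]map_comp. Qed.

Lemma frac_eq (K : fieldType) (p q r s : {poly K}) : q != 0 -> s != 0 ->
  FracField.tofrac p / FracField.tofrac q = FracField.tofrac r / FracField.tofrac s <->
  p * s = r * q.
Proof.
move=> q0 s0; split=> [/eqP|E].
  rewrite eqr_div ?tofrac_eq0 // -!rmorphM tofrac_eq => /eqP ->.
  by [].
by apply/eqP; rewrite eqr_div ?tofrac_eq0 // -!rmorphM tofrac_eq E.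
Qed.

(** The degree is a parameter, unlike in [hurwitz_poly], so that the transform is linear and applies
    to polynomials of smaller degree. *)
Definition hur (A : comNzRingType) (m : nat) (P : {poly A}) : {poly A} :=
  \sum_(i < m.+1) P`_i *: (('X - 1) ^+ i * ('X + 1) ^+ (m - i)).

Lemma hurwitz_polyE (A : comNzRingType) m (P : {poly A}) :
  size P = m.+1 -> hurwitz_poly P = hur m P.
Proof. by move=> sP; rewrite /hurwitz_poly sP. Qed.

Lemma hur_map (A B : comNzRingType) (phi : {rmorphism A -> B}) m (P : {poly A}) :
  hur m (map_poly phi P) = map_poly phi (hur m P).
Proof.
rewrite /hur rmorph_sum; apply: eq_bigr => i _.
rewrite /= coef_map map_polyZ rmorphM !rmorphXn rmorphB rmorphD /= map_polyX.
by rewrite rmorph1.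
Qed.

Lemma hurD (A : comNzRingType) m (P Q : {poly A}) : hur m (P + Q) = hur m P + hur m Q.
Proof. by rewrite /hur -big_split; apply: eq_bigr => i _; rewrite coefD scalerDl. Qed.

Lemma hurZ (A : comNzRingType) m a (P : {poly A}) : hur m (a *: P) = a *: hur m P.
Proof. by rewrite /hur scaler_sumr; apply: eq_bigr => i _; rewrite coefZ scalerA. Qed.

Lemma size_hur (A : comNzRingType) m (P : {poly A}) : (size (hur m P) <= m.+1)%N.
Proof.
rewrite (leq_trans (size_sum _ _ _)) //; apply/bigmax_leqP => i _.
rewrite (leq_trans (size_scale_leq _ _)) //.
rewrite -[_ - 1](_ : 'X - 1%:P = _) // -[_ + 1](_ : 'X + 1%:P = _) //.
rewrite (leq_trans (size_polyMleq _ _)) // size_exp_XsubC.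
rewrite -[1%:P]opprK -rmorphN /= size_exp_XsubC; have := ltn_ord i; lia.
Qed.

Lemma size_odd_even (A : nzRingType) m (H : {poly A}) : (size H <= m.+1)%N ->
  (size (odd_poly H) <= uphalf m)%N /\ (size (even_poly H) <= m./2.+1)%N.
Proof.
move=> sH; have := size_odd_poly H; have := size_even_poly H.
move=> h1 h2; split; [rewrite (leq_trans h2) //|rewrite (leq_trans h1) //];
move: sH; move: (size _) => x; lia.
Qed.

Lemma map_odd_poly (A B : nzRingType) (phi : {rmorphism A -> B}) (P : {poly A}) :
  odd_poly (map_poly phi P) = map_poly phi (odd_poly P).
Proof. by apply/polyP => i; rewrite !(coef_odd_poly, coef_map). Qed.

Lemma map_even_poly (A B : nzRingType) (phi : {rmorphism A -> B}) (P : {poly A}) :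
  even_poly (map_poly phi P) = map_poly phi (even_poly P).
Proof. by apply/polyP => i; rewrite !(coef_even_poly, coef_map). Qed.

Lemma cf_expand_map (F K : fieldType) (phi : {rmorphism F -> K}) m (N D : {poly F}) :
  cf_expand m (map_poly phi N) (map_poly phi D) = map phi (cf_expand m N D).
Proof.
elim: m N D => //= m IH N D; rewrite !coef_map -fmorph_div; congr (_ :: _).
rewrite -IH; congr (cf_expand _ _ _).
apply/polyP => i.
rewrite coef_map !coef_drop_poly !(coefB, coefZ) !coef_map.
by rewrite /= rmorphB !rmorphM.
Qed.

Lemma polyR_of_intE (R : realType) (P : {poly int}) :
  polyR_of_int R P = map_poly ratr (polyQ_of_int P).
Proof.
apply/polyP => i; rewrite !coef_map_id0 ?rmorph0 ?mulr0z //.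
by rewrite ratr_int.
Qed.

(** Working over the reals loses nothing: [H] has rational coefficients, so [cf_expand] already runs
    over the rationals and a real tuple that it yields is rational. The scale [c] is the constant
    coefficient of the even part. *)
Lemma stieltjes_tuple_ofP (R : realType) m (P : {poly int}) (x : 'cV[R]_m) :
  (0 < m)%N -> size P = m.+1 ->
  let H := hur m (polyR_of_int R P) in
  stieltjes_tuple_of P x <->
  (forall j, 0 < x j 0) /\
  exists2 c, c != 0 &
    odd_poly H = c *: cfN (col_seq x) /\ even_poly H = c *: cfD (col_seq x).
Proof.
move=> m0 sP H.
have sPQ : size (polyQ_of_int P) = m.+1 by rewrite size_map_inj_poly //; exact: intr_inj.
set HQ := hur m (polyQ_of_int P).
have HE : H = map_poly ratr HQ by rewrite /H polyR_of_intE hur_map.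
have [sN sD] := size_odd_even (size_hur m (polyQ_of_int P)).
rewrite -/HQ in sN sD.
split.
  case=> f [fpos + ->]; rewrite stieltjesE /hurwitz_alternant (hurwitz_polyE sPQ) -/HQ.
  split=> [j|]; first by rewrite mxE ltr0q.
  have f0 : {in col_seq f, forall a, 0 < a} by apply/(col_seqP f (fun a => 0 < a)).
  (* A zero denominator would make the alternant 0 by the convention on inverses, while [cfN] has
     constant coefficient [f_1 > 0]. *)
  have D0 : even_poly HQ != 0.
    apply/eqP => D0; move: p; rewrite D0 rmorph0 invr0 mulr0 => /eqP.
    rewrite mulf_eq0 invr_eq0 !tofrac_eq0 (negbTE (cfD_neq0 _)) orbF => /eqP N0.
    have := cfN_coef0 (col_seq f); rewrite N0 coef0 => /esym/eqP.
    have := fpos (Ordinal m0); rewrite -(nth_col_seq f 0) /= => /lt0r_neq0.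
    by move=> /negbTE ->.
  move: p => /frac_eq-/(_ (cfD_neq0 _) D0) /esym E.
  have fne : {in col_seq f, forall a, a != 0} by move=> a /f0 /lt0r_neq0.
  have [||EN ED] := cf_proportional fne E.
  - by rewrite size_col_seq.
  - by rewrite size_col_seq.
  exists (ratr (even_poly HQ)`_0).
    rewrite fmorph_eq0; apply/eqP => c0; move/eqP: D0; apply.
    by rewrite ED c0 scale0r.
  rewrite col_seq_map !(cf_map _ _).1 (cf_map _ _).2 HE map_odd_poly map_even_poly.
  by rewrite -!map_polyZ -EN -ED.
case=> xpos [c c0 [EN ED]].
set f := cf_expand m (odd_poly HQ) (even_poly HQ).
have x0 : {in col_seq x, forall a, a != 0}.
  by apply/(col_seqP x (fun a => a != 0)) => j; rewrite lt0r_neq0.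
have fx : map ratr f = col_seq x.
  rewrite -cf_expand_map -map_odd_poly -map_even_poly -HE EN ED.
  have := @cf_expand_cf _ (col_seq x) c%:P 0 _ x0.
  by rewrite size_col_seq addn0 cats0 -!mul_polyC => -> //; rewrite coefC.
have D0 : (even_poly HQ)`_0 != 0.
  have := congr1 (fun p : {poly R} => p`_0) ED.
  rewrite HE map_even_poly coef_map coefZ cfD_coef0 mulr1 /= => E.
  by apply: contra_neq c0 => D0; rewrite -E D0 rmorph0.
have fpos : {in f, forall a, 0 < a}.
  move=> a af; rewrite -(ltr0q R).
  have : ratr a \in col_seq x by rewrite -fx; apply: map_f.
  by move: (ratr a); apply/(col_seqP x (fun a => 0 < a)).
have fne : {in f, forall a, a != 0} by move=> a /fpos /lt0r_neq0.
have [EQN EQD] := cf_expandP D0 sN sD fne.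
exists (seq_col m f).
have sf : size f = m by rewrite size_cf_expand.
split.
- by apply/(col_seqP _ (fun a => 0 < a)); rewrite seq_colK.
- rewrite stieltjesE seq_colK // /hurwitz_alternant (hurwitz_polyE sPQ) -/HQ.
  apply/frac_eq; rewrite ?cfD_neq0 //.
    by apply/eqP => E; rewrite E coef0 eqxx in D0.
  by rewrite [in LHS]EQD [in RHS]EQN -scalerAr -scalerAl mulrC.
- by apply: col_seq_inj; rewrite col_seq_map seq_colK.
Qed.

(** * Stable polynomials *)

Definition stable (R : realType) (G : {poly R[i]}) : Prop :=
  forall z : R[i], 0 <= Re z -> G.[z] != 0.

Lemma ReD (R : realType) (x y : R[i]) : Re (x + y) = Re x + Re y.
Proof. by case: x => a b; case: y. Qed.

Lemma ReN (R : realType) (x : R[i]) : Re (- x) = - Re x.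
Proof. by case: x. Qed.

Lemma ReZ (R : realType) (a : R) (x : R[i]) : Re (a%:C%C * x) = a * Re x.
Proof. by case: x => b c /=; rewrite mul0r subr0. Qed.

Lemma rcD (R : realType) (a b : R) : (a + b)%:C%C = a%:C%C + b%:C%C.
Proof. exact: rmorphD. Qed.

Lemma rcB (R : realType) (a b : R) : (a - b)%:C%C = a%:C%C - b%:C%C.
Proof. exact: rmorphB. Qed.

Lemma rcM (R : realType) (a b : R) : (a * b)%:C%C = a%:C%C * b%:C%C.
Proof. exact: rmorphM. Qed.

Lemma rcV (R : realType) (a : R) : (a^-1)%:C%C = (a%:C%C)^-1.
Proof. exact: fmorphV. Qed.

Lemma rcX (R : realType) (a : R) n : (a ^+ n)%:C%C = a%:C%C ^+ n.
Proof. exact: rmorphXn. Qed.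

Lemma Re_le_norm (R : realType) (x : R[i]) : (Re x)%:C%C <= `|x|.
Proof.
rewrite normc_def lecR (le_trans (ler_norm _)) // -sqrtr_sqr ler_wsqrtr //.
by rewrite lerDl sqr_ge0.
Qed.

Lemma Re_normE (R : realType) (x : R[i]) : 0 <= x -> (Re x)%:C%C = x.
Proof. by move=> x0; apply: RRe_real; exact: ger0_real. Qed.

Lemma stable_factor (R : realType) (G : {poly R[i]}) : stable G ->
  exists rs : seq R[i], [/\ G = lead_coef G *: \prod_(a <- rs) ('X - a%:P),
    {in rs, forall a, Re a < 0}, (size G).-1 = size rs & G != 0].
Proof.
move=> stG; have G0 : G != 0.
  by apply/eqP => G0; have := stG 0 (lexx _); rewrite G0 horner0 eqxx.
have [rs Grs] := closed_field_poly_normal G; exists rs; split=> //.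
  move=> a ars; rewrite ltNge; apply/negP => /stG; apply/negP; rewrite negbK.
  apply/eqP; rewrite Grs hornerZ horner_prod (big_rem a) //=.
  by rewrite hornerXsubC subrr mul0r mulr0.
by rewrite Grs size_scale ?lead_coef_eq0 // size_prod_XsubC.
Qed.

(** For a root [a] with negative real part, [|z - a|] dominates [1 + |z|] on the closed right
    half-plane up to a constant. The bound is uniform up to infinity, so that perturbing [G] needs
    no compactness. *)
Lemma stable_lower_bound (R : realType) (G : {poly R[i]}) : stable G ->
  exists2 c : R, 0 < c &
    forall z : R[i], 0 <= Re z -> c%:C%C * (1 + `|z|) ^+ (size G).-1 <= `|G.[z]|.
Proof.
move=> /stable_factor [rs [Grs Hrs -> G0]].
have [c c0 Hc] : exists2 c : R, 0 < c & forall z : R[i], 0 <= Re z ->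
    c%:C%C * (1 + `|z|) ^+ size rs <= `|(\prod_(a <- rs) ('X - a%:P)).[z]|.
  clear -Hrs; elim: rs Hrs => [|a rs IH] Hrs.
    exists 1 => // z _.
    by rewrite big_nil hornerC normr1 expr0 mulr1.
  have [|c c0 Hc] := IH; first by move=> b brs; apply: Hrs; rewrite inE brs orbT.
  have a0 : Re a < 0 by apply: Hrs; rewrite mem_head.
  (* From [1 + |z| <= |z - a| + (1 + |a|)] and [- Re a <= |z - a|]. *)
  pose d := 1 + (1 + Re `|a|) / (- Re a).
  have na : 0 <= Re `|a| by rewrite -ler0c Re_normE.
  have e0 : 0 < - Re a by rewrite oppr_gt0.
  have d0 : 0 < d by rewrite ltr_pwDl // divr_ge0 ?ltW // ltr_pwDl.
  exists (c / d); first by rewrite divr_gt0.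
  move=> z z0; rewrite big_cons hornerM normrM /= exprS.
  rewrite rcM [X in _ * X <= _]mulrC mulrACA [leRHS]mulrC; apply: ler_pM.
  - by rewrite mulr_ge0 ?ler0c ?ltW // exprn_ge0 // addr_ge0.
  - by rewrite mulr_ge0 ?ler0c ?invr_ge0 ?ltW // ltr_pwDl.
  - exact: Hc.
  rewrite rcV mulrC ler_pdivrMr ?ltcR // !hornerE.
  rewrite /d rcD mulrDr mulr1.
  have h1 : (- Re a)%:C%C <= `|z - a|.
    by apply: le_trans (Re_le_norm _); rewrite lecR ReD ReN lerDr.
  have h2 : 1 + `|a| <= `|z - a| * ((1 + Re `|a|) / - Re a)%:C%C.
    have -> : 1 + `|a| = (1 + Re `|a|)%:C%C by rewrite rcD Re_normE.
    rewrite [(_ + _) / _]mulrC rcM mulrA ler_peMl ?ler0c //.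
      by rewrite ltW // ltr_pwDl.
    by rewrite rcV ler_pdivlMr ?ltcR // mul1r.
  apply: le_trans (lerD (lexx _) h2).
  rewrite addrCA lerD2l.
  by rewrite -[z in leLHS](subrK a) ler_normD.
exists (c * Re `|lead_coef G|).
  by rewrite mulr_gt0 // -ltcR Re_normE // normr_gt0 lead_coef_eq0.
move=> z z0; rewrite [in leRHS]Grs hornerZ normrM mulrC rcM mulrA.
rewrite Re_normE // mulrC; apply: ler_wpM2l => //.
by rewrite mulrC Hc.
Qed.

Lemma horner_upper_bound (R : realType) (B : {poly R[i]}) n : (size B <= n.+1)%N ->
  exists2 c : R, 0 < c & forall z : R[i], `|B.[z]| <= c%:C%C * (1 + `|z|) ^+ n.
Proof.
move=> sB; exists (1 + Re (\sum_(i < size B) `|B`_i|)).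
  by rewrite ltr_pwDl // -ler0c Re_normE ?sumr_ge0.
move=> z; rewrite rcD Re_normE ?sumr_ge0 // mulrDl.
rewrite ler_wpDl ?mulr_ge0 ?exprn_ge0 ?addr_ge0 //.
rewrite horner_coef mulr_suml (le_trans (ler_norm_sum _ _ _)) //.
apply: ler_sum => i _; rewrite normrM; apply: ler_wpM2l => //.
rewrite normrX (@le_trans _ _ ((1 + `|z|) ^+ i)) //.
  by apply: lerXn2r; rewrite ?nnegrE ?addr_ge0 // lerDr.
apply: ler_weXn2l; first by rewrite lerDl.
by rewrite -ltnS (leq_trans (ltn_ord i)).
Qed.

(** The perturbation has at most the degree of [G], so both are compared with the same power of
    [1 + |z|]. *)
Lemma stable_open (R : realType) (G B : {poly R[i]}) n :
  size G = n.+1 -> (size B <= n.+1)%N -> stable G ->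
  exists2 d : R, 0 < d & forall e : R, `|e| < d -> stable (G + e%:C%C *: B).
Proof.
move=> sG sB stG.
have [c c0 Hc] := stable_lower_bound stG; have [k k0 Hk] := horner_upper_bound sB.
rewrite sG /= in Hc.
exists (c / k); first by rewrite divr_gt0.
move=> e; rewrite ltr_pdivlMr // => ek z z0.
apply/eqP => E; have := Hc z z0.
have -> : G.[z] = - (e%:C%C * B.[z]).
  by apply/eqP; rewrite -addr_eq0 -hornerZ -hornerD E.
rewrite normrN normrM; apply/negP/negbT/lt_geF.
have -> : `|e%:C%C| = (`|e|)%:C%C by rewrite normc_def /= expr0n addr0 sqrtr_sqr.
apply: le_lt_trans (ler_wpM2l _ (Hk z)) _; first by rewrite ler0c.
rewrite mulrA ltr_pM2r; first by rewrite -rcM ltcR.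
by rewrite exprn_gt0 // (lt_le_trans ltr01) // lerDl.
Qed.

(** Each factor [z - a] has modulus at least [Re z]. The bound involves the leading coefficient but
    not the roots, and hence survives a limit. *)
Lemma stable_lead_bound (R : realType) (G : {poly R[i]}) (z : R[i]) :
  stable G -> 0 <= Re z -> `|lead_coef G| * (Re z)%:C%C ^+ (size G).-1 <= `|G.[z]|.
Proof.
move=> /stable_factor [rs [Grs Hrs -> _]] z0.
rewrite [in leRHS]Grs hornerZ normrM; apply: ler_wpM2l => //.
clear -Hrs z0; elim: rs Hrs => [|a rs IH] Hrs.
  by rewrite big_nil hornerC normr1 expr0.
rewrite big_cons hornerM normrM /= exprS; apply: ler_pM.
- by rewrite ler0c.
- by rewrite exprn_ge0 ?ler0c.
- rewrite !hornerE; apply: le_trans (Re_le_norm _).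
  by rewrite lecR ReD ReN lerDl oppr_ge0 ltW // Hrs // mem_head.
- by apply: IH => b brs; apply: Hrs; rewrite inE brs orbT.
Qed.

(** At a zero of the limit polynomial, the value at the parameter [s - d] is of order [d], against
    the bound of [stable_lead_bound]. Nothing is claimed on the axis itself. *)
Lemma stable_limit (R : realType) (A B : {poly R[i]}) n (s : R) : 0 < s ->
  (forall e, 0 <= e <= s -> size (A + e%:C%C *: B) = n.+1) ->
  (forall e, 0 <= e < s -> stable (A + e%:C%C *: B)) ->
  forall z : R[i], 0 < Re z -> (A + s%:C%C *: B).[z] != 0.
Proof.
move=> s0 Hsz Hst z z0; apply/eqP => E.
set G := A + s%:C%C *: B in E.
have ss : 0 <= s <= s by rewrite lexx ltW.
have sG := Hsz s ss; rewrite -/G in sG.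
set l := G`_n; have l0 : 0 < `|l|.
  by rewrite normr_gt0 /l -[n]/(n.+1.-1) -sG -lead_coefE lead_coef_eq0 -size_poly_eq0 sG.
pose r := Re z ^+ n; have r0 : 0 < r by rewrite exprn_gt0.
pose M := Re (`|B.[z]| + `|B`_n| * r%:C%C).
have M0 : 0 <= M by rewrite -ler0c Re_normE ?addr_ge0 ?mulr_ge0 // ler0c ltW.
pose lr := Re `|l| * r.
have lr0 : 0 < lr by rewrite mulr_gt0 // -ltcR Re_normE.
(* Small enough for [d M < lr], with [s - d] still in the segment. *)
pose d := Num.min s (lr / (M + 1) / 2).
have d0 : 0 < d by rewrite lt_min s0 !divr_gt0 // ltr_pwDr.
have Hd : 0 <= s - d < s by rewrite subr_ge0 ge_min lexx /= ltrBlDr ltrDl.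
have := stable_lead_bound (Hst _ Hd) (ltW z0).
have -> : A + (s - d)%:C%C *: B = G - d%:C%C *: B.
  by rewrite rcB scalerBl addrA.
have sz : size (G - d%:C%C *: B) = n.+1.
  have -> : G - d%:C%C *: B = A + (s - d)%:C%C *: B by rewrite rcB scalerBl addrA.
  by apply: Hsz; case/andP: Hd => -> /ltW ->.
rewrite lead_coefE sz /= coefB coefZ -/l hornerD E add0r hornerN hornerZ normrN normrM.
have -> : `|d%:C%C| = d%:C%C by rewrite ger0_norm // ler0c ltW.
rewrite -rcX -/r => H.
have : `|l| * r%:C%C <= d%:C%C * (`|B.[z]| + `|B`_n| * r%:C%C).
  rewrite mulrDr mulrA -lerBlDr; apply: le_trans H.
  rewrite -mulrBl; apply: ler_wpM2r; first by rewrite ler0c ltW.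
  have := lerB_dist l (d%:C%C * B`_n).
  by rewrite normrM (@ger0_norm _ d%:C%C) // ler0c ltW.
rewrite -(@Re_normE _ `|l|) // -(@Re_normE _ (_ + _)); last first.
  by rewrite addr_ge0 ?mulr_ge0 // ler0c ltW.
rewrite -/M -!rcM lecR -/lr; apply/negP; rewrite -ltNge.
have M1 : 0 < M + 1 by rewrite ltr_pwDr.
apply: (@le_lt_trans _ _ (lr / (M + 1) / 2 * M)).
  by apply: ler_wpM2r => //; rewrite ge_min lexx orbT.
rewrite mulrAC ltr_pdivrMr // mulrAC ltr_pdivrMr //.
by rewrite -mulrA ltr_pM2l //; lra.
Qed.

(** Connectedness: the supremum of the parameters up to which stability holds is attained, by
    [stable_limit] and the assumption on the axis, and [stable_open] prevents it from being less
    than [b]. *)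
Lemma stable_homotopy (R : realType) (A B : {poly R[i]}) n (b : R) :
  (size B <= n.+1)%N ->
  (forall e, 0 <= e <= b -> size (A + e%:C%C *: B) = n.+1) ->
  (forall e, 0 <= e <= b -> forall z : R[i], Re z = 0 -> (A + e%:C%C *: B).[z] != 0) ->
  stable A -> forall e, 0 <= e <= b -> stable (A + e%:C%C *: B).
Proof.
move=> sB Hsz Haxis stA.
pose S := [set e : R | 0 <= e <= b /\ forall x, 0 <= x <= e -> stable (A + x%:C%C *: B)].
have [b0|b0] := ltP b 0.
  by move=> e /andP[e0 /(le_trans e0)]; rewrite leNgt b0.
have S0 : S 0.
  split; first by rewrite lexx.
  by move=> x; rewrite -eq_le => /eqP <-; rewrite scale0r addr0.
have ubS : has_ubound S by exists b => e [/andP[]].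
have hsS : has_sup S by split; [exists 0|].
set s := sup S.
have s0 : 0 <= s by apply: ub_le_sup.
have sb : s <= b by apply: ge_sup; [exists 0|move=> e [/andP[]]].
have below x : 0 <= x < s -> stable (A + x%:C%C *: B).
  move=> /andP[x0 xs]; have [|e [_ He]] := @sup_adherent _ S (s - x) _ hsS.
    by rewrite subr_gt0.
  by rewrite subKr => /ltW xe; apply: He; rewrite x0.
have at_s : stable (A + s%:C%C *: B).
  have [->|sn0] := eqVneq s 0; first by rewrite scale0r addr0.
  have sp : 0 < s by rewrite lt0r sn0.
  move=> z; rewrite le_eqVlt => /predU1P[/esym z0|z0].
    by apply: Haxis z0; rewrite s0.
  apply: (@stable_limit _ _ _ n _ sp) z0 => // e /andP[e0 es]; apply: Hsz.
  by rewrite e0 (le_trans es).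
have [|d d0 Hd] := stable_open (Hsz s _) sB at_s; first by rewrite s0.
have [sltb|bs] := ltP s b; last first.
  have {}bs : s = b by apply/eqP; rewrite eq_le sb.
  move=> e /andP[e0]; rewrite -bs le_eqVlt => /predU1P[-> //|es].
  by apply: below; rewrite e0.
pose s' := Num.min b (s + d / 2).
have ss' : s < s' by rewrite lt_min sltb ltrDl divr_gt0.
suff : S s' by move/(ub_le_sup ubS); rewrite leNgt ss'.
split; first by rewrite (le_trans s0 (ltW ss')) ge_min lexx.
move=> x /andP[x0 xs']; have [xs|sx] := ltP x s; first by apply: below; rewrite x0.
have -> : A + x%:C%C *: B = A + s%:C%C *: B + (x - s)%:C%C *: B.
  by rewrite -addrA -scalerDl -rcD [s + _]addrC subrK.
apply: Hd; rewrite ger0_norm ?subr_ge0 // ltrBlDr addrC.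
apply: le_lt_trans xs' _; rewrite gt_min ltrD2l ltr_pdivrMr // ltr_pMr // ltr1n orbT.
by [].
Qed.

(** * Even and odd parts, and the Routh algorithm *)

Definition eo (A : nzRingType) (D N : {poly A}) : {poly A} :=
  D \Po 'X^2 + (N \Po 'X^2) * 'X.

Lemma coef_eo (A : comNzRingType) (D N : {poly A}) i :
  (eo D N)`_i = if odd i then N`_(i./2) else D`_(i./2).
Proof.
rewrite /eo coefD coefMX !coef_comp_poly_Xn // !dvdn2 !divn2.
case: i => [|i] /=; first by rewrite addr0.
by rewrite uphalf_half; case: (odd i) => /=; rewrite ?addr0 ?add0r.
Qed.

Lemma even_eo (A : comNzRingType) (D N : {poly A}) : even_poly (eo D N) = D.
Proof. by apply/polyP => i; rewrite coef_even_poly coef_eo odd_double doubleK. Qed.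

Lemma odd_eo (A : comNzRingType) (D N : {poly A}) : odd_poly (eo D N) = N.
Proof.
by apply/polyP => i; rewrite coef_odd_poly coef_eo /= odd_double /= uphalf_double.
Qed.

Lemma eo_even_odd (A : comNzRingType) (H : {poly A}) : eo (even_poly H) (odd_poly H) = H.
Proof. exact: poly_even_odd. Qed.

Lemma eoD (A : comNzRingType) (D N D' N' : {poly A}) : eo D N + eo D' N' = eo (D + D') (N + N').
Proof. by rewrite /eo !comp_polyD mulrDl addrACA. Qed.

Lemma eoZ (A : comNzRingType) c (D N : {poly A}) : c *: eo D N = eo (c *: D) (c *: N).
Proof. by rewrite /eo !comp_polyZ scalerDr scalerAl. Qed.

Lemma size_eo (A : comNzRingType) m (D N : {poly A}) :
  (size N <= uphalf m)%N -> (size D <= m./2.+1)%N -> (size (eo D N) <= m.+1)%N.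
Proof.
move=> sN sD; apply/leq_sizeP => j mj; rewrite coef_eo.
case: ifP => o; rewrite nth_default //.
  apply: leq_trans sN _; move: o mj; clear; lia.
apply: leq_trans sD _; move: o mj; clear; lia.
Qed.

Notation toC := (map_poly (real_complex _)).

Lemma horner_toC (R : realType) (P : {poly R}) (x : R) :
  (toC P).[x%:C%C] = (P.[x])%:C%C.
Proof. exact: horner_map. Qed.

Lemma horner_eo (A : comNzRingType) (D N : {poly A}) (z : A) :
  (eo D N).[z] = D.[z ^+ 2] + N.[z ^+ 2] * z.
Proof. by rewrite /eo hornerD hornerM !horner_comp hornerX hornerXn. Qed.

Lemma coef_toC (R : realType) (P : {poly R}) i : (toC P)`_i = (P`_i)%:C%C.
Proof. exact: coef_map. Qed.

Lemma rc_eq0 (R : realType) (a : R) : (a%:C%C == 0) = (a == 0).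
Proof. by rewrite eq_complex /= eqxx andbT. Qed.

Lemma toC_eo (R : realType) (D N : {poly R}) : toC (eo D N) = eo (toC D) (toC N).
Proof. by rewrite /eo rmorphD rmorphM /= !map_comp_poly map_polyXn map_polyX. Qed.

Lemma sqr_imaginary (R : realType) (z : R[i]) : Re z = 0 ->
  z ^+ 2 = (- Im z ^+ 2)%:C%C.
Proof.
case: z => a y /= ->; rewrite expr2; apply/eqP.
by rewrite eq_complex /= !mul0r mulr0 sub0r addr0 -expr2 !eqxx.
Qed.

(** Real coefficients separate the real and imaginary parts of the value: a root on the axis is 0 or
    a common zero of [D] and [N] at [- y ^ 2]. *)
Lemma horner_toC_eo_axis (R : realType) (D N : {poly R}) (z : R[i]) : Re z = 0 ->
  (toC (eo D N)).[z] =
    Complex (D.[- (Im z) ^+ 2]) (N.[- (Im z) ^+ 2] * Im z).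
Proof.
move=> z0; rewrite toC_eo horner_eo (sqr_imaginary z0).
case: z z0 => a y /= ->.
rewrite !horner_toC; apply/eqP; rewrite eq_complex /=.
by apply/andP; split; apply/eqP; ring.
Qed.

Lemma Re_inv_gt0 (R : realType) (x : R[i]) : 0 < Re x -> 0 < Re x^-1.
Proof.
case: x => a b /= a0; apply: divr_gt0 => //; apply: ltr_pwDl.
  by rewrite exprn_gt0.
exact: sqr_ge0.
Qed.

(** The quotient is the sum of [1 / (- a)] over the roots [a], each with positive real part. It
    yields the sign of a term of the continued fraction. *)
Lemma stable_coef1 (R : realType) (G : {poly R[i]}) : stable G -> (1 < size G)%N ->
  0 < Re (G`_1 / G`_0).
Proof.
move=> /stable_factor [rs [Grs Hrs sG' G0]] sG.
have srs : (0 < size rs)%N by rewrite -sG' -subn1 subn_gt0.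
rewrite Grs !coefZ -mulf_div divff ?lead_coef_eq0 // mul1r.
set p := \prod_(a <- rs) ('X - a%:P).
suff [p0 pge pgt] : [/\ p`_0 != 0, 0 <= Re (p`_1 / p`_0) &
    (0 < size rs)%N -> 0 < Re (p`_1 / p`_0)] by exact: pgt.
rewrite {}/p; clear -Hrs; elim: rs Hrs => [|a rs IH] Hrs.
  rewrite big_nil !coefC /= mul0r oner_eq0; split=> //; exact: lexx.
have [|p0 pge _] := IH; first by move=> b brs; apply: Hrs; rewrite inE brs orbT.
have a0 : Re a < 0 by apply: Hrs; rewrite mem_head.
have an0 : a != 0 by apply: contraTneq a0 => ->; rewrite ltxx.
rewrite big_cons mulrBl !coefB !coefXM /= sub0r !coefCM.
set p := \prod_(_ <- _) _ in p0 pge *.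
have -> : (p`_0 - a * p`_1) / - (a * p`_0) = (- a)^-1 + p`_1 / p`_0.
  by field; rewrite p0.
have h : 0 < Re ((- a)^-1 + p`_1 / p`_0).
  by rewrite ReD ltr_pwDl // Re_inv_gt0 // ReN oppr_gt0.
by rewrite oppr_eq0 mulf_neq0 // ltW.
Qed.

Lemma size_toC (R : realType) (P : {poly R}) : size (toC P) = size P.
Proof. by rewrite size_map_poly. Qed.

Lemma size_eq_of_coef (A : nzRingType) (P : {poly A}) m :
  (size P <= m.+1)%N -> P`_m != 0 -> size P = m.+1.
Proof.
move=> sP Pm; apply/eqP; rewrite eqn_leq sP ltnNge /=.
by apply: contra Pm => h; rewrite nth_default.
Qed.

(* The even part moves along the segment from [D] to [f1 D - N] while the odd part
   stays fixed; only at the end point does a root reach the imaginary axis, at [0],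
   and dividing by that root gives the next pair of the continued fraction. *)
Lemma routh_step (R : realType) m (D N : {poly R}) :
  (size N <= uphalf m.+1)%N -> (size D <= m.+1./2.+1)%N ->
  (eo D N)`_m.+1 != 0 -> stable (toC (eo D N)) ->
  let f1 := N`_0 / D`_0 in let M := drop_poly 1 (f1 *: D - N) in
  [/\ D`_0 != 0, 0 < f1, (eo N M)`_m != 0 & stable (toC (eo N M))].
Proof.
move=> sN sD lead st f1 M.
have Nhi : N`_(m./2.+1) = 0 by rewrite nth_default.
have sE := size_eq_of_coef (size_eo sN sD) lead.
have D0 : D`_0 != 0.
  have := st 0 (lexx _); apply: contra => /eqP D0.
  rewrite toC_eo horner_eo mulr0 addr0 expr0n /= horner_coef0 coef_toC D0.
  exact: eqxx (0 : R[i]).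
have f1pos : 0 < f1.
  have := stable_coef1 st; rewrite size_toC sE => /(_ isT).
  by rewrite !coef_toC -rcV -rcM !coef_eo.
have EM : 'X * M = f1 *: D - N by apply: mulX_drop; exact: coef0_step.
have EX : eo N M * 'X = eo (f1 *: D - N) N.
  by rewrite -EM /eo comp_polyM comp_polyX mulrDl -mulrA -expr2 addrC ['X^2 * _]mulrC.
have lead' : (eo N M)`_m != 0.
  have : (eo N M * 'X)`_m.+1 != 0.
    rewrite EX; move: lead; rewrite !coef_eo.
    case: ifP => // om; rewrite !coefB coefZ.
    have -> : (m.+1./2 = m./2.+1)%N by move: om; clear; rewrite /=; lia.
    by rewrite Nhi subr0 => Dn; rewrite mulf_neq0 // gt_eqF.
  by rewrite coefMX.
split=> //.
pose A := toC (eo D N).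
pose B := toC (eo ((f1 - 1) *: D - N) 0).
have AB (e : R) : A + e%:C%C *: B = toC (eo ((1 + e * (f1 - 1)) *: D - e *: N) N).
  rewrite /A /B -map_polyZ -rmorphD eoZ eoD /= scaler0 addr0 scalerBr scalerA.
  by rewrite addrA scalerDl scale1r.
(* A convex combination of 1 and [f1], so the leading coefficient never vanishes along the
   segment. *)
have a0 (e : R) : 0 <= e <= 1 -> 0 < 1 + e * (f1 - 1) by move=> /andP[? ?]; nra.
have sAB (e : R) : 0 <= e <= 1 -> size (A + e%:C%C *: B) = m.+2.
  move=> e01; rewrite AB size_toC; apply: size_eq_of_coef.
    apply: size_eo => //.
    rewrite (leq_trans (size_polyD _ _)) // size_polyN geq_max.
    rewrite !(leq_trans (size_scale_leq _ _)) //.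
    by move: sN; clear; move: (size _) => x; rewrite /=; lia.
  move: lead; rewrite !coef_eo; case: ifP => // om; rewrite coefB !coefZ.
  have -> : (m.+1./2 = m./2.+1)%N by move: om; clear; rewrite /=; lia.
  by rewrite Nhi mulr0 subr0 => Dn; rewrite mulf_neq0 // gt_eqF ?a0.
have sB : (size B <= m.+2)%N.
  rewrite size_toC; apply: size_eo; rewrite ?size_poly0 //.
  rewrite (leq_trans (size_polyD _ _)) // size_polyN geq_max.
  rewrite !(leq_trans (size_scale_leq _ _)) //.
  by move: sN; clear; move: (size _) => x; rewrite /=; lia.
(* Where [N] vanishes, so does [D], which the stability of the starting polynomial forbids; at 0 the
   even part is [(1 - e) D(0)]. *)
have axis (e : R) (z : R[i]) : 0 <= e <= 1 -> Re z = 0 ->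
    (A + e%:C%C *: B).[z] = 0 -> e = 1 /\ z = 0.
  move=> e01 z0; rewrite AB horner_toC_eo_axis // => /eqP.
  rewrite eq_complex /= !hornerE mulf_eq0 => /andP[/eqP ED /orP[/eqP EN|/eqP y0]].
    move: ED; rewrite EN mulr0 subr0 => /eqP.
    rewrite mulf_eq0 gt_eqF ?a0 //= => /eqP ED.
    have := st z; rewrite z0 => /(_ (lexx _)).
    by rewrite horner_toC_eo_axis // ED EN mul0r eqxx.
  move: ED; rewrite y0 expr0n /= oppr0 !horner_coef0.
  have -> : N`_0 = f1 * D`_0 by rewrite divfK.
  rewrite mulrA -mulrBl => /eqP; rewrite mulf_eq0 (negbTE D0) orbF => /eqP E.
  split; first by lra.
  by apply/eqP; rewrite eq_complex /= z0 y0 !eqxx.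
have stAB (e : R) : 0 <= e < 1 -> stable (A + e%:C%C *: B).
  move=> /andP[e0 e1]; apply: (stable_homotopy (n := m.+1) (b := e)) => //.
  - by move=> x /andP[x0 xe]; apply: sAB; rewrite x0 (le_trans xe) // ltW.
  - move=> x /andP[x0 xe] z z0; apply/eqP => /axis -/(_ _ z0) [|x1 _].
      by rewrite x0 (le_trans xe) // ltW.
    by move: (le_lt_trans xe e1); rewrite x1 ltxx.
  - by rewrite e0 lexx.
have E1 z : (A + 1%:C%C *: B).[z] = (toC (eo N M)).[z] * z.
  rewrite AB (_ : 1 + 1 * (f1 - 1) = f1); last by ring.
  rewrite scale1r -EX rmorphM /= map_polyX.
  by rewrite hornerM hornerX.
(* On the axis, [axis] applies outside 0, and at 0 the value is [N(0) = f1 D(0)]; in the open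
   half-plane [stable_limit] applies. *)
move=> z; rewrite le_eqVlt => /predU1P[/esym z0|z0].
  have [->|zn0] := eqVneq z 0.
    rewrite toC_eo horner_eo mulr0 addr0 expr0n /= horner_coef0 coef_toC.
    rewrite rc_eq0.
    by apply: contraTneq f1pos => N0; rewrite /f1 N0 mul0r ltxx.
  apply/eqP => E; have [||_] := axis 1 z _ z0.
  - by rewrite ler01 lexx.
  - by rewrite E1 E mul0r.
  - by move/eqP; rewrite (negbTE zn0).
have /(_ z z0) := stable_limit ltr01 sAB stAB.
by rewrite E1 mulf_eq0 negb_or => /andP[].
Qed.

Theorem hurwitz_stieltjes (R : realType) m (D N : {poly R}) :
  (size N <= uphalf m)%N -> (size D <= m./2.+1)%N ->
  (eo D N)`_m != 0 -> stable (toC (eo D N)) ->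
  exists f : seq R, [/\ size f = m, {in f, forall a, 0 < a},
    D`_0 != 0, N = D`_0 *: cfN f & D = D`_0 *: cfD f].
Proof.
elim: m D N => [|m IH] D N sN sD lead st.
  exists [::]; rewrite /= scaler0 -mul_polyC mulr1 -(size1_polyC sD).
  split=> //; first by move: lead; rewrite coef_eo.
  by apply/eqP; rewrite -size_poly_leq0.
have [D0 f1pos lead' st'] := routh_step sN sD lead st.
set f1 := N`_0 / D`_0 in f1pos lead' st'.
set M := drop_poly 1 _ in lead' st'.
have EM : 'X * M = f1 *: D - N by apply: mulX_drop; exact: coef0_step.
have EN0 : N`_0 = f1 * D`_0 by rewrite divfK.
have [||f [sf fpos N0 EM' EN]] := IH N M _ _ lead' st'.
- rewrite size_drop_poly leq_subLR add1n (leq_trans (size_polyD _ _)) // size_polyN.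
  rewrite geq_max (leq_trans (size_scale_leq _ _)) //=.
  by move: sN; clear; move: (size _) => x; rewrite /=; lia.
- exact: sN.
rewrite EN0 in EM' EN; exists (f1 :: f); split=> //.
- by rewrite /= sf.
- by move=> a; rewrite inE => /predU1P[->|/fpos].
- by rewrite EN /= scalerA mulrC.
apply: (scalerI (lt0r_neq0 f1pos)).
rewrite -[f1 *: D in LHS](subrK N) -EM EM' EN -scalerAr -scalerDr scalerA.
by rewrite cfD_cons [cfD f + _]addrC.
Qed.

(** On the axis a root would be a common zero of [cfD f] and [cfN f], excluded by
    [cf_wronskian_pos], or 0, where [cfD f] is 1. In the open half-plane [g = z h(z ^ 2)], with [h]
    the fraction, has nonnegative real part, so [1 + g] is not 0. *)
Lemma cf_stable (R : realType) (f : seq R) : {in f, forall a, 0 < a} ->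
  stable (toC (eo (cfD f) (cfN f))).
Proof.
move=> fpos z; rewrite le_eqVlt => /predU1P[/esym z0|z0].
  rewrite horner_toC_eo_axis //; apply/eqP => E.
  move/eqP: E; rewrite eq_complex /= mulf_eq0 => /andP[/eqP ED /orP[/eqP EN|/eqP y0]]; last first.
    move: ED; rewrite y0 expr0n /= oppr0 horner_coef0 cfD_coef0 => /eqP.
    by rewrite oner_eq0.
  case: (posnP (size f)) => [/size0nil f0|f0].
    by move: ED; rewrite f0 /= hornerC => /eqP; rewrite oner_eq0.
  have [_] := cf_wronskian_pos (- Im z ^+ 2) fpos f0.
  by rewrite !hornerE ED EN !(mulr0, mul0r, subr0) ltxx.
rewrite toC_eo horner_eo.
suff [d0 r0] : (toC (cfD f)).[z ^+ 2] != 0 /\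
    0 <= Re ((toC (cfN f)).[z ^+ 2] * z / (toC (cfD f)).[z ^+ 2]).
  set d := _.[_] in d0 r0 *; set g := _ * z in r0 *.
  have -> : d + g = d * (1 + g / d) by field.
  rewrite mulf_neq0 //; apply/eqP => /(congr1 (@complex.Re R)); rewrite ReD /= => E.
  by move: r0; lra.
elim: f fpos => [|a l IH] fpos.
  rewrite /= rmorph0 rmorph1 horner0 hornerC !mul0r oner_eq0.
  by split=> //; exact: lexx.
have [|d0 r0] := IH; first by move=> b bl; apply: fpos; rewrite inE bl orbT.
have a0 : 0 < a by apply: fpos; rewrite mem_head.
rewrite cfN_cons cfD_cons rmorphD rmorphM /= map_polyX map_polyZ hornerD hornerM hornerZ hornerX.
set d := _.[_] in d0 r0 *; set n := _.[_] in r0 *.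
have zn0 : z != 0 by apply: contraTneq z0 => ->; rewrite ltxx.
(* A new term replaces [g] by [a / (z^-1 + g)], which again has nonnegative real part. *)
have s0 : 0 < Re (z^-1 + n * z / d) by rewrite ReD ltr_pwDl // Re_inv_gt0.
have E : d + z ^+ 2 * n = d * z * (z^-1 + n * z / d) by field; rewrite zn0 d0.
have sn0 : z^-1 + n * z / d != 0 by apply: contraTneq s0 => ->; rewrite ltxx.
rewrite E; split; first by rewrite !mulf_neq0.
have -> : a%:C%C * d * z / (d * z * (z^-1 + n * z / d)) = a%:C%C * (z^-1 + n * z / d)^-1.
  have dz0 : d * z != 0 by rewrite mulf_neq0.
  move: (z^-1 + _) => s; rewrite -[a%:C%C * d * z]mulrA.
  by rewrite [a%:C%C * _]mulrC -mulf_div divff // mul1r.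
by rewrite ReZ mulr_ge0 ?ltW // Re_inv_gt0.
Qed.

(** * The transform of P into H_P *)

(** Lets polynomial identities be checked away from the poles of Moebius transformations. *)
Lemma poly_eq_eval (F : numFieldType) (s : seq F) (p q : {poly F}) :
  (forall z, z \notin s -> p.[z] = q.[z]) -> p = q.
Proof.
move=> H; apply/eqP; rewrite -subr_eq0.
have P0 : \prod_(a <- s) ('X - a%:P) != 0 :> {poly F}.
  by rewrite monic_neq0 // monic_prod_XsubC.
rewrite -(mulIr_eq0 _ (mulIf P0)).
set r := _ * _; apply: contraT => r0.
have rz z : root r z.
  rewrite /root hornerM hornerD hornerN; have [zs|/H ->] := boolP (z \in s).
    by rewrite horner_prod (big_rem z) //= hornerXsubC subrr mul0r mulr0.
  by rewrite subrr mul0r.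
have := max_poly_roots (rs := [seq i%:R | i <- iota 0 (size r)]) r0.
rewrite size_map size_iota ltnn; apply.
  by apply/allP => z _.
by rewrite map_inj_uniq ?iota_uniq //; exact: mulrIn (oner_neq0 _).
Qed.

Lemma hur_eval (F : fieldType) m (P : {poly F}) (z : F) : (size P <= m.+1)%N ->
  z + 1 != 0 -> (hur m P).[z] = (z + 1) ^+ m * P.[(z - 1) / (z + 1)].
Proof.
move=> sP z1; rewrite (horner_coef_wide _ sP) mulr_sumr horner_sum.
apply: eq_bigr => i _; rewrite !hornerE.
have -> : (z + 1) ^+ m = (z + 1) ^+ (m - i) * (z + 1) ^+ i.
  by rewrite -exprD subnK // -ltnS.
rewrite expr_div_n; set a := (z + 1) ^+ (m - i).
have : (z + 1) ^+ i != 0 by rewrite expf_neq0.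
by move: (_ ^+ i) => b b0; rewrite /=; field.
Qed.

Lemma hur_evalN1 (A : comNzRingType) m (P : {poly A}) :
  (hur m P).[-1] = (- 2) ^+ m * P`_m.
Proof.
rewrite /hur horner_sum big_ord_recr /= big1 => [|i _].
  rewrite add0r subnn expr0 mulr1 hornerZ horner_exp !hornerE /= mulrC.
  by congr (_ ^+ _ * _); ring.
by rewrite hornerZ hornerM !horner_exp !hornerE addNr expr0n subn_eq0 leqNgt ltn_ord /= !mulr0.
Qed.

Lemma hur_eval1 (A : comNzRingType) m (P : {poly A}) :
  (hur m P).[1] = 2 ^+ m * P`_0.
Proof.
rewrite /hur horner_sum big_ord_recl /= big1 => [|i _].
  by rewrite addr0 subn0 expr0 mul1r hornerZ horner_exp !hornerE mulrC.
by rewrite hornerZ hornerM !horner_exp !hornerE subrr expr0n [_ == _]/= /= mulr0 mul0r.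
Qed.

Lemma hur_lead (A : comNzRingType) m (P : {poly A}) : (size P <= m.+1)%N ->
  (hur m P)`_m = P.[1].
Proof.
move=> sP; rewrite /hur coef_sum (horner_coef_wide _ sP).
apply: eq_bigr => i _; rewrite coefZ expr1n; congr (_ * _).
have M1 : ('X - 1 : {poly A}) \is monic by rewrite -(rmorph1 polyC) monicXsubC.
have M2 : ('X + 1 : {poly A}) \is monic.
  by rewrite -[1]opprK -(rmorph1 polyC) -rmorphN monicXsubC.
have s1 : size ('X - 1 : {poly A}) = 2%N by rewrite -(rmorph1 polyC) size_XsubC.
have s2 : size ('X + 1 : {poly A}) = 2%N.
  by rewrite -[1]opprK -(rmorph1 polyC) -rmorphN size_XsubC.
have M : ('X - 1) ^+ i * ('X + 1) ^+ (m - i) \is @monic A.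
  by rewrite monicMl ?monic_exp.
have S : size (('X - 1) ^+ i * ('X + 1) ^+ (m - i) : {poly A}) = m.+1.
  rewrite size_monicM ?monic_exp ?monic_neq0 ?monic_exp //.
  have sz p k : p \is @monic A -> size p = 2%N -> size (p ^+ k) = k.+1.
    move=> pm sp; elim: k => [|k IH]; first by rewrite expr0 size_poly1.
    by rewrite exprS size_monicM ?monic_neq0 ?monic_exp // IH sp.
  rewrite !sz //; have := ltn_ord i; lia.
by move/monicP: M; rewrite lead_coefE S.
Qed.

Lemma normc_le (R : realType) (x y : R[i]) :
  (`|x| <= `|y|) = (Re x ^+ 2 + Im x ^+ 2 <= Re y ^+ 2 + Im y ^+ 2).
Proof.
by rewrite !normc_def lecR ler_sqrt // addr_ge0 ?sqr_ge0.
Qed.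

(** [(z - 1) / (z + 1)] maps the closed right half-plane onto the closed unit disc without 1. That
    point corresponds to infinity and is covered by the leading coefficient, equal to [P(1)]. *)
Lemma expansive_stable (R : realType) m (P : {poly R}) : (0 < m)%N ->
  size P = m.+1 ->
  expansive P <-> stable (toC (hur m P)) /\ (hur m P)`_m != 0.
Proof.
move=> m0 sP; have sPC : (size (toC P) <= m.+1)%N by rewrite size_toC sP.
rewrite hur_lead ?sP // -hur_map.
have ReD1 (z : R[i]) : 0 <= Re z -> z + 1 != 0.
  by move=> z0; apply/eqP => /(congr1 (@complex.Re R)); rewrite ReD /=; lra.
split=> [[_ Hroot]|[st P1]].
  split.
    move=> z z0; rewrite hur_eval ?ReD1 // mulf_neq0 ?expf_neq0 ?ReD1 //.
    apply/negP => /Hroot; rewrite normf_div.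
    rewrite ltr_pdivlMr ?normr_gt0 ?ReD1 // mul1r; apply/negP/negbT/le_gtF.
    by rewrite normc_le; case: z z0 => a b /=; nra.
  apply/eqP => P1; have := Hroot 1.
  rewrite normr1 ltxx => h; apply/notF/h.
  by rewrite /root -[1](rmorph1 (real_complex R)) horner_toC P1.
split; first by rewrite sP.
move=> x rx; rewrite real_ltNge ?normr_real // ?real1; apply/negP => x1.
have xn1 : 1 - x != 0.
  rewrite subr_eq0; apply: contra P1 => /eqP xE.
  by move: rx; rewrite -xE /root -[1](rmorph1 (real_complex R)) horner_toC rc_eq0.
set z := (1 + x) / (1 - x).
have z1 : z + 1 != 0.
  have -> : z + 1 = 2 / (1 - x) by rewrite /z; field.
  by rewrite mulf_neq0 ?invr_eq0 // pnatr_eq0.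
have Rez : 0 <= Re z.
  move: x1; rewrite -[1 in leRHS](@normr1 R[i]) normc_le /z.
  clear; case: x => a b /= h; rewrite ?sub0r.
  set d := (1 - a) ^+ 2 + _ ^+ 2; have d0 : 0 <= d by rewrite addr_ge0 ?sqr_ge0.
  have -> : (1 + a) * ((1 - a) / d) - (0 + b) * - (- b / d) = (1 - a ^+ 2 - b ^+ 2) / d.
    by ring.
  by rewrite divr_ge0 //; nra.
have := st z Rez; rewrite hur_eval // mulf_eq0 negb_or => /andP[_].
have -> : (z - 1) / (z + 1) = x.
  have -> : z - 1 = 2 * x / (1 - x) by rewrite /z; field.
  have -> : z + 1 = 2 / (1 - x) by rewrite /z; field.
  by field; rewrite xn1.
by move/negP; apply.
Qed.

(** Reversal with respect to a fixed degree, unlike [reciprocal], hence linear. *)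
Definition rev_poly (A : nzRingType) m (P : {poly A}) : {poly A} :=
  \poly_(i < m.+1) P`_(m - i).

Lemma reciprocalE (A : nzRingType) m (P : {poly A}) : size P = m.+1 ->
  reciprocal P = rev_poly m P.
Proof. by move=> sP; rewrite /reciprocal sP. Qed.

Lemma rev_polyD (A : nzRingType) m (P Q : {poly A}) :
  rev_poly m (P + Q) = rev_poly m P + rev_poly m Q.
Proof.
by apply/polyP => i; rewrite coefD !coef_poly; case: ifP; rewrite ?coefD ?addr0.
Qed.

Lemma rev_polyN (A : nzRingType) m (P : {poly A}) : rev_poly m (- P) = - rev_poly m P.
Proof.
by apply/polyP => i; rewrite coefN !coef_poly; case: ifP; rewrite ?coefN ?oppr0.
Qed.

Lemma rev_polyZ (A : nzRingType) m a (P : {poly A}) : rev_poly m (a *: P) = a *: rev_poly m P.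
Proof.
by apply/polyP => i; rewrite coefZ !coef_poly; case: ifP; rewrite ?coefZ ?mulr0.
Qed.

Lemma rev_poly_map (A B : nzRingType) (phi : {rmorphism A -> B}) m (P : {poly A}) :
  rev_poly m (map_poly phi P) = map_poly phi (rev_poly m P).
Proof.
apply/polyP => i; rewrite coef_map [LHS]coef_poly [X in _ = phi X]coef_poly coef_map.
by case: ifP => // _; rewrite rmorph0.
Qed.

Lemma rev_poly_eval (F : fieldType) m (P : {poly F}) z : (size P <= m.+1)%N ->
  z != 0 -> (rev_poly m P).[z] = z ^+ m * P.[z^-1].
Proof.
move=> sP z0; rewrite (horner_coef_wide _ sP) mulr_sumr horner_poly.
rewrite (reindex_inj rev_ord_inj) /=; apply: eq_bigr => i _.
have im : (i <= m)%N by rewrite -ltnS.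
rewrite subSS subKn //.
have -> : z ^+ m = z ^+ (m - i) * z ^+ i by rewrite -exprD subnK.
rewrite exprVn.
have : z ^+ i != 0 by rewrite expf_neq0.
by move: (_ ^+ i) => b b0; field.
Qed.

(* Multiply the reciprocal polynomial evaluated at [(z - 1) / (z + 1)] by
   [(z + 1) ^ m]: inversion becomes [z -> - z]. *)
Lemma hur_rev (F : fieldType) m (P : {poly F}) z : (size P <= m.+1)%N -> ~~ odd m ->
  z + 1 != 0 -> z - 1 != 0 ->
  (z + 1) ^+ m * (rev_poly m P).[(z - 1) / (z + 1)] = (hur m P).[- z].
Proof.
move=> sP em z1 z2.
have z3 : - z + 1 != 0 by rewrite -oppr_eq0 opprD opprK.
rewrite rev_poly_eval ?mulf_neq0 ?invr_eq0 // hur_eval //.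
rewrite expr_div_n mulrA invfM invrK.
rewrite [(z + 1) ^+ m * _]mulrC divfK ?expf_neq0 //.
have -> : (- z + 1) ^+ m = (z - 1) ^+ m.
  have -> : - z + 1 = - (z - 1) by ring.
  by rewrite exprNn -signr_odd (negbTE em) expr0 mul1r.
congr (_ * _.[_]).
have -> : - z - 1 = - (z + 1) by ring.
have -> : - z + 1 = - (z - 1) by ring.
by rewrite invrN mulrNN mulrC.
Qed.

Lemma hur_plus (F : numFieldType) m (T P : {poly F}) :
  (size T <= m.+1)%N -> (size P <= m.+1)%N -> ~~ odd m ->
  ('X - 1) * T = 'X * P - rev_poly m P ->
  hur m T = eo (even_poly (hur m P) - 'X * odd_poly (hur m P)) 0.
Proof.
move=> sT sP em E.
apply: (@poly_eq_eval _ [:: 1; -1]) => z; rewrite !inE negb_or => /andP[z1 z2].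
have {}z1 : z - 1 != 0 by rewrite subr_eq0.
have {}z2 : z + 1 != 0 by rewrite -[1]opprK subr_eq0.
have {}E : ((z - 1) / (z + 1) - 1) * T.[(z - 1) / (z + 1)] =
    (z - 1) / (z + 1) * P.[(z - 1) / (z + 1)] - (rev_poly m P).[(z - 1) / (z + 1)].
  by have := congr1 (fun p => p.[(z - 1) / (z + 1)]) E; rewrite !hornerE.
have h1 := hur_eval sT z2; have h2 := hur_eval sP z2; have h3 := hur_rev sP em z2 z1.
have : (z - 1 - (z + 1)) * (hur m T).[z] =
  (z - 1) * (hur m P).[z] - (z + 1) * (hur m P).[- z].
  rewrite h1 h2 -h3.
  transitivity ((z + 1) ^+ m.+1 * (((z - 1) / (z + 1) - 1) * T.[(z - 1) / (z + 1)])).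
    by rewrite exprS; field.
  by rewrite E exprS; field.
have hP w : (hur m P).[w] = (even_poly (hur m P)).[w ^+ 2] + (odd_poly (hur m P)).[w ^+ 2] * w.
  by rewrite -horner_eo eo_even_odd.
rewrite horner_eo !(hornerD, hornerN, hornerM, hornerX, horner0) !hP sqrrN => {}E.
apply: (@mulfI _ (z - 1 - (z + 1))).
  have -> : z - 1 - (z + 1) = - 2 by ring.
  by rewrite oppr_eq0 pnatr_eq0.
by rewrite E; ring.
Qed.

(** Here the equation becomes [2 z H_T(z) = (z - 1) H_P(z) + (z + 1) H_P(- z)], whose right-hand
    side is [2 z (D - N)]; hence 0 is among the excluded points. *)
Lemma hur_minus (F : numFieldType) m (T P : {poly F}) :
  (size T <= m.+1)%N -> (size P <= m.+1)%N -> ~~ odd m ->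
  ('X + 1) * T = 'X * P + rev_poly m P ->
  hur m T = eo (even_poly (hur m P) - odd_poly (hur m P)) 0.
Proof.
move=> sT sP em E.
apply: (@poly_eq_eval _ [:: 0; 1; -1]) => z; rewrite !inE !negb_or => /and3P[z0 z1 z2].
have {}z1 : z - 1 != 0 by rewrite subr_eq0.
have {}z2 : z + 1 != 0 by rewrite -[1]opprK subr_eq0.
have {}E : ((z - 1) / (z + 1) + 1) * T.[(z - 1) / (z + 1)] =
    (z - 1) / (z + 1) * P.[(z - 1) / (z + 1)] + (rev_poly m P).[(z - 1) / (z + 1)].
  by have := congr1 (fun p => p.[(z - 1) / (z + 1)]) E; rewrite !hornerE.
have h1 := hur_eval sT z2; have h2 := hur_eval sP z2; have h3 := hur_rev sP em z2 z1.
have : (z - 1 + (z + 1)) * (hur m T).[z] =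
  (z - 1) * (hur m P).[z] + (z + 1) * (hur m P).[- z].
  rewrite h1 h2 -h3.
  transitivity ((z + 1) ^+ m.+1 * (((z - 1) / (z + 1) + 1) * T.[(z - 1) / (z + 1)])).
    by rewrite exprS; field.
  by rewrite E exprS; field.
have hP w : (hur m P).[w] = (even_poly (hur m P)).[w ^+ 2] + (odd_poly (hur m P)).[w ^+ 2] * w.
  by rewrite -horner_eo eo_even_odd.
rewrite horner_eo !(hornerD, hornerN, hornerM, hornerX, horner0) !hP sqrrN => {}E.
apply: (@mulfI _ (z - 1 + (z + 1))).
  have -> : z - 1 + (z + 1) = 2 * z by ring.
  by rewrite mulf_neq0 ?pnatr_eq0.
by rewrite E; ring.
Qed.

Lemma hur_self (F : numFieldType) m (T : {poly F}) :
  (size T <= m.+1)%N -> ~~ odd m -> T = rev_poly m T ->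
  hur m T = eo (even_poly (hur m T)) 0.
Proof.
move=> sT em E.
apply: (@poly_eq_eval _ [:: 1; -1]) => w; rewrite !inE negb_or => /andP[w1 w2].
have {}w1 : w - 1 != 0 by rewrite subr_eq0.
have {}w2 : w + 1 != 0 by rewrite -[1]opprK subr_eq0.
have : (hur m T).[w] = (hur m T).[- w].
  by rewrite -(hur_rev sT em w2 w1) -E hur_eval.
have hT u : (hur m T).[u] = (even_poly (hur m T)).[u ^+ 2] + (odd_poly (hur m T)).[u ^+ 2] * u.
  by rewrite -horner_eo eo_even_odd.
rewrite horner_eo horner0 !hT sqrrN.
move=> /addrI /eqP; rewrite mulrN -addr_eq0 -mulr2n mulrn_eq0 /= => /eqP ->.
by rewrite mul0r.
Qed.

Lemma polyR_of_int_inj (R : realType) : injective (polyR_of_int R).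
Proof. by apply: map_inj_poly; [exact: intr_inj|rewrite mulr0z]. Qed.

Lemma size_polyR (R : realType) (P : {poly int}) : size (polyR_of_int R P) = size P.
Proof. by rewrite size_map_inj_poly //; exact: intr_inj. Qed.

Lemma polyR_rev (R : realType) m (P : {poly int}) :
  polyR_of_int R (rev_poly m P) = rev_poly m (polyR_of_int R P).
Proof. by rewrite /polyR_of_int -(rev_poly_map (intmul 1)). Qed.

Lemma toC_polyR_of_int (R : realType) (P : {poly int}) : toC (polyR_of_int R P) = polyC_of_int R P.
Proof.
apply/polyP => i; rewrite !coef_map_id0 ?mulr0z //.
exact: rmorph_int.
Qed.

Lemma hur_inj (F : numFieldType) m (P Q : {poly F}) :
  (size P <= m.+1)%N -> (size Q <= m.+1)%N -> hur m P = hur m Q -> P = Q.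
Proof.
move=> sP sQ E; apply: (@poly_eq_eval _ [:: 1]) => x; rewrite inE => x1.
have {}x1 : 1 - x != 0 by rewrite subr_eq0 eq_sym.
pose z := (1 + x) / (1 - x).
have E1 : z + 1 = 2 / (1 - x) by rewrite /z; field.
have z1 : z + 1 != 0 by rewrite E1 mulf_neq0 ?invr_eq0 // pnatr_eq0.
have E2 : (z - 1) / (z + 1) = x.
  have -> : z - 1 = 2 * x / (1 - x) by rewrite /z; field.
  by rewrite E1; field; rewrite x1.
have := congr1 (fun p => p.[z]) E; rewrite !hur_eval // E2.
by apply: mulfI; rewrite expf_neq0.
Qed.

Lemma cf_of_stieltjes_tuple (R : realType) m (P : {poly int}) (x : 'cV[R]_m) :
  (0 < m)%N -> size P = m.+1 -> stieltjes_tuple_of P x ->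
  let H := hur m (polyR_of_int R P) in
  col_seq x = cf_expand m (odd_poly H) (even_poly H).
Proof.
move=> m0 sP /(stieltjes_tuple_ofP x m0 sP) [xpos [c c0 [EN ED]]] H.
rewrite /H EN ED.
have x0 : {in col_seq x, forall a, a != 0}.
  by apply/(col_seqP x (fun a => a != 0)) => j; rewrite lt0r_neq0.
have := @cf_expand_cf _ (col_seq x) c%:P 0 _ x0.
by rewrite size_col_seq addn0 cats0 -!mul_polyC => -> //; rewrite coefC.
Qed.

Lemma stieltjes_tuple_uniq (R : realType) m (P : {poly int}) (x y : 'cV[R]_m) :
  (0 < m)%N -> size P = m.+1 -> stieltjes_tuple_of P x -> stieltjes_tuple_of P y ->
  x = y.
Proof.
move=> m0 sP hx hy; apply: col_seq_inj.
by rewrite (cf_of_stieltjes_tuple m0 sP hx) (cf_of_stieltjes_tuple m0 sP hy).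
Qed.

(** The tuple determines [H_P] up to a scale, which [H_P(-1) = (- 2) ^ m] fixes for a monic [P]. *)
Lemma stieltjes_tuple_inj (R : realType) m (P P' : {poly int}) (x : 'cV[R]_m) :
  (0 < m)%N -> size P = m.+1 -> size P' = m.+1 -> P \is monic -> P' \is monic ->
  stieltjes_tuple_of P x -> stieltjes_tuple_of P' x -> P = P'.
Proof.
move=> m0 sP sP' mP mP'.
move=> /(stieltjes_tuple_ofP x m0 sP) [_ [c c0 [EN ED]]].
move=> /(stieltjes_tuple_ofP x m0 sP') [_ [c' c'0 [EN' ED']]].
have lead (Q : {poly int}) : size Q = m.+1 -> Q \is monic -> (polyR_of_int R Q)`_m = 1.
  by move=> sQ mQ; rewrite coef_map -[m]/(m.+1.-1) -sQ -lead_coefE (monicP mQ).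
have E (Q : {poly int}) d : odd_poly (hur m (polyR_of_int R Q)) = d *: cfN (col_seq x) ->
    even_poly (hur m (polyR_of_int R Q)) = d *: cfD (col_seq x) ->
    hur m (polyR_of_int R Q) = d *: eo (cfD (col_seq x)) (cfN (col_seq x)).
  by move=> e1 e2; rewrite -[LHS]eo_even_odd e1 e2 eoZ.
have {EN ED} H1 := E P c EN ED; have {EN' ED'} H2 := E P' c' EN' ED'.
have h1 := hur_evalN1 m (polyR_of_int R P); have h2 := hur_evalN1 m (polyR_of_int R P').
rewrite lead // H1 hornerZ in h1; rewrite lead // H2 hornerZ -h1 in h2.
have e0 : (eo (cfD (col_seq x)) (cfN (col_seq x))).[-1] != 0.
  apply/eqP => e; move: h1; rewrite e mulr0 mulr1 => /esym/eqP.
  by rewrite expf_eq0 oppr_eq0 pnatr_eq0 andbF.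
have cc : c' = c by apply: (mulIf e0).
apply: (@polyR_of_int_inj R); apply: (@hur_inj _ m); rewrite ?size_polyR ?sP ?sP' //.
by rewrite H1 H2 cc.
Qed.

Lemma expansive_tuple (R : realType) m (P : {poly int}) : (0 < m)%N ->
  size P = m.+1 -> expansive (polyR_of_int R P) ->
  exists x : 'cV[R]_m, stieltjes_tuple_of P x.
Proof.
move=> m0 sP; have sPR : size (polyR_of_int R P) = m.+1 by rewrite size_polyR.
move=> /(expansive_stable m0 sPR) [st lead].
have [sN sD] := size_odd_even (size_hur m (polyR_of_int R P)).
rewrite -[hur _ _]eo_even_odd in st lead.
have [f [sf fpos D0 EN ED]] := hurwitz_stieltjes sN sD lead st.
exists (seq_col m f); apply/(stieltjes_tuple_ofP _ m0 sP).
split; first by apply/(col_seqP _ (fun a => 0 < a)); rewrite seq_colK.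
by exists (even_poly (hur m (polyR_of_int R P)))`_0; rewrite ?seq_colK.
Qed.

(** For odd [m] reciprocity would give [T(-1) = - T(-1)]. *)
Lemma even_degree (m : nat) (T : {poly int}) : size T = m.+1 ->
  reciprocal T = T -> ~~ root T (-1) -> ~~ odd m.
Proof.
move=> sT; rewrite (reciprocalE sT) => rT; apply: contra => om.
have : (rev_poly m T).[-1] = - T.[-1].
  rewrite horner_poly (reindex_inj rev_ord_inj) (horner_coef_wide _ (n := m.+1)) ?sT //.
  rewrite -sumrN; apply: eq_bigr => i _ /=.
  have im : (i <= m)%N by rewrite -ltnS.
  rewrite subSS subKn // -mulrN -[in LHS]signr_odd oddB // om addTb -[in RHS]signr_odd.
  by case: (odd i); rewrite ?opprK.
by rewrite rT /root; move: T.[-1] => a E; apply/eqP; lia.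
Qed.

(** * The equations of [P_T^+] and [P_T^-], and the hypersurface *)

Section PT.
Variables (R : realType) (m : nat) (T : {poly int}).
Hypotheses (m0 : (0 < m)%N) (em : ~~ odd m) (sT : size T = m.+1).

Let H P := hur m (polyR_of_int R P).

Lemma sizeR_le (P : {poly int}) : size P = m.+1 -> (size (polyR_of_int R P) <= m.+1)%N.
Proof. by rewrite size_polyR => ->. Qed.

Lemma PTplus_hur P : PTplus R T P ->
  hur m (polyR_of_int R T) = eo (even_poly (H P) - 'X * odd_poly (H P)) 0.
Proof.
case=> _ sP _ _; rewrite sT in sP => E.
apply: hur_plus; rewrite ?sizeR_le //.
have := congr1 (polyR_of_int R) E.
rewrite (reciprocalE sP) /polyR_of_int !rmorphM !rmorphB rmorphM /= map_polyX rmorph1.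
by rewrite -(rev_poly_map (intmul 1)).
Qed.

Lemma PTminus_hur P : PTminus R T P ->
  hur m (polyR_of_int R T) = eo (even_poly (H P) - odd_poly (H P)) 0.
Proof.
case=> _ sP _ _; rewrite sT in sP => E.
apply: hur_minus; rewrite ?sizeR_le //.
have := congr1 (polyR_of_int R) E.
rewrite (reciprocalE sP) /polyR_of_int !rmorphM !rmorphD rmorphM /= map_polyX rmorph1.
by rewrite -(rev_poly_map (intmul 1)).
Qed.

Lemma PT_size P : PT R T P -> P \is monic /\ size P = m.+1.
Proof. by case=> -[mP sP _ _ _]; rewrite sP sT. Qed.

Lemma FT_gt0 (x : 'cV[R]_m) : FT R m T x -> positive_orthant R m x.
Proof.
move=> [P /PT_size [_ sP]] /(stieltjes_tuple_ofP x m0 sP) [xpos _].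
exact: xpos.
Qed.

Lemma FT_hypersurface : FT R m T `&` hypersurface R m = set0.
Proof.
apply/seteqP; split=> // x [[P /PT_size [mP sP]]].
move=> /(stieltjes_tuple_ofP x m0 sP) [_ [c c0 [EN ED]]] [p [q [q1 E v]]].
have q0 : q != 0 by apply: contraNneq q1 => ->; rewrite horner0.
move: E; rewrite stieltjesE => /frac_eq-/(_ (cfD_neq0 _) q0) E.
have pq : p.[1] = q.[1] by rewrite -[LHS](divfK q1) -v mul1r.
have {}E : (cfN (col_seq x)).[1] = (cfD (col_seq x)).[1].
  apply: (mulIf q1); rewrite -hornerM E hornerM pq mulrC; done.
have := hur_evalN1 m (polyR_of_int R P).
rewrite -{1}(eo_even_odd (hur m _)) horner_eo EN ED sqrrN expr1n !hornerZ E.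
rewrite mulrN1 subrr coef_map -[in P`_m](_ : m.+1.-1 = m) // -sP -lead_coefE (monicP mP) mulr1.
by move/esym/eqP; rewrite expf_eq0 oppr_eq0 pnatr_eq0 andbF.
Qed.

End PT.

(** * Local finiteness *)

Section Discrete.
Variables (R : realType) (m : nat) (T : {poly int}).
Hypotheses (m0 : (0 < m)%N) (em : ~~ odd m) (sT : size T = m.+1).

Let H P := hur m (polyR_of_int R P).

Lemma nth_col (x : 'cV[R]_m) i : (col_seq x)`_i = if insub i is Some j then x j 0 else 0.
Proof.
case: insubP => [j _ <-|]; first exact: nth_col_seq.
by rewrite -leqNgt => mi; rewrite nth_default // size_col_seq.
Qed.

(* The scale of [hur m P] relative to the continued fraction is read off from
   [P(-1) = T(-1)] on [PTplus], and from [P(1) = T(1)] on [PTminus]. *)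
Lemma PT_scale P (x : 'cV[R]_m) c : PT R T P ->
  odd_poly (H P) = c *: cfN (col_seq x) -> even_poly (H P) = c *: cfD (col_seq x) ->
  c = (H T)`_0 \/ c * (cfD (col_seq x))`_(m./2) = (H T)`_m.
Proof.
move=> [PP|PP] EN ED; [left|right].
  by rewrite /H (PTplus_hur em sT PP) coef_eo /= coefB coefXM subr0 -/(H P) ED coefZ cfD_coef0 mulr1.
rewrite /H (PTminus_hur em sT PP) coef_eo (negbTE em) coefB -/(H P) EN ED !coefZ.
have [sN _] := size_cf (col_seq x); rewrite size_col_seq in sN.
rewrite [X in _ - _ * X]nth_default ?mulr0 ?subr0 //.
by rewrite (leq_trans sN) // uphalf_half (negbTE em).
Qed.

(** Near [x] a point of [F_T] comes from an integer polynomial [H_P] with bounded coefficients and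
    is recovered from it by [cf_expand]. *)
Lemma FT_locally_finite (x : 'cV[R]_m) : positive_orthant R m x ->
  exists (I : finType) (g : I -> 'cV[R]_m), exists2 V : set 'cV[R]_m, nbhs x V &
    forall y, V y -> FT R m T y -> exists i, y = g i.
Proof.
move=> xpos.
(* In the box between [x / 2] and [2 x], the lower corner bounds the leading coefficient of [cfD]
   from below and the upper corner bounds all coefficients from above. *)
pose l : 'cV[R]_m := 2^-1 *: x; pose u : 'cV[R]_m := 2 *: x.
pose V := [set y : 'cV[R]_m | forall j, l j 0 < y j 0 < u j 0].
have nV : nbhs x V.
  apply: (@filter_forall 'cV[R]_m 'I_m (fun j y => is_true (l j 0 < y j 0 < u j 0)) (nbhs x)) => j.
  have h : (fun y : 'cV[R]_m => y j 0) @ x --> x j 0 by exact: coord_continuous.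
  have xj := xpos j.
  have [h1 h2] : l j 0 < x j 0 /\ x j 0 < u j 0 by rewrite !mxE; split; lra.
  near=> y; apply/andP; split; near: y.
    exact: (cvgr_gt _ h).
  exact: (cvgr_lt _ h).
pose Dl := cfD (col_seq l); pose Du := cfD (col_seq u); pose Nu := cfN (col_seq u).
have lpos : {in col_seq l, forall a, 0 < a}.
  apply/(col_seqP l (fun a => 0 < a)) => j; rewrite mxE mulr_gt0 //.
have Dl0 : 0 < Dl`_(m./2).
  by have [_] := cf_lead_gt0 lpos; rewrite size_col_seq.
(* One summand for each case of [PT_scale]. *)
pose C := `|(H T)`_0| + `|(H T)`_m| / Dl`_(m./2).
pose M := \sum_(i < m.+1) (`|Nu`_i| + `|Du`_i|).
pose K := Num.bound (C * M).
(* Integers between [- K] and [K], encoded as naturals up to [2 K] by a shift. *)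
pose pol (F : {ffun 'I_m.+1 -> 'I_(2 * K).+1}) : {poly R} :=
  \poly_(i < m.+1) ((F (inord i) : nat)%:R - K%:R).
exists _, (fun F => seq_col m (cf_expand m (odd_poly (pol F)) (even_poly (pol F)))), V => //.
move=> y Vy [P PP tP]; have [mP sP] := PT_size sT PP.
have cfy := cf_of_stieltjes_tuple m0 sP tP.
have [ypos [c c0 [EN ED]]] := (stieltjes_tuple_ofP y m0 sP).1 tP.
have yu i : 0 <= (col_seq y)`_i <= (col_seq u)`_i.
  rewrite !nth_col; case: insub => [j|]; last by rewrite lexx.
  by have /andP[_ /ltW ->] := Vy j; rewrite ltW.
have ly i : 0 <= (col_seq l)`_i <= (col_seq y)`_i.
  rewrite !nth_col; case: insub => [j|]; last by rewrite lexx.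
  by have /andP[/ltW -> _] := Vy j; rewrite mxE mulr_ge0 // ltW.
have su : size (col_seq y) = size (col_seq u) by rewrite !size_col_seq.
have sl : size (col_seq l) = size (col_seq y) by rewrite !size_col_seq.
have cC : `|c| <= C.
  have Dy : 0 < (cfD (col_seq y))`_(m./2).
    by apply: lt_le_trans Dl0 _; have [_ /andP[]] := cf_coef_le sl ly m./2.
  have [->|E] := PT_scale PP EN ED.
    by rewrite lerDl mulr_ge0 // invr_ge0 ltW.
  have : `|c| * Dl`_(m./2) <= `|(H T)`_m|.
    rewrite -E normrM ler_wpM2l // gtr0_norm //.
    by have [_ /andP[]] := cf_coef_le sl ly m./2.
  rewrite -ler_pdivlMr // => /le_trans -> //.
  by rewrite lerDr.
have MM i : (i < m.+1)%N -> `|(cfN (col_seq y))`_i| <= M /\ `|(cfD (col_seq y))`_i| <= M.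
  move=> im; have [/andP[n0 n1] /andP[d0 d1]] := cf_coef_le su yu i.
  have MI : `|Nu`_i| + `|Du`_i| <= M.
    rewrite /M (bigD1 (Ordinal im)) //= lerDl; apply: sumr_ge0 => j _; exact: addr_ge0.
  split; apply: le_trans MI; (rewrite ger0_norm; last by []).
    apply: le_trans n1 _; apply: le_trans (ler_norm _) _.
    by rewrite lerDl.
  apply: le_trans d1 _; apply: le_trans (ler_norm _) _.
  by rewrite lerDr.
have HK i : (i < m.+1)%N -> `|(H P)`_i| <= K%:R.
  move=> im; apply: le_trans (ltW (archi_boundP _)); last first.
    rewrite mulr_ge0 // ?(le_trans _ cC) //.
    by apply: sumr_ge0 => j _; apply: addr_ge0.
  rewrite -(eo_even_odd (H P)) coef_eo EN ED.
  have i2 : (i./2 < m.+1)%N by move: im; clear; lia.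
  have [hN hD] := MM _ i2.
  by case: ifP => _; rewrite coefZ normrM ler_pM.
have Hint i : exists z : int, (H P)`_i = z%:~R.
  exists (hur m P)`_i; rewrite /H /polyR_of_int (hur_map (intmul 1)).
  by rewrite coef_map.
exists [ffun i : 'I_m.+1 => inord `|(Num.floor (H P)`_i + K%:Z)%R|%N].
apply: col_seq_inj; rewrite seq_colK ?size_cf_expand // cfy -/(H P).
suff -> : pol [ffun i : 'I_m.+1 => inord `|(Num.floor (H P)`_i + K%:Z)%R|%N] = H P by [].
apply/polyP => i; rewrite coef_poly; case: ltnP => im; last first.
  by rewrite nth_default // (leq_trans (size_hur _ _)).
have Ei : (inord i : 'I_m.+1) = i :> nat by rewrite inordK.
rewrite ffunE Ei.
have [z Ez] := Hint i; have hK := HK i im; rewrite Ez in hK; rewrite Ez intrKfloor.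
have /andP[z1 z2] : (- K%:Z <= z) && (z <= K%:Z).
  by rewrite -!(ler_int R) intrN -ler_norml.
rewrite inordK; last by move: z1 z2; clear; lia.
rewrite !pmulrn -mulrzBr; congr (_ *~ _).
by move: z1 z2; clear; lia.
Unshelve. all: by end_near.
Qed.

Lemma FT_separated (x : 'cV[R]_m) : positive_orthant R m x ->
  exists2 V : set 'cV[R]_m, nbhs x V & V `&` FT R m T `<=` [set x].
Proof.
move=> /FT_locally_finite [I [g [V nV HV]]].
exists (V `&` [set y | forall i, g i = x \/ y <> g i]).
  apply: filterI => //.
  apply: (@filter_forall 'cV[R]_m I (fun i y => g i = x \/ y <> g i) (nbhs x)) => i.
  have [->|gx] := eqVneq (g i) x; first by apply: filterE => y; left.
  have [j xj] : exists j, x j 0 != g i j 0.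
    apply: contrapT => /forallNP h; move/eqP: gx; apply.
    apply/matrixP => j k; rewrite ord1; have := h j.
    by move/negP; rewrite negbK => /eqP.
  have h : (fun y : 'cV[R]_m => y j 0) @ x --> x j 0 by exact: coord_continuous.
  have d0 : 0 < `|x j 0 - g i j 0| by rewrite normr_gt0 subr_eq0.
  move/cvgrPdist_lt: h => /(_ _ d0).
  by apply: filterS => y yj; right => E; rewrite E ltxx in yj.
move=> y [[Vy Hy] /(HV y Vy) [i yi]].
by have [<-|] := Hy i.
Qed.

Lemma FT_discrete :
  isolated (FT R m T) = FT R m T /\
  limit_point (FT R m T) `&` positive_orthant R m = set0.
Proof.
split.
  apply/seteqP; split; first exact: isolatedS.
  move=> x Fx; have [V nV HV] := FT_separated (FT_gt0 m0 sT Fx).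
  split; first exact/mem_set.
  exists V => //; apply/seteqP; split=> // y ->.
  by split=> //; exact: nbhs_singleton.
apply/seteqP; split=> // x [lx xpos].
have [V nV HV] := FT_separated xpos.
have [y [/eqP yx Fy Vy]] := lx V nV.
by apply: yx; exact: HV.
Qed.

End Discrete.

(** * The semigroup law *)

Lemma cf_horner1_gt0 (F : numFieldType) (f : seq F) : {in f, forall a, 0 < a} ->
  0 <= (cfN f).[1] /\ 0 < (cfD f).[1].
Proof.
elim: f => [|a l IH] fpos; first by rewrite /= horner0 hornerC lexx ltr01.
have [|n0 d0] := IH; first by move=> b bl; apply: fpos; rewrite inE bl orbT.
rewrite cfN_cons cfD_cons hornerZ hornerD hornerM hornerX mul1r.
by rewrite mulr_ge0 ?ltr_pwDl // ltW // fpos // mem_head.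
Qed.

Section Semigroup.
Variables (R : realType) (m : nat) (T : {poly int}).
Hypotheses (m0 : (0 < m)%N) (em : ~~ odd m) (sT : size T = m.+1).

Let H P := hur m (polyR_of_int R P).

(** The scale is positive because [H_P(1) = 2 ^ m P(0)] and [cfD f + cfN f] are both positive at
    1. *)
Lemma PTplus_cf P : PTplus R T P ->
  exists (c : R) (f : seq R), [/\ 0 < c, {in f, forall a, 0 < a}, size f = m,
    odd_poly (H P) = c *: cfN f & even_poly (H P) = c *: cfD f].
Proof.
case=> mP sP eP P0 _; rewrite sT in sP.
have [x /(stieltjes_tuple_ofP x m0 sP) [xpos [c c0 [EN ED]]]] := expansive_tuple m0 sP eP.
have fpos : {in col_seq x, forall a, 0 < a} by apply/(col_seqP x (fun a => 0 < a)).
exists c, (col_seq x); split; rewrite ?size_col_seq //.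
have [n0 d0] := cf_horner1_gt0 fpos.
have := hur_eval1 m (polyR_of_int R P).
rewrite -{1}(eo_even_odd (hur m _)) horner_eo EN ED expr1n mulr1 !hornerZ -mulrDr coef_map.
have s0 : 0 < (cfD (col_seq x)).[1] + (cfN (col_seq x)).[1] by rewrite ltr_pwDl.
move=> E; rewrite -(pmulr_lgt0 _ s0) E mulr_gt0 ?exprn_gt0 ?ltr0n //.
by rewrite ltr0z -horner_coef0.
Qed.

Lemma PTplus_root_sign P (w : R) : PTplus R T P ->
  w < 0 -> (even_poly (H P) - 'X * odd_poly (H P)).[w] = 0 ->
  0 < (odd_poly (H P)).[w] * (deriv (even_poly (H P) - 'X * odd_poly (H P))).[w].
Proof.
move=> PP w0 tw.
have [c [f [c0 fpos sf EN ED]]] := PTplus_cf PP.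
have sf0 : (0 < size f)%N by rewrite sf.
have [_] := cf_wronskian_pos w fpos sf0.
rewrite -(pmulr_rgt0 _ (exprn_gt0 2 c0)).
set N := odd_poly (H P) in EN tw *; set D := even_poly (H P) in ED tw *.
have -> : c ^+ 2 * ((cfN f * cfD f).[w] -
     w * (cfN f * deriv (cfD f) - deriv (cfN f) * cfD f).[w]) =
   (N * D).[w] - w * (N * deriv D - deriv N * D).[w].
  by rewrite EN ED !derivZ !(hornerD, hornerN, hornerM, hornerZ); ring.
(* At a root [w] of [t = D - X N] one has [D(w) = w N(w)], and the Wronskian inequality becomes
   [- w N(w) t'(w) > 0]. *)
have Dw : D.[w] = w * N.[w].
  by move: tw; rewrite hornerD hornerN hornerM hornerX => /eqP; rewrite subr_eq0 => /eqP.
rewrite derivD derivN poly.derivM derivX mul1r !(hornerD, hornerN, hornerM, hornerX) Dw.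
set a := N.[w]; set b := (deriv D).[w]; set d := (deriv N).[w] => h.
have : 0 < (- w) * (a * (b - (a + w * d))) by move: h; congr (_ < _); ring.
by rewrite pmulr_rgt0 // oppr_gt0.
Qed.

Lemma PTplus_oplus P P' : T \is monic -> reciprocal T = T ->
  PTplus R T P -> PTplus R T P' -> PTplus R T (oplus T P P').
Proof.
move=> mT rT PP PP'.
have [c [f [c0 fpos sf EN ED]]] := PTplus_cf PP.
have [c' [f' [c'0 fpos' sf' EN' ED']]] := PTplus_cf PP'.
have HT := PTplus_hur em sT PP; have HT' := PTplus_hur em sT PP'.
set k := odd_poly (H P) in EN HT; set k' := odd_poly (H P') in EN' HT'.
set t := even_poly (H P) - 'X * k in HT.
have tE' : even_poly (H P') - 'X * k' = t.
  by rewrite -(even_eo t 0) -HT HT' even_eo.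
have HP : H P = eo (t + 'X * k) k by rewrite subrK eo_even_odd.
have HP' : H P' = eo (t + 'X * k') k' by rewrite -tE' subrK eo_even_odd.
have rs w := PTplus_root_sign (w := w) PP; have rs' w := PTplus_root_sign (w := w) PP'.
have [mP sP eP P0 EP] := PP; have [mP' sP' eP' P'0 EP'] := PP'.
rewrite sT in sP sP'.
have sPR : size (polyR_of_int R P) = m.+1 by rewrite size_polyR.
have [st _] := (expansive_stable m0 sPR).1 eP.
have [nl0 dl0] := cf_lead_gt0 fpos; have [nl0' dl0'] := cf_lead_gt0 fpos'.
rewrite sf in nl0 dl0; rewrite sf' in nl0' dl0'.
(* With [tn], this prevents the leading coefficients from cancelling: the degree stays [m] along the
   deformation. *)
have kn : 0 <= ('X * k')`_(m./2).
  rewrite coefXM; case: eqP => // /eqP m2; rewrite EN' coefZ mulr_ge0 ?ltW //.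
  suff -> : (m./2.-1 = m.-1./2)%N by exact: nl0'.
  by move: em m2; clear; lia.
have tn : 0 < (t + 'X * k)`_(m./2) by rewrite subrK ED coefZ mulr_gt0.
(* The deformation leads from [H_P] at [e = 0] to the transform of [oplus T P P'] at [e = 1]. *)
have stable_k (e : R) : 0 <= e <= 1 ->
    stable (toC (eo (t + 'X * (k + e *: k')) (k + e *: k'))).
  pose A := toC (eo (t + 'X * k) k); pose B := toC (eo ('X * k') k').
  have AB (x : R) : A + x%:C%C *: B = toC (eo (t + 'X * (k + x *: k')) (k + x *: k')).
    rewrite /A /B -map_polyZ -rmorphD /= eoZ eoD; congr (toC (eo _ _)).
    by rewrite mulrDr scalerAr addrA.
  rewrite -AB; have sAH : (size (H P) <= m.+1)%N by exact: size_hur.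
  have sBH : (size (eo ('X * k') k') <= m.+1)%N.
    have -> : eo ('X * k') k' = H P' - H T.
      rewrite HP' /H HT -scaleN1r eoZ eoD scaler0 addr0 scaleN1r.
      by rewrite addrAC subrr add0r.
    by rewrite (leq_trans (size_polyD _ _)) // size_polyN geq_max !size_hur.
  apply: (stable_homotopy (n := m)).
  - by rewrite size_toC.
  - move=> x /andP[x0 x1]; rewrite AB size_toC; apply: size_eq_of_coef.
      have -> : eo (t + 'X * (k + x *: k')) (k + x *: k') = H P + x *: eo ('X * k') k'.
        by rewrite HP eoZ eoD mulrDr addrA scalerAr.
      rewrite (leq_trans (size_polyD _ _)) // geq_max sAH.
      by rewrite (leq_trans (size_scale_leq _ _)).
    rewrite coef_eo (negbTE em) mulrDr -scalerAr addrA coefD coefZ.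
    by rewrite gt_eqF // ltr_pwDl // mulr_ge0.
  (* A root on the axis off 0 would be a common zero of [t] and [k + x k'], but [k t'] and [k' t']
     are positive at the negative roots of [t]; at 0 the value is [t(0) = c > 0]. *)
  - move=> x /andP[x0 x1] z z0; rewrite AB horner_toC_eo_axis //; apply/negP.
    rewrite eq_complex /= => /andP[/eqP ED0]; rewrite mulf_eq0 => /orP[/eqP EN0|/eqP y0].
      move: ED0; rewrite hornerD hornerM EN0 mulr0 addr0 => t0.
      have [y0|y0] := eqVneq (Im z) 0.
        move: t0; rewrite y0 expr0n oppr0 horner_coef0.
        have -> : t`_0 = c by rewrite /t coefB coefXM subr0 ED coefZ cfD_coef0 mulr1.
        by move=> ce; rewrite ce ltxx in c0.
      have w0 : - Im z ^+ 2 < 0 by rewrite oppr_lt0 exprn_even_gt0.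
      have h1 := rs _ w0 t0; have := rs' _ w0; rewrite tE' => /(_ t0) h2.
      move: EN0; rewrite hornerD hornerZ => E.
      have : 0 < (k.[- Im z ^+ 2] + x * k'.[- Im z ^+ 2]) * (deriv t).[- Im z ^+ 2].
        by rewrite mulrDl -mulrA ltr_pwDl // mulr_ge0 // ltW.
      by rewrite E mul0r ltxx.
    move: ED0; rewrite y0 expr0n oppr0 horner_coef0 coefD coefXM addr0.
    have -> : t`_0 = c by rewrite /t coefB coefXM subr0 ED coefZ cfD_coef0 mulr1.
    by move=> ce; rewrite ce ltxx in c0.
  - by rewrite /A -HP /H hur_map in st *.
have HE : H (oplus T P P') = eo (t + 'X * (k + k')) (k + k').
  have -> : H (oplus T P P') = H P + H P' - H T.
    rewrite /H /oplus /polyR_of_int rmorphB rmorphD /= !hurD.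
    by rewrite -[- map_poly _ T]scaleN1r hurZ scaleN1r.
  rewrite HP HP' /H HT -scaleN1r eoZ !eoD scaler0 addr0 scaleN1r mulrDr.
  by congr eo; ring.
have lead_coefm (Q : {poly int}) : size Q = m.+1 -> Q \is monic -> Q`_m = 1.
  by move=> sQ mQ; rewrite -[m]/(m.+1.-1) -sQ -lead_coefE (monicP mQ).
have co : (oplus T P P')`_m = 1 by rewrite coefB coefD !lead_coefm.
have so : size (oplus T P P') = m.+1.
  apply: size_eq_of_coef; last by rewrite co.
  rewrite (leq_trans (size_polyD _ _)) // size_polyN sT geq_max leqnn andbT.
  by rewrite (leq_trans (size_polyD _ _)) // sP sP' maxnn.
split.
- by apply/monicP; rewrite lead_coefE so.
- by rewrite so sT.
- apply/(expansive_stable m0); rewrite ?size_polyR // -/(H _) HE; split.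
    by have := stable_k 1; rewrite ler01 lexx scale1r; apply.
  by rewrite coef_eo (negbTE em) mulrDr addrA coefD gt_eqF // ltr_pwDl.
(* The sign of the constant coefficient is read off at 1, where the transform is
   [H_P(1) + 2 k'(1)]. *)
- have := hur_eval1 m (polyR_of_int R (oplus T P P')).
  rewrite -/(H _) HE horner_coef0 coef_map.
  have -> : (eo (t + 'X * (k + k')) (k + k')).[1] = (H P).[1] + 2 * k'.[1].
    by rewrite HP !horner_eo expr1n !(hornerD, hornerM, hornerX); ring.
  rewrite hur_eval1 coef_map => E.
  have : 0 < 2 ^+ m * ((oplus T P P')`_0)%:~R :> R.
    rewrite -E ltr_pwDl //.
      by rewrite mulr_gt0 ?exprn_gt0 ?ltr0n // ltr0z -horner_coef0.
    have [n0 _] := cf_horner1_gt0 fpos'.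
    by rewrite EN' hornerZ mulr_ge0 // mulr_ge0 // ltW.
  by rewrite pmulr_rgt0 ?ltr0z // exprn_gt0 // ltr0n.
- move: EP EP'; rewrite (reciprocalE sP) (reciprocalE sP') (reciprocalE so) /oplus.
  rewrite rev_polyD rev_polyN rev_polyD -(reciprocalE sT) rT => EP EP'.
  have -> : 'X * (P + P' - T) - (rev_poly m P + rev_poly m P' - T) =
    ('X * P - rev_poly m P) + ('X * P' - rev_poly m P') - ('X - 1) * T by ring.
  by rewrite -EP -EP'; ring.
Qed.

Hypotheses (mT : T \is monic) (rT : reciprocal T = T).
Hypothesis (T1 : exists2 z : R[i], root (polyC_of_int R T) z & `|z| = 1).

(** A root on the unit circle makes [T] non-expansive; the two cases of [salem_tuple] are thus
    disjoint. *)
Lemma not_PTplus_T : ~ PTplus R T T.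
Proof.
case=> _ _ [_ Hroot] _ _; have [z rz z1] := T1.
by have := Hroot z; rewrite toC_polyR_of_int rz z1 ltxx => /(_ isT).
Qed.

Lemma salem_tuple_exists P : (PTplus R T `|` [set T]) P ->
  exists x : 'cV[R]_m, salem_tuple T P x.
Proof.
case=> [PP|->]; last by exists 0; right.
have [_ sP eP _ _] := PP; rewrite sT in sP.
by have [x hx] := expansive_tuple m0 sP eP; exists x; left.
Qed.

Lemma salem_tuple_fun P (x y : 'cV[R]_m) : salem_tuple T P x -> salem_tuple T P y -> x = y.
Proof.
move=> [[PP hx]|[-> ->]] [[PP' hy]|[PT ->]] //.
- have [_ sP _ _ _] := PP; rewrite sT in sP.
  exact: stieltjes_tuple_uniq m0 sP hx hy.
- by move: PP; rewrite PT => /not_PTplus_T.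
- by move: PP' => /not_PTplus_T.
Qed.

Lemma stieltjes_tuple_neq0 P (x : 'cV[R]_m) : PTplus R T P -> stieltjes_tuple_of P x ->
  x <> 0.
Proof.
move=> PP hx x0; have Fx : FT R m T x by exists P => //; left.
have := FT_gt0 m0 sT Fx (Ordinal m0).
by rewrite x0 mxE ltxx.
Qed.

Lemma salem_tuple_inj P P' (x : 'cV[R]_m) : salem_tuple T P x -> salem_tuple T P' x -> P = P'.
Proof.
move=> [[PP hx]|[-> x0]] [[PP' hx']|[-> x0']] //.
- have [mP sP _ _ _] := PP; have [mP' sP' _ _ _] := PP'; rewrite sT in sP sP'.
  exact: stieltjes_tuple_inj m0 sP sP' mP mP' hx hx'.
- by case: (stieltjes_tuple_neq0 PP hx).
- by case: (stieltjes_tuple_neq0 PP' hx').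
Qed.

Lemma salem_tuple_dom P (x : 'cV[R]_m) : salem_tuple T P x -> (PTplus R T `|` [set T]) P.
Proof. by case=> [[PP _]|[-> _]]; [left|right]. Qed.

Lemma salem_tuple_range (x : 'cV[R]_m) :
  (FTplus R m T `|` [set 0]) x <-> exists P, salem_tuple T P x.
Proof.
split=> [[[P PP hx]|->]|[P [[PP hx]|[_ ->]]]].
- by exists P; left.
- by exists T; right.
- by left; exists P.
- by right.
Qed.

Lemma oplus_closed P P' : (PTplus R T `|` [set T]) P -> (PTplus R T `|` [set T]) P' ->
  (PTplus R T `|` [set T]) (oplus T P P').
Proof.
move=> [PP|->] [PP'|->].
- by left; exact: PTplus_oplus.
- by left; rewrite /oplus addrK.
- by left; rewrite /oplus addrC addKr.
- by right; rewrite /oplus addrK.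
Qed.

(** The law is transported along a correspondence that is one-to-one by [salem_tuple_fun] and
    [salem_tuple_inj], so its axioms reduce to identities for [oplus]. Outside the tuples, [xget]
    returns the default 0. *)
Lemma FTplus_semigroup :
  exists op : 'cV[R]_m -> 'cV[R]_m -> 'cV[R]_m,
    commutative_semigroup_on (FTplus R m T `|` [set 0]) op 0 /\
    forall P P', (PTplus R T `|` [set T]) P ->
      (PTplus R T `|` [set T]) P' ->
      (PTplus R T `|` [set T]) (oplus T P P') /\
      forall x y : 'cV[R]_m, salem_tuple T P x -> salem_tuple T P' y ->
        salem_tuple T (oplus T P P') (op x y).
Proof.
pose op (x y : 'cV[R]_m) : 'cV[R]_m := xget 0 [set z : 'cV[R]_m | exists P P',
  [/\ salem_tuple T P x, salem_tuple T P' y & salem_tuple T (oplus T P P') z]].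
have opP P P' (x y : 'cV[R]_m) : salem_tuple T P x -> salem_tuple T P' y ->
    salem_tuple T (oplus T P P') (op x y).
  move=> hx hy.
  have [z hz] := salem_tuple_exists (oplus_closed (salem_tuple_dom hx) (salem_tuple_dom hy)).
  have /= : [set z : 'cV[R]_m | exists P P',
      [/\ salem_tuple T P x, salem_tuple T P' y & salem_tuple T (oplus T P P') z]] (op x y).
    by apply: (xgetI 0 (x := z)); exists P, P'.
  move=> [Q [Q' [hQ hQ' h]]].
  by rewrite (salem_tuple_inj hx hQ) (salem_tuple_inj hy hQ').
exists op; split; last first.
  by move=> P P' HP HP'; split; [exact: oplus_closed|move=> x y; exact: opP].
have sT0 : salem_tuple T T (0 : 'cV[R]_m) by right.
split.
- by right.
- move=> x y /salem_tuple_range [P hx] /salem_tuple_range [P' hy].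
  by apply/salem_tuple_range; exists (oplus T P P'); exact: opP.
- move=> x y z /salem_tuple_range [P hx] /salem_tuple_range [P' hy] /salem_tuple_range [P'' hz].
  apply: salem_tuple_fun (opP _ _ _ _ hx (opP _ _ _ _ hy hz)) _.
  have -> : oplus T P (oplus T P' P'') = oplus T (oplus T P P') P'' by rewrite /oplus; ring.
  by apply: (opP) => //; exact: opP.
- move=> x y /salem_tuple_range [P hx] /salem_tuple_range [P' hy].
  apply: salem_tuple_fun (opP _ _ _ _ hx hy) _.
  have -> : oplus T P P' = oplus T P' P by rewrite /oplus; ring.
  exact: opP.
- move=> x /salem_tuple_range [P hx].
  apply: salem_tuple_fun (opP _ _ _ _ sT0 hx) _.
  by have -> : oplus T T P = P by rewrite /oplus; ring.
Qed.

Lemma salem_tuple_unique_exists P : (PTplus R T `|` [set T]) P ->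
  exists! x : 'cV[R]_m, salem_tuple T P x.
Proof.
move=> /salem_tuple_exists [x hx]; exists x; split=> // y; exact: salem_tuple_fun.
Qed.

End Semigroup.

(** * Affine independence of the terms of k / t *)

Fixpoint cf_rest (F : fieldType) (j : nat) (N D : {poly F}) : {poly F} * {poly F} :=
  if j is j'.+1 then cf_rest j' (drop_poly 1 ((N`_0 / D`_0) *: D - N)) N else (N, D).

Lemma cf_expand_add (F : fieldType) j m (N D : {poly F}) :
  cf_expand (j + m) N D =
  cf_expand j N D ++ cf_expand m (cf_rest j N D).1 (cf_rest j N D).2.
Proof. by elim: j N D => //= j IH N D; rewrite IH. Qed.

Lemma nth_cf_expand (F : fieldType) i m (N D : {poly F}) : (i < m)%N ->
  (cf_expand m N D)`_i = (cf_rest i N D).1`_0 / (cf_rest i N D).2`_0.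
Proof. by elim: i m N D => [|i IH] [|m] N D //= im; rewrite IH. Qed.

Lemma cf_rest_coef0 (F : fieldType) j (N D : {poly F}) : D`_0 != 0 ->
  {in cf_expand j N D, forall a, a != 0} ->
  (cf_rest j N D).2`_0 = D`_0 * \prod_(a <- cf_expand j N D) a.
Proof.
elim: j N D => [|j IH] N D D0 Hs; first by rewrite /= big_nil mulr1.
have s0 : N`_0 / D`_0 != 0 by apply: Hs; rewrite mem_head.
have EN0 : N`_0 = D`_0 * (N`_0 / D`_0) by rewrite mulrC divfK.
rewrite [cf_rest _ _ _]/= IH; last first.
- by move=> b bl; apply: Hs; rewrite inE bl orbT.
- by rewrite EN0 mulf_neq0.
by rewrite [in RHS]/= big_cons mulrA -EN0.
Qed.

(** The determinant formula for convergents, which measures the error of the [j]-th one; each step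
    contributes a factor [- 'X]. *)
Lemma cf_rest_cross (F : fieldType) j (N D : {poly F}) : D`_0 != 0 ->
  {in cf_expand j N D, forall a, a != 0} ->
  N * cfD (cf_expand j N D) - cfN (cf_expand j N D) * D =
  (-1) ^+ j * ('X ^+ j * (cf_rest j N D).1).
Proof.
elim: j N D => [|j IH] N D D0 Hs; first by rewrite /= mulr1 mul0r subr0 !expr0 !mul1r.
have s0 : N`_0 / D`_0 != 0 by apply: Hs; rewrite mem_head.
have EN0 : N`_0 = N`_0 / D`_0 * D`_0 by rewrite divfK.
rewrite /=; set s := N`_0 / D`_0 in s0 EN0 *; set M := drop_poly 1 (s *: D - N).
have EM : 'X * M = s *: D - N by apply: mulX_drop; exact: coef0_step.
set l := cf_expand j M N.
transitivity (- 'X * (M * cfD l - cfN l * N)).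
  rewrite mulNr mulrBr mulrA EM -!mul_polyC; ring.
rewrite IH; last first.
- by move=> b bl; apply: Hs; rewrite /= inE bl orbT.
- by rewrite EN0 mulf_neq0.
by rewrite !exprS; ring.
Qed.

Lemma size_cf_rest (F : fieldType) j m (N D : {poly F}) :
  (size N <= uphalf (j + m))%N -> (size D <= (j + m)./2.+1)%N ->
  (size (cf_rest j N D).1 <= uphalf m)%N /\ (size (cf_rest j N D).2 <= m./2.+1)%N.
Proof.
elim: j N D => [|j IH] N D sN sD //=; apply: IH.
  rewrite size_drop_poly leq_subLR add1n (leq_trans (size_polyD _ _)) // size_polyN.
  rewrite geq_max (leq_trans (size_scale_leq _ _)) //=.
  by move: sN; move: (size N) => x; rewrite addSn /=; lia.
by move: sN; rewrite addSn.
Qed.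

(** Unlike in [cf_expandP], the last of the [m + 1] terms may vanish, because nothing is divided by
    it. This yields the denominator in [admissible_extend] before the sign of the last term is
    known. *)
Lemma cf_exact (F : fieldType) m (N D : {poly F}) :
  D`_0 != 0 -> (size N <= uphalf m.+1)%N -> (size D <= m.+1./2.+1)%N ->
  {in cf_expand m N D, forall a, a != 0} ->
  N = D`_0 *: cfN (cf_expand m.+1 N D) /\ D = D`_0 *: cfD (cf_expand m.+1 N D).
Proof.
elim: m N D => [|m IH] N D D0 sN sD Hs.
  rewrite /= mulr0 addr0 scalerA [_ * (_ / _)]mulrC divfK //.
  by rewrite -!mul_polyC !mulr1; split; exact: size1_polyC.
have s0 : N`_0 / D`_0 != 0 by apply: Hs; rewrite mem_head.
have EN0 : N`_0 = N`_0 / D`_0 * D`_0 by rewrite divfK.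
rewrite -[cf_expand m.+2 N D]/(N`_0 / D`_0 ::
  cf_expand m.+1 (drop_poly 1 ((N`_0 / D`_0) *: D - N)) N).
set s := N`_0 / D`_0 in s0 EN0 *; set M := drop_poly 1 (s *: D - N).
have EM : 'X * M = s *: D - N by apply: mulX_drop; exact: coef0_step.
have [||||EM' EN] := IH M N.
- by rewrite EN0 mulf_neq0.
- have := @size_cf_rest _ 1 m.+1 N D; rewrite add1n => /(_ sN sD) [].
  by rewrite /= -/s -/M.
- by move: sN => /=.
- by move=> b bl; apply: Hs; rewrite /= inE bl orbT.
rewrite EN0 in EM' EN; move: (cf_expand m.+1 M N) EM' EN => f EM' EN.
split; first by rewrite cfN_cons EN scalerA mulrC.
apply: (scalerI s0).
rewrite -[s *: D in LHS](subrK N) -EM EM' EN -scalerAr -scalerDr scalerA.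
by rewrite cfD_cons [cfD _ + _]addrC.
Qed.

(** * Limits of terms and of convergents *)

Section Limits.
Context {R : realType} {U : Type} {F : set_system U} {FF : ProperFilter F}.

Lemma cvg_sum_seq (I : Type) (r : seq I) (f : I -> U -> R) (l : I -> R) :
  (forall i, f i x @[x --> F] --> l i) ->
  \sum_(i <- r) f i x @[x --> F] --> \sum_(i <- r) l i.
Proof.
move=> cf; elim: r => [|i r IH].
  by rewrite big_nil; under eq_fun do rewrite big_nil; exact: cvg_cst.
by rewrite big_cons; under eq_fun do rewrite big_cons; exact: cvgD.
Qed.

(** Term [i] is a rational function of the coefficients, continuous as long as the preceding terms
    of the limit are nonzero; its own limit may be 0. *)
Lemma cf_expand_cvg (N D : U -> {poly R}) (N0 D0 : {poly R}) i m :
  (forall k, (N x)`_k @[x --> F] --> N0`_k) ->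
  (forall k, (D x)`_k @[x --> F] --> D0`_k) ->
  D0`_0 != 0 -> {in cf_expand i N0 D0, forall a, a != 0} -> (i < m)%N ->
  (cf_expand m (N x) (D x))`_i @[x --> F] --> (cf_expand m N0 D0)`_i.
Proof.
elim: i N D N0 D0 m => [|i IH] N D N0 D0 [|m] // cN cD d0 Hs im.
  by rewrite /=; apply: cvgM => //; exact: cvgV.
have hs : (N x)`_0 / (D x)`_0 @[x --> F] --> N0`_0 / D0`_0.
  by apply: cvgM => //; exact: cvgV.
rewrite /=; apply: IH => //.
- move=> k; rewrite coef_drop_poly coefB coefZ.
  under eq_fun do rewrite coef_drop_poly coefB coefZ.
  by apply: cvgB => //; apply: cvgM.
- apply: contraNneq (Hs (N0`_0 / D0`_0) _); first by move=> ->; rewrite mul0r.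
  by rewrite mem_head.
- by move=> a al; apply: Hs; rewrite /= inE al orbT.
Qed.

Lemma cf_horner_cvg (l : U -> seq R) (l0 : seq R) (y : R) :
  (forall x, size (l x) = size l0) ->
  (forall i, (l x)`_i @[x --> F] --> l0`_i) ->
  (cfN (l x)).[y] @[x --> F] --> (cfN l0).[y] /\
  (cfD (l x)).[y] @[x --> F] --> (cfD l0).[y].
Proof.
elim: l0 l => [|a l0 IH] l sl cl.
  have -> : l = (fun=> [::]) by apply/funext => x; apply: size0nil; rewrite sl.
  by rewrite /=; split; exact: cvg_cst.
have El x : l x = (l x)`_0 :: behead (l x) by case: (l x) (sl x).
have [||cN cD] := IH (fun x => behead (l x)).
- by move=> x; rewrite size_behead sl.
- by move=> i; under eq_fun do rewrite nth_behead; exact: cl i.+1.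
split.
  rewrite cfN_cons hornerZ; under eq_fun do rewrite El cfN_cons hornerZ.
  by apply: cvgM => //; exact: cl 0%N.
rewrite cfD_cons hornerD hornerM hornerX.
under eq_fun do rewrite El cfD_cons hornerD hornerM hornerX.
by apply: cvgD => //; apply: cvgM => //; exact: cvg_cst.
Qed.

End Limits.

(* [1; s2; l] are the terms of a fraction k / t normalised by k(0) = t(0) = 1. *)
Definition admissible (R : realType) (t : {poly R}) (s2 : R) (l : seq R) : Prop :=
  [/\ s2 < 0, {in l, forall a, 0 < a} & cfD [:: 1, s2 & l] = t].

Lemma cf_expand_take (F : fieldType) i m (N D : {poly F}) : (i <= m)%N ->
  cf_expand i N D = take i (cf_expand m N D).
Proof.
by move=> im; rewrite -(subnKC im) cf_expand_add take_size_cat // size_cf_expand.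
Qed.

Lemma seq_pos (R : numDomainType) (l : seq R) n : size l = n ->
  (forall i : 'I_n, 0 < l`_i) -> {in l, forall a, 0 < a}.
Proof.
move=> sl H a al; have il : (index a l < n)%N by rewrite -sl index_mem.
by have := H (Ordinal il); rewrite /= nth_index.
Qed.

(* The numerator [k] is moved to [k (1 + b X) + sg x X], where the sign [sg] makes the
   last term but one positive. That the last term tends to [b] follows from the
   value of the sum of the terms, since the coefficient of [X] in the denominator is known. *)
Lemma admissible_extend (R : realType) (t : {poly R}) (b s2 : R) (l : seq R) p :
  0 < b -> t.[- b^-1] != 0 -> admissible t s2 l -> size l = p.*2 ->
  exists (S : R -> R) (L : R -> seq R),
  [/\ \forall x \near 0^'+, admissible (t * (1 + b *: 'X)) (S x) (L x),
      forall x, size (L x) = p.*2.+2,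
      forall i, (i < p.*2)%N -> (L x)`_i @[x --> 0^'+] --> l`_i,
      (L x)`_(p.*2) @[x --> 0^'+] --> (0 : R) &
      (L x)`_(p.*2.+1) @[x --> 0^'+] --> b].
Proof.
move=> b0 ty [s20 lpos tE] sl.
set y := - b^-1 in ty; have y0 : y < 0 by rewrite oppr_lt0 invr_gt0.
pose u : {poly R} := 1 + b *: 'X.
have uy : u.[y] = 0.
  by rewrite /u hornerD hornerZ hornerX hornerC /y mulrN divff ?subrr // gt_eqF.
have u0 : u`_0 = 1 by rewrite /u coefD coefZ coefX coefC mulr0 addr0.
have u1 : u`_1 = b by rewrite /u coefD coefZ coefX coefC mulr1 add0r.
pose s := [:: 1, s2 & l]; pose j := p.*2.+2.
have ss : size s = j by rewrite /= sl.
have sne : {in s, forall a, a != 0}.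
  move=> a; rewrite !inE => /or3P[/eqP ->|/eqP ->|/lpos /lt0r_neq0 //].
    by rewrite oner_eq0.
  by rewrite lt_eqF.
pose sg := Num.sg t.[y].
pose kx (x : R) : {poly R} := u * cfN s + (sg * x) *: 'X.
pose T := u * t.
pose cf x := cf_expand (j + 2) (kx x) T.
have T0 : T`_0 = 1 by rewrite /T coef0M u0 mul1r -tE cfD_coef0.
have T00 : T`_0 != 0 by rewrite T0 oner_eq0.
have kx0 x : (kx x)`_0 = 1.
  by rewrite /kx coefD coefZ coefX coef0M u0 cfN_coef0 mulr0 addr0 mulr1.
have kxy x : (kx x).[y] = sg * x * y.
  by rewrite /kx hornerD hornerM uy mul0r add0r hornerZ hornerX.
have su : (size u <= 2)%N.
  rewrite (leq_trans (size_polyD _ _)) // geq_max size_poly1 /=.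
  by rewrite (leq_trans (size_scale_leq _ _)) // size_polyX.
have [sN sD] := size_cf s; rewrite ss in sN sD; rewrite tE in sD.
have skx x : (size (kx x) <= uphalf (j + 2))%N.
  rewrite (leq_trans (size_polyD _ _)) // geq_max; apply/andP; split; last first.
    by rewrite (leq_trans (size_scale_leq _ _)) // size_polyX /j; clear; lia.
  rewrite (leq_trans (size_polyMleq _ _)) //.
  by move: sN su; move: (size _) (size _) => v w; rewrite /j; clear; lia.
have sT : (size T <= (j + 2)./2.+1)%N.
  rewrite (leq_trans (size_polyMleq _ _)) //.
  by move: sD su; move: (size _) (size _) => v w; rewrite /j; clear; lia.
(* At [x = 0] the factor [u] is common to numerator and denominator, which costs two terms. *)
have E0 : cf_expand (j + 2) (u * cfN s) T = s ++ [:: 0; 0].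
  have c0 : u`_0 != 0 by rewrite u0 oner_eq0.
  by have := cf_expand_cf 2 c0 sne; rewrite ss tE.
have cX : x @[x --> (0:R)^'+] --> (0 : R) by apply: cvg_at_right_filter; exact: cvg_id.
have ckx k : (kx x)`_k @[x --> (0:R)^'+] --> (u * cfN s)`_k.
  under eq_fun do rewrite /kx coefD coefZ.
  have : (u * cfN s)`_k + sg * x * ('X`_k : R) @[x --> (0:R)^'+] -->
      (u * cfN s)`_k + sg * 0 * ('X`_k : R).
    apply: cvgD; first exact: cvg_cst.
    by apply: cvgM; [apply: cvgM => //; exact: cvg_cst|exact: cvg_cst].
  by rewrite mulr0 mul0r addr0.
have ccf i : (i <= j)%N -> (cf x)`_i @[x --> (0:R)^'+] --> (s ++ [:: 0; 0])`_i.
  move=> ij; rewrite -E0; apply: cf_expand_cvg => //.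
  - by move=> k; exact: cvg_cst.
  - move=> a; rewrite (@cf_expand_take _ _ (j + 2)); last by rewrite (leq_trans ij) // leq_addr.
    by rewrite E0 takel_cat ?ss // => /mem_take /sne.
  - by rewrite (leq_ltn_trans ij) // addn2.
have scf x : size (cf x) = j.+2 by rewrite size_cf_expand addn2.
have cf0 x : (cf x)`_0 = 1 by rewrite /cf addn2 /= kx0 T0 divr1.
pose S x := (cf x)`_1; pose L x := drop 2 (cf x).
have cfE x : cf x = [:: 1, S x & L x].
  rewrite /S /L; have := scf x; have := cf0 x; case: (cf x) => [//|a [//|c r]] /= -> _.
  by rewrite drop0.
have sL x : size (L x) = p.*2.+2 by rewrite size_drop scf.
have nL x i : (L x)`_i = (cf x)`_i.+2 by rewrite nth_drop.
have cS : S x @[x --> (0:R)^'+] --> s2 by apply: (ccf 1%N).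
have cL i : (i < p.*2)%N -> (L x)`_i @[x --> (0:R)^'+] --> l`_i.
  move=> ip; under eq_fun do rewrite nL.
  have -> : l`_i = (s ++ [:: 0; 0])`_i.+2 by rewrite nth_cat ss /j !ltnS ip.
  by apply: ccf; rewrite /j !ltnS ltnW.
have cLe : (L x)`_(p.*2) @[x --> (0:R)^'+] --> (0 : R).
  under eq_fun do rewrite nL.
  have Ej : (s ++ [:: 0; 0])`_j = 0 by rewrite nth_cat ss /j ltnn subnn.
  by have := ccf j (leqnn j); rewrite Ej.
(* The first [j] terms converge to [s], so for small [x] the denominator of this convergent has at
   [y] the sign of [t]. *)
pose lx x := cf_expand j (kx x) T.
have lxE x : lx x = take j (cf x) by apply: cf_expand_take; rewrite leq_addr.
have slx x : size (lx x) = j by rewrite size_cf_expand.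
have [_ cDy] : (cfN (lx x)).[y] @[x --> (0:R)^'+] --> (cfN s).[y] /\
    (cfD (lx x)).[y] @[x --> (0:R)^'+] --> (cfD s).[y].
  apply: cf_horner_cvg => [x|i]; first by rewrite slx ss.
  under eq_fun do rewrite lxE.
  have [ij|ji] := ltnP i j.
    under eq_fun do rewrite nth_take //.
    have -> : s`_i = (s ++ [:: 0; 0])`_i by rewrite nth_cat ss ij.
    by apply: ccf; exact: ltnW.
  rewrite nth_default ?ss //; under eq_fun do rewrite nth_default ?size_take ?scf ?ltnS ?leqnSn //.
  exact: cvg_cst.
rewrite tE in cDy.
have sgt : 0 < sg * t.[y] by rewrite /sg -normrEsg normr_gt0.
have good : \forall x \near (0:R)^'+,
    [/\ 0 < x, S x < 0, forall i : 'I_(p.*2), 0 < (L x)`_i & 0 < sg * (cfD (lx x)).[y]].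
  near=> x; split; near: x.
  - exact: nbhs_right_gt.
  - exact: (cvgr_lt _ cS).
  - apply: filter_forall => i; apply: (cvgr_gt _ (cL i (ltn_ord i))).
    by apply: lpos; rewrite mem_nth // sl.
  - apply: (cvgr_gt _ _ _ sgt); apply: cvgM => //; exact: cvg_cst.
have good2 : \forall x \near (0:R)^'+, 0 < (L x)`_(p.*2) /\ cfD (cf x) = T.
  apply: filterS good => x [x0 Sx Lx Dx].
  have lxS : lx x = [:: 1, S x & take p.*2 (L x)] by rewrite lxE cfE.
  have tpos : {in take p.*2 (L x), forall a, 0 < a}.
    apply: (@seq_pos _ _ p.*2); first by rewrite size_take sL ltnW.
    by move=> i; rewrite nth_take.
  have lxne : {in lx x, forall a, a != 0}.
    move=> a; rewrite lxS !inE => /or3P[/eqP ->|/eqP ->|/tpos /lt0r_neq0 //].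
      by rewrite oner_eq0.
    by rewrite lt_eqF.
  have E2 := cf_rest_coef0 T00 lxne; have X2 := cf_rest_cross T00 lxne.
  have [sM _] := @size_cf_rest _ j 2 _ _ (skx x) sT.
  set M := (cf_rest j (kx x) T).1 in X2 sM.
  have e0 : (L x)`_(p.*2) = M`_0 / (cf_rest j (kx x) T).2`_0.
    by rewrite nL /cf nth_cf_expand // addn2.
  have prodneg : \prod_(a <- lx x) a < 0.
    rewrite lxS !big_cons mul1r nmulr_rlt0 //.
    by rewrite big_seq; apply: prodr_gt0 => a /tpos.
  (* The convergent formula is evaluated at [y], where [T] vanishes and [kx x] is [sg x y]. As [M]
     is constant and the odd power [y ^ (j - 1)] negative, the sign of [M(0)] follows. *)
  have M0 : M`_0 < 0.
    have := congr1 (fun q => q.[y]) X2; rewrite -/(lx x).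
    have Ty : T.[y] = 0 by rewrite hornerM uy mul0r.
    rewrite -[(-1) ^+ j]signr_odd /j /= negbK odd_double expr0 mul1r.
    rewrite (size1_polyC sM) hornerD hornerN [(kx x * _).[y]]hornerM kxy.
    rewrite [(_ * T).[y]]hornerM Ty mulr0 subr0 hornerM horner_exp hornerX hornerC => H.
    have {}H : sg * x * (cfD (lx x)).[y] = y ^+ p.*2.+1 * M`_0.
      have yn0 : y != 0 by rewrite lt_eqF.
      by apply: (mulIf yn0); rewrite mulrAC H !exprS; ring.
    have hp : 0 < sg * x * (cfD (lx x)).[y] by rewrite mulrAC mulr_gt0.
    have hy : y ^+ p.*2.+1 < 0 by rewrite exprn_odd_lt0 //= odd_double.
    by move: hp; rewrite H (nmulr_rgt0 _ hy) coefC.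
  have ep : 0 < (L x)`_(p.*2).
    by rewrite e0 E2 T0 mul1r nmulr_rgt0 // invr_lt0.
  split=> //.
  have [|||_] := @cf_exact _ j.+1 (kx x) T T00.
  - by have := skx x; rewrite addn2.
  - by have := sT; rewrite addn2.
  - rewrite (@cf_expand_take _ _ (j + 2)) ?addn2 // -addn2 -/(cf x).
    rewrite (take_nth 0) ?scf // => a; rewrite mem_rcons inE => /predU1P[->|].
      by rewrite -[j]/(p.*2.+2) -nL lt0r_neq0.
    by rewrite -lxE => /lxne.
  - by rewrite T0 scale1r -addn2 => EX; rewrite /cf -EX.
have cLast : (L x)`_(p.*2.+1) @[x --> (0:R)^'+] --> b.
  (* The coefficient of ['X] in [T] is the sum of all terms but the first; the last term is what the
     limits of the others leave. *)
  have bE : b = T`_1 - s2 - \sum_(i < p.*2) l`_i - 0.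
    rewrite subr0 /T coefM !big_ord_recr big_ord0 /= u0 u1 add0r mul1r.
    have -> : t`_0 = 1 by rewrite -tE cfD_coef0.
    rewrite -{1}tE cfD_coef1 big_cons (big_nth 0) big_mkord sl mulr1.
    by move: (\sum_(_ < _) _) => z; ring.
  rewrite bE.
  apply: (@cvg_trans _ ((T`_1 - S x - \sum_(i < p.*2) (L x)`_i - (L x)`_(p.*2)) @[x --> (0:R)^'+])).
    apply: near_eq_cvg; apply: filterS good2 => x [_ Ex].
    rewrite -Ex cfE cfD_coef1 big_cons (big_nth 0) big_mkord sL !big_ord_recr /=.
    by move: (\sum_(_ < _) _) => z; ring.
  apply: cvgB => //; apply: cvgB; first by apply: cvgB => //; exact: cvg_cst.
  by apply: cvg_sum_seq => i; exact: cL.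
exists S, L; split=> //.
have lastpos : \forall x \near (0:R)^'+, 0 < (L x)`_(p.*2.+1) by apply: (cvgr_gt _ cLast).
near=> x.
have [x0 Sx Lx _] : [/\ 0 < x, S x < 0, forall i : 'I_(p.*2), 0 < (L x)`_i & 0 < sg * (cfD (lx x)).[y]].
  by near: x.
have [Lp DT] : 0 < (L x)`_(p.*2) /\ cfD (cf x) = T by near: x.
have Lq : 0 < (L x)`_(p.*2.+1) by near: x.
split=> //; last by rewrite -cfE DT /T mulrC.
apply: (seq_pos (sL x)) => i.
have [ip|] := ltnP i p.*2; first exact: Lx (Ordinal ip).
rewrite leq_eqVlt => /predU1P[<- //|]; rewrite leq_eqVlt => /predU1P[<- //|].
by move=> h; have := leq_ltn_trans h (ltn_ord i); rewrite ltnn.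
Unshelve. all: by end_near.
Qed.

(** The form of [t] normalised by [t(0) = 1], with roots [- 1 / b]. The parameter [b0] is kept apart
    because it will be negative: its root comes from the Salem number. *)
Definition nodes (R : realType) (b0 : R) (bs : seq R) : {poly R} :=
  (1 + b0 *: 'X) * \prod_(b <- bs) (1 + b *: 'X).

Lemma horner_node (R : realType) (b x : R) : (1 + b *: 'X).[x] = 1 + b * x.
Proof. by rewrite hornerD hornerZ hornerX hornerC. Qed.

Lemma nodes_rem (R : realType) (b0 b : R) bs : b \in bs ->
  nodes b0 bs = nodes b0 (rem b bs) * (1 + b *: 'X).
Proof.
move=> bbs; rewrite /nodes (perm_big _ (perm_to_rem bbs)) big_cons /= -mulrA.
by congr (_ * _); rewrite mulrC.
Qed.

Lemma nodes_neq0 (R : realType) (b0 b : R) bs : b0 < 0 -> 0 < b -> b \notin bs ->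
  (nodes b0 bs).[- b^-1] != 0.
Proof.
move=> b00 bp bbs; have bn0 : b != 0 by rewrite gt_eqF.
have H a : (1 + a *: 'X).[- b^-1] = 0 -> a = b.
  rewrite horner_node mulrN => /eqP; rewrite subr_eq0 => /eqP /esym/(congr1 ( *%R^~ b)).
  by rewrite mulfVK // mul1r.
rewrite hornerM mulf_neq0 //; first by apply/eqP => /H E; move: b00; rewrite E ltNge ltW.
rewrite horner_prod; elim: bs bbs => [|a bs IH]; first by rewrite big_nil oner_eq0.
rewrite inE negb_or big_cons => /andP[ba /IH h]; rewrite mulf_neq0 //.
by apply/eqP => /H E; rewrite E eqxx in ba.
Qed.

(** With terms [1, s, l0, l1] the denominator is [1 + (s + l0 + l1) X + s l1 X ^ 2]. The parameter
    [d = l0 + l1] is free, and [b1 < d] makes [s] negative and [l0] positive. *)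
Lemma admissible_two (R : realType) (b0 b1 d : R) : b0 < 0 -> 0 < b1 -> b1 < d ->
  admissible (nodes b0 [:: b1]) (b0 + b1 - d)
    [:: d - b0 * b1 / (b0 + b1 - d); b0 * b1 / (b0 + b1 - d)].
Proof.
move=> h0 h1 hd; set s := b0 + b1 - d; set g := b0 * b1 / s.
have s0 : s < 0 by rewrite /s; lra.
have sn0 : s != 0 by rewrite lt_eqF.
have g0 : 0 < g by rewrite /g nmulr_rgt0 ?invr_lt0 // nmulr_rlt0.
have gs : g * s = b0 * b1 by rewrite /g divfK.
split=> //.
  have d0 : 0 < d - g.
    have : (d - g) * s < 0.
      by rewrite mulrBl gs /s; nra.
    by rewrite nmulr_llt0.
  by move=> a; rewrite !inE => /orP[/eqP ->|/eqP ->].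
rewrite /nodes big_seq1 /=.
have -> : b1 = s + d - b0 by rewrite /s; ring.
have : b0 * b1 = g * s by [].
have -> : b1 = s + d - b0 by rewrite /s; ring.
clearbody s g => E.
rewrite -!mul_polyC !mulr0 !addr0 !mulr1.
have -> : (1 + b0%:P * 'X) * (1 + (s + d - b0)%:P * 'X) =
   1 + (s + d)%:P * 'X + (b0 * (s + d - b0))%:P * 'X ^+ 2 :> {poly R}.
  by rewrite !(rmorphD, rmorphB, rmorphM, rmorphN) /=; ring.
by rewrite E !(rmorphD, rmorphB, rmorphM, rmorphN) /=; ring.
Qed.

(** Each induction step removes in turn two distinct nodes by means of [admissible_extend].
    Existence is carried along: the coefficient of the last term but one disappears in the limit and
    needs an actual tuple. *)
Lemma cf_independent (R : realType) (b0 : R) n (bs : seq R) : b0 < 0 ->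
  size bs = n.+1 -> uniq bs -> {in bs, forall b, 0 < b} ->
  (exists s2 l, size l = n.+1.*2 /\ admissible (nodes b0 bs) s2 l) /\
  forall (c : R) (a : nat -> R),
    (forall s2 l, size l = n.+1.*2 -> admissible (nodes b0 bs) s2 l ->
      c + \sum_(i < n.+1.*2) a i * l`_i = 0) ->
    c = 0 /\ forall i, (i < n.+1.*2)%N -> a i = 0.
Proof.
move=> h0; elim: n bs => [|n IH] bs sbs ubs pbs.
  case: bs sbs ubs pbs => [|b1 []] // _ _ pbs.
  have h1 : 0 < b1 by apply: pbs; rewrite mem_head.
  have adm k := @admissible_two _ b0 b1 (b1 + k) h0 h1.
  split.
    have hk : b1 < b1 + 1 by rewrite ltrDl.
    by do 2!eexists; split; last exact: adm hk; rewrite doubleS.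
  move=> c a H.
  (* Multiplied by [b0 - k], the relation is polynomial of degree at most 2 in [k]; three values
     decide it. *)
  have {}H k : 0 < k -> c * (b0 - k) + a 0%N * ((b1 + k) * (b0 - k) - b0 * b1) + a 1%N * (b0 * b1) = 0.
    move=> k0; have hk : b1 < b1 + k by rewrite ltrDl.
    have := H _ _ _ (adm k hk); rewrite !big_ord_recr big_ord0 /= add0r.
    have -> : b0 + b1 - (b1 + k) = b0 - k by ring.
    have kn0 : b0 - k != 0 by rewrite lt_eqF //; lra.
    move=> /(_ erefl) /(congr1 ( *%R^~ (b0 - k))); rewrite mul0r => <-.
    by field.
  have e1 := H 1 ltr01; have e2 := H 2 (ltr0Sn R 1); have e3 := H 3 (ltr0Sn R 2).
  have a0 : a 0%N = 0 by lra.
  rewrite a0 in e1 e2.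
  have c0 : c = 0 by lra.
  rewrite c0 in e1; split=> // -[|[|i]] // _.
  move: e1; rewrite !mul0r !add0r => /eqP; rewrite mulf_eq0 => /orP[/eqP //|].
  by rewrite mulf_eq0 lt_eqF // gt_eqF.
have remP b : b \in bs -> [/\ size (rem b bs) = n.+1, uniq (rem b bs),
    {in rem b bs, forall b, 0 < b} & (nodes b0 (rem b bs)).[- b^-1] != 0].
  move=> bbs; split.
  - by rewrite size_rem // sbs.
  - exact: rem_uniq.
  - by move=> x /mem_rem /pbs.
  - by apply: nodes_neq0; rewrite ?pbs // mem_rem_uniqF.
case: bs sbs ubs pbs remP => [|b1 [|b2 bs]] // sbs ubs pbs remP.
set B := [:: b1, b2 & bs] in sbs ubs pbs remP *.
have B1 : b1 \in B by rewrite mem_head.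
have B2 : b2 \in B by rewrite !inE eqxx orbT.
have ex : exists s2 l, size l = n.+2.*2 /\ admissible (nodes b0 B) s2 l.
  have [s1 u1 p1 y1] := remP _ B1.
  have [[s2 [l [sl adm]]] _] := IH _ s1 u1 p1.
  have [S [L [near_adm sL _ _ _]]] := admissible_extend (pbs _ B1) y1 adm sl.
  have [x hx] := @filter_ex _ _ (at_right_proper_filter (0 : R)) _ near_adm.
  by exists (S x), (L x); rewrite (nodes_rem _ B1) sL.
split=> // c a H.
(* In the limit the last term contributes [b] times its coefficient, which joins the constant of a
   relation for the remaining nodes. *)
have key b : b \in B -> c + a n.+1.*2.+1 * b = 0 /\ forall i, (i < n.+1.*2)%N -> a i = 0.
  move=> bB; have [s1 u1 p1 y1] := remP _ bB.
  have [_] := IH _ s1 u1 p1; apply => s2 l sl adm.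
  have [S [L [near_adm sL cL ce cb]]] := admissible_extend (pbs _ bB) y1 adm sl.
  pose f x := c + (\sum_(i < n.+1.*2) a i * (L x)`_i + a n.+1.*2 * (L x)`_(n.+1.*2) +
      a n.+1.*2.+1 * (L x)`_(n.+1.*2.+1)).
  have cf : f x @[x --> (0 : R)^'+] --> c + (\sum_(i < n.+1.*2) a i * l`_i + a n.+1.*2 * 0 +
      a n.+1.*2.+1 * b).
    apply: cvgD; first exact: cvg_cst.
    apply: cvgD; last by apply: cvgM => //; exact: cvg_cst.
    apply: cvgD; last by apply: cvgM => //; exact: cvg_cst.
    by apply: cvg_sum_seq => i; apply: cvgM; [exact: cvg_cst|exact: cL].
  have f0 : \forall x \near (0 : R)^'+, f x = 0.
    apply: filterS near_adm => x hx.
    have := H (S x) (L x); rewrite (nodes_rem _ bB) => /(_ (sL x) hx).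
    by rewrite doubleS big_ord_recr big_ord_recr.
  have cf0 : f x @[x --> (0 : R)^'+] --> (0 : R) by exact: cvg_near_cst f0.
  have := @norm_cvg_unique _ _ _ _ _ _ cf cf0.
  by rewrite mulr0 addr0 => E; rewrite -[RHS]E; ring.
have [k1 aE] := key _ B1; have [k2 _] := key _ B2.
have b12 : b1 - b2 != 0.
  by move: ubs; rewrite /= inE negb_or subr_eq0 => /andP[/andP[]].
have alast : a n.+1.*2.+1 = 0.
  have : a n.+1.*2.+1 * (b1 - b2) = 0 by lra.
  by move/eqP; rewrite mulf_eq0 (negbTE b12) orbF => /eqP.
have c0 : c = 0 by move: k1; rewrite alast mul0r addr0.
split=> // i; rewrite doubleS ltnS leq_eqVlt => /predU1P[-> //|].
rewrite ltnS leq_eqVlt => /predU1P[->|/aE //].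
(* Only the coefficient of the last term but one is left, and that term is positive. *)
have [s2 [l [sl adm]]] := ex; have := H _ _ sl adm.
rewrite doubleS big_ord_recr big_ord_recr [LHS]/= alast c0 add0r mul0r addr0 big1 ?add0r => [|j _].
  move/eqP; rewrite mulf_eq0 => /orP[/eqP //|].
  case: adm => _ lp _; rewrite gt_eqF // lp // mem_nth // sl doubleS //.
by rewrite aE // mul0r.
Qed.

(** * The roots of t *)

Lemma mup_prod_XsubC (F : fieldType) (x : F) (s : seq F) :
  mup x (\prod_(a <- s) ('X - a%:P)) = count_mem x s.
Proof.
elim: s => [|a s IH]; first by rewrite big_nil mupNroot // /root hornerC oner_eq0.
rewrite big_cons mupM ?polyXsubC_eq0 ?monic_neq0 ?monic_prod_XsubC // IH /=.
by rewrite -['X - a%:P]expr1 mup_XsubCX; case: eqP.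
Qed.

Lemma uniq_of_count (T : eqType) (s : seq T) :
  {in s, forall x, (count_mem x s <= 1)%N} -> uniq s.
Proof.
move=> H; apply: count_mem_uniq => x; have [xs|xs] := boolP (x \in s).
  by apply/eqP; rewrite eqn_leq H //= -has_count has_pred1.
by apply/count_memPn.
Qed.

Section SalemNodes.
Variables (R : realType) (m : nat) (T : {poly int}).
Hypotheses (m0 : (0 < m)%N) (em : ~~ odd m) (sT : size T = m.+1).
Hypotheses (hT : salem_poly R T) (hsimple : simple_roots R T).
Hypotheses (hN1 : ~~ root T (-1)) (h1 : ~~ root T 1).

Let TR := polyR_of_int R T.
Let TC := polyC_of_int R T.
Let t := even_poly (hur m TR).

Lemma salem_monic : T \is monic. Proof. by case: hT. Qed.

Lemma salem_coef : T`_m = 1.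
Proof. by rewrite -[m]/(m.+1.-1) -sT -lead_coefE (monicP salem_monic). Qed.

Lemma salem_coef0 : T`_0 = 1.
Proof.
have [_ rT _ _] := hT.
have := congr1 (fun p : {poly int} => p`_0) rT.
by rewrite (reciprocalE sT) coef_poly /= subn0 salem_coef => <-.
Qed.

Lemma salem_hur : hur m TR = eo t 0.
Proof.
have [_ rT _ _] := hT.
apply: hur_self => //; first by rewrite size_polyR sT.
by rewrite /TR -polyR_rev -(reciprocalE sT) rT.
Qed.

Lemma salem_hurC : hur m TC = eo (toC t) 0.
Proof. by rewrite /TC -toC_polyR_of_int hur_map -/TR salem_hur toC_eo rmorph0. Qed.

Lemma sizeTC : size TC = m.+1.
Proof. by rewrite /TC -toC_polyR_of_int size_toC size_polyR. Qed.

Lemma hurC_eval z : (hur m TC).[z] = (toC t).[z ^+ 2].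
Proof. by rewrite salem_hurC horner_eo horner0 mul0r addr0. Qed.

Lemma t_horner1 : t.[1] = 2 ^+ m.
Proof.
have := hur_eval1 m TR; rewrite salem_hur horner_eo horner0 mul0r addr0 expr1n => ->.
by rewrite coef_map salem_coef0 mulr1.
Qed.

Lemma t_lead : t`_(m./2) != 0.
Proof.
have := hur_lead (m := m) (P := TR); rewrite salem_hur coef_eo (negbTE em) => -> //.
  rewrite -[1](rmorph1 (intmul 1 : {rmorphism int -> R})) horner_map intr_eq0.
  exact: h1.
by rewrite size_polyR sT.
Qed.

Lemma size_t : size t = (m./2).+1.
Proof.
apply: size_eq_of_coef t_lead.
by have [] := size_odd_even (size_hur m TR).
Qed.

Lemma rootTC z : z + 1 != 0 ->
  root (toC t) (z ^+ 2) = root TC ((z - 1) / (z + 1)).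
Proof.
move=> z1; rewrite /root -hurC_eval hur_eval ?sizeTC // mulf_eq0.
by rewrite expf_eq0 (negbTE z1) andbF.
Qed.

Lemma TC_monic : TC \is monic.
Proof.
apply/monicP; rewrite lead_coefE sizeTC /= /TC -toC_polyR_of_int coef_toC coef_map salem_coef.
by [].
Qed.

(** The square root could only be the pole [-1] of the Moebius map if [w = 1], but
    [t(1) = 2 ^ m]. *)
Lemma root_sqrt (w : R[i]) : root (toC t) w ->
  exists z, [/\ w = z ^+ 2, z + 1 != 0 & root TC ((z - 1) / (z + 1))].
Proof.
move=> rw; exists (sqrtc w); rewrite sqr_sqrtc.
have z1 : sqrtc w + 1 != 0.
  apply/eqP => /eqP; rewrite addr_eq0 => /eqP E.
  have w1 : w = 1 by rewrite -(sqr_sqrtc w) E sqrrN expr1n.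
  move: rw; rewrite w1 /root -[1](rmorph1 (real_complex R)) horner_toC t_horner1 rc_eq0.
  by rewrite expf_eq0 pnatr_eq0 andbF.
split=> //; move: rw; rewrite -{1}(sqr_sqrtc w) /root -hurC_eval hur_eval ?sizeTC //.
by rewrite mulf_eq0 expf_eq0 (negbTE z1) andbF.
Qed.

Lemma root_neq0 (x : R[i]) : root TC x -> x != 0.
Proof.
apply: contraTneq => ->; rewrite /root horner_coef0 /TC -toC_polyR_of_int coef_toC.
by rewrite coef_map salem_coef0 rc_eq0 oner_eq0.
Qed.

Lemma root_inv (x : R[i]) : root TC x -> root TC x^-1.
Proof.
move=> rx; have [_ rT _ _] := hT.
have x0 := root_neq0 rx.
have E : rev_poly m TC = TC.
  by rewrite /TC -toC_polyR_of_int rev_poly_map -polyR_rev -(reciprocalE sT) rT.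
have := rev_poly_eval (m := m) (P := TC) (z := x); rewrite sizeTC leqnn E => /(_ isT x0).
move: rx; rewrite /root => /eqP -> /esym/eqP.
by rewrite mulf_eq0 expf_eq0 (negbTE x0) andbF.
Qed.

Lemma Re_mobius_norm1 (z : R[i]) : z + 1 != 0 -> `|(z - 1) / (z + 1)| = 1 -> Re z = 0.
Proof.
move=> z1 /eqP; rewrite normf_div.
rewrite -(inj_eq (mulIf (_ : `|z + 1| != 0))); last by rewrite normr_eq0.
rewrite divfK ?normr_eq0 // mul1r => /eqP E.
have := normc_le (z - 1) (z + 1); rewrite E lexx => /esym h1'.
have := normc_le (z + 1) (z - 1); rewrite E lexx => /esym h2'.
by move: h1' h2'; case: z {E z1} => a b /=; rewrite !addr0 ?subr0 => *; nra.
Qed.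

Lemma mobiusK (F : numFieldType) (z : F) : z + 1 != 0 ->
  z = (1 + (z - 1) / (z + 1)) / (1 - (z - 1) / (z + 1)).
Proof.
move=> z1.
have -> : 1 + (z - 1) / (z + 1) = 2 * z / (z + 1) by field.
have -> : 1 - (z - 1) / (z + 1) = 2 / (z + 1) by field.
by field; rewrite z1.
Qed.

(** Roots of [T] on the unit circle give an imaginary [z], hence [w = z ^ 2] negative. Those off the
    circle are [beta] and [beta^-1], because roots are stable under inversion; they give opposite
    values of [z], hence the same [w]. *)
Lemma salem_t_roots : exists2 z0 : R, 1 < z0 &
  root t z0 /\
  forall w : R[i], root (toC t) w -> w = z0%:C%C \/ exists2 y : R, y < 0 & w = y%:C%C.
Proof.
have [_ _ [beta [b1 mub Hb]] _] := hT.
pose g := (1 + beta) / (1 - beta).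
have bn : 1 - beta != 0 by rewrite subr_eq0 lt_eqF.
have g2 : 1 < g ^+ 2.
  rewrite /g expr_div_n ltr_pdivlMr ?mul1r; last by rewrite exprn_even_gt0.
  by nra.
have gC : g%:C%C = (1 + beta%:C%C) / (1 - beta%:C%C).
  by rewrite /g rcM rcV rcD rcB.
have rb : root TC beta%:C%C.
  apply: contraT => /mupNroot; rewrite mub; done.
exists (g ^+ 2) => //; split.
  have g1 : g%:C%C + 1 != 0.
    have -> : g%:C%C + 1 = (2 / (1 - beta))%:C%C.
      have -> : 2 / (1 - beta) = g + 1 by rewrite /g; field.
      by rewrite rcD.
    by rewrite rc_eq0 mulf_neq0 ?invr_eq0 // pnatr_eq0.
  have := rootTC g1.
  have -> : (g%:C%C - 1) / (g%:C%C + 1) = beta%:C%C.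
    have e1 : g%:C%C - 1 = (g - 1)%:C%C by rewrite rcB.
    have e2 : g%:C%C + 1 = (g + 1)%:C%C by rewrite rcD.
    rewrite e1 e2 -rcV -rcM; congr (_%:C%C).
    have -> : g - 1 = 2 * beta / (1 - beta) by rewrite /g; field.
    have -> : g + 1 = 2 / (1 - beta) by rewrite /g; field.
    by field; rewrite bn.
  by rewrite rb -rcX /root horner_toC rc_eq0 => ->.
move=> w /root_sqrt [z [-> z1 rx]].
set x := (z - 1) / (z + 1) in rx.
have zE := mobiusK z1; rewrite -/x in zE.
have real_case : x = beta%:C%C \/ x^-1 = beta%:C%C -> z ^+ 2 = (g ^+ 2)%:C%C.
  move=> [E|E]; rewrite zE rcX gC; first by rewrite E.
  have xE : x = beta%:C%C^-1 by rewrite -E invrK.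
  have b0 : beta%:C%C != 0 by rewrite rc_eq0 gt_eqF // (lt_trans ltr01).
  have bn1 : 1 - beta%:C%C != 0 by rewrite -[1]/(1%:C%C) -rcB rc_eq0.
  rewrite xE.
  have -> : (1 + beta%:C%C^-1) / (1 - beta%:C%C^-1) = - ((1 + beta%:C%C) / (1 - beta%:C%C)).
    have h : 1 - beta%:C%C^-1 = - (1 - beta%:C%C) / beta%:C%C by field.
    rewrite h; field; rewrite b0 bn1; done.
  by rewrite sqrrN.
have [n1|n1] := eqVneq `|x| 1.
  right; have Rz := Re_mobius_norm1 z1 n1.
  have E := sqr_imaginary Rz.
  exists (- Im z ^+ 2) => //; rewrite oppr_lt0 exprn_even_gt0 //=.
  (* [z = 0] corresponds to the excluded root [-1] of [T]. *)
  apply/eqP => I0.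
  have z0 : z = 0 by apply/eqP; rewrite eq_complex /= Rz I0 !eqxx.
  move: rx; rewrite /x z0 sub0r add0r divr1 /root.
  have -> : -1 = (-1 : R)%:C%C by rewrite -[1]/(1%:C%C) -rmorphN.
  rewrite /TC -toC_polyR_of_int horner_toC rc_eq0.
  rewrite -[-1](rmorphN1 (intmul 1 : {rmorphism int -> R})) horner_map intr_eq0.
  by move=> E1; move: hN1; rewrite /root E1.
left; apply: real_case.
have [gt1|le1] := boolP (1 < `|x|); first by left; apply: Hb.
right; apply: Hb; first exact: root_inv.
have xn := root_neq0 rx.
rewrite normrV ?unitfE // invf_gt1 ?normr_gt0 //.
by rewrite real_ltNge ?real1 ?normr_real // le_eqVlt negb_or eq_sym n1.
Qed.

Lemma toC_inj : injective (fun p : {poly R} => toC p).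
Proof. by apply: map_inj_poly => //; exact: complexI. Qed.

Lemma TC_uniq_factor : exists2 xs : seq R[i], uniq xs & TC = \prod_(x <- xs) ('X - x%:P).
Proof.
have [xs E] := closed_field_poly_normal TC.
rewrite (monicP TC_monic) scale1r in E; exists xs => //.
apply: uniq_of_count => x xxs; rewrite -mup_prod_XsubC -E hsimple //.
by rewrite -/TC E root_prod_XsubC.
Qed.

Lemma hurC_factor : exists (c : R[i]) (zs : seq R[i]),
  [/\ c != 0, uniq zs & hur m TC = c *: \prod_(z <- zs) ('X - z%:P)].
Proof.
have [xs uxs E] := TC_uniq_factor.
have x1 x : x \in xs -> 1 - x != 0.
  move=> xxs; rewrite subr_eq0 eq_sym; apply/eqP => x1.
  have : root TC x by rewrite E root_prod_XsubC.
  rewrite x1 /root /TC -toC_polyR_of_int -[1](rmorph1 (real_complex R)) horner_toC rc_eq0.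
  rewrite -[1](rmorph1 (intmul 1 : {rmorphism int -> R})) horner_map intr_eq0.
  by move=> E1; move: h1; rewrite /root E1.
have sxs : size xs = m.
  by have := sizeTC; rewrite E size_prod_XsubC => -[].
exists (\prod_(x <- xs) (1 - x)), [seq (1 + x) / (1 - x) | x <- xs]; split.
- rewrite prodf_seq_neq0; apply/allP => x /x1; done.
- rewrite map_inj_in_uniq // => x y /x1 hx /x1 hy /eqP.
  rewrite eqr_div // => /eqP H.
  have : 2 * (x - y) = (1 + x) * (1 - y) - (1 + y) * (1 - x) by ring.
  rewrite H subrr.
  by move/eqP; rewrite mulf_eq0 pnatr_eq0 /= subr_eq0 => /eqP.
apply: (@poly_eq_eval _ [:: -1]) => z; rewrite inE => z1.
have {}z1 : z + 1 != 0 by rewrite -[1]opprK subr_eq0.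
rewrite hur_eval ?sizeTC // E hornerZ !horner_prod big_map -sxs.
elim: xs x1 {E uxs sxs} => [|x xs IH] x1; first by rewrite !big_nil.
rewrite !big_cons /= exprS !hornerXsubC.
have hx : 1 - x != 0 by apply: x1; rewrite mem_head.
have /IH H : {in xs, forall x, 1 - x != 0}.
  by move=> y yxs; apply: x1; rewrite inE yxs orbT.
rewrite mulrACA H [RHS]mulrACA; congr (_ * _).
by field; rewrite hx z1.
Qed.

Lemma t_real_factor : exists2 L : seq R, t = lead_coef t *: \prod_(r <- L) ('X - r%:P) &
  size L = m./2.
Proof.
have [z0 z01 [rz0 Hroots]] := salem_t_roots.
have [rs E] := closed_field_poly_normal (toC t).
have rsE : rs = map (real_complex R) (map (@complex.Re R) rs).
  rewrite -map_comp -[LHS]map_id; apply/eq_in_map => w wrs /=.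
  have : root (toC t) w.
    rewrite E rootZ ?root_prod_XsubC // lead_coef_eq0.
    by rewrite -size_poly_eq0 size_toC size_t.
  by move/Hroots => [->|[y _ ->]].
exists (map (@complex.Re R) rs).
  apply: toC_inj; rewrite E {1}rsE map_polyZ rmorph_prod /= big_map.
  rewrite lead_coef_map; congr (_ *: _).
  by apply: eq_bigr => r _; rewrite rmorphB /= map_polyX map_polyC.
have : size (toC t) = (m./2).+1 by rewrite size_toC size_t.
rewrite E size_scale ?size_prod_XsubC; first by case=> <-; rewrite size_map.
by rewrite lead_coef_eq0 -size_poly_eq0 size_toC size_t.
Qed.

(** A double root [r] of [t] would give a double root [sqrt r] of [H_T(z) = t(z ^ 2)], whose roots
    are simple as those of [T] are. *)
Lemma t_roots_uniq (L : seq R) : t = lead_coef t *: \prod_(r <- L) ('X - r%:P) -> uniq L.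
Proof.
move=> E; apply: uniq_of_count => r rL.
rewrite leqNgt; apply/negP => cnt.
have : (('X - r%:P) ^+ 2 %| t)%R.
  rewrite E dvdpZr ?lead_coef_eq0 -?size_poly_eq0 ?size_t //.
  by rewrite -mup_geq ?mup_prod_XsubC // monic_neq0 // monic_prod_XsubC.
case/dvdpP => q Eq.
have [c [zs [c0 uzs Hz]]] := hurC_factor.
pose w := sqrtc r%:C%C.
have : (('X - w%:P) ^+ 2 %| hur m TC)%R.
  apply/dvdpP; exists ((toC q \Po 'X^2) * ('X + w%:P) ^+ 2).
  rewrite salem_hurC Eq /eo comp_poly0 mul0r addr0 rmorphM rmorphXn rmorphB /=.
  rewrite map_polyX map_polyC comp_polyM rmorphXn rmorphB /= comp_polyX comp_polyC.
  rewrite -[(real_complex R) r]/(r%:C%C) -(sqr_sqrtc r%:C%C) -/w rmorphXn /=; ring.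
rewrite Hz dvdpZr // -mup_geq ?monic_neq0 ?monic_prod_XsubC // mup_prod_XsubC.
by rewrite count_uniq_mem //; case: (_ \in _).
Qed.

Lemma nodes_coef0 (b0 : R) bs : (nodes b0 bs)`_0 = 1.
Proof.
rewrite -horner_coef0 hornerM horner_node mulr0 addr0 mul1r horner_prod big1 // => b _.
by rewrite horner_node mulr0 addr0.
Qed.

Lemma salem_nodes : exists (b0 : R) (bs : seq R),
  [/\ b0 < 0, {in bs, forall b, 0 < b}, uniq bs & (size bs).+1 = m./2] /\
  [/\ (0 < size bs)%N, 0 < t`_0 & t = t`_0 *: nodes b0 bs].
Proof.
have [z0 z01 [rz0 Hroots]] := salem_t_roots.
have [L E sL] := t_real_factor; have uL := t_roots_uniq E.
have lead0 : lead_coef t != 0 by rewrite lead_coef_eq0 -size_poly_eq0 size_t.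
have rL r : root t r = (r \in L) by rewrite E rootZ // root_prod_XsubC.
have z0L : z0 \in L by rewrite -rL.
have z0p : 0 < z0 by rewrite (lt_trans ltr01).
have Lneg r : r \in rem z0 L -> r < 0.
  rewrite mem_rem_uniq // inE => /andP[rz rinL].
  have : root (toC t) r%:C%C by rewrite /root horner_toC rc_eq0; move: rinL; rewrite -rL.
  by move/Hroots => [[/eqP]|[y y0 [->]]] //; rewrite (negbTE rz).
exists (- z0^-1), [seq - r^-1 | r <- rem z0 L].
have tE : t = t`_0 *: nodes (- z0^-1) [seq - r^-1 | r <- rem z0 L].
  have fac (r : R) : r != 0 -> 'X - r%:P = (- r) *: (1 + (- r^-1) *: 'X).
    move=> r0; rewrite scalerDr scalerA mulrNN divff // scale1r addrC.
    by rewrite scaleNr alg_polyC.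
  have [c Ec] : exists c, t = c *: nodes (- z0^-1) [seq - r^-1 | r <- rem z0 L].
    rewrite E (perm_big _ (perm_to_rem z0L)) big_cons /= /nodes big_map.
    rewrite fac ?gt_eqF //.
    have [d ->] : exists d, \prod_(r <- rem z0 L) ('X - r%:P) =
        d *: \prod_(r <- rem z0 L) (1 + (- r^-1) *: 'X).
      elim: (rem z0 L) Lneg => [|r K IH] H; first by exists 1; rewrite !big_nil scale1r.
      have [|d Ed] := IH; first by move=> x xK; apply: H; rewrite inE xK orbT.
      exists (- r * d); rewrite !big_cons Ed fac; last by rewrite lt_eqF // H // mem_head.
      by rewrite -scalerAl -scalerAr scalerA.
    by exists (lead_coef t * (- z0 * d)); rewrite -scalerAl -scalerAr !scalerA mulrA.
  by rewrite {2}Ec coefZ nodes_coef0 mulr1.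
have bpos : {in [seq - r^-1 | r <- rem z0 L], forall b, 0 < b}.
  by move=> b /mapP[r /Lneg r0 ->]; rewrite oppr_gt0 invr_lt0.
split; split=> //.
- by rewrite oppr_lt0 invr_gt0.
- rewrite map_inj_uniq ?rem_uniq // => x y /oppr_inj; exact: invr_inj.
- by rewrite size_map size_rem // -sL prednK // -has_predT; apply/hasP; exists z0.
(* The root of [T] on the unit circle provides a negative root of [t]. *)
- rewrite size_map.
  have [_ _ _ [x rx x1]] := hT.
  have xn1 : 1 - x != 0.
    rewrite subr_eq0 eq_sym; apply/eqP => xE; move: rx.
    rewrite xE /root -toC_polyR_of_int -[1](rmorph1 (real_complex R)) horner_toC rc_eq0.
    rewrite -[1](rmorph1 (intmul 1 : {rmorphism int -> R})) horner_map intr_eq0.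
    by move=> E1; move: h1; rewrite /root E1.
  pose z := (1 + x) / (1 - x).
  have z1E : z + 1 = 2 / (1 - x) by rewrite /z; field.
  have z1 : z + 1 != 0 by rewrite z1E mulf_neq0 ?invr_eq0 // pnatr_eq0.
  have zx : (z - 1) / (z + 1) = x.
    have -> : z - 1 = 2 * x / (1 - x) by rewrite /z; field.
    by rewrite z1E; field; rewrite xn1.
  have Rz : Re z = 0 by apply: Re_mobius_norm1 => //; rewrite zx.
  have rz : root (toC t) (z ^+ 2).
    rewrite /root -hurC_eval hur_eval ?sizeTC // zx mulf_eq0.
    by move: rx; rewrite /root => ->; rewrite orbT.
  have Ez := sqr_imaginary Rz.
  move: rz; rewrite Ez /root horner_toC rc_eq0 -/(root _ _) rL => inL.
  have : - Im z ^+ 2 \in rem z0 L.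
    rewrite mem_rem_uniq // inE inL andbT /=; apply/eqP => E0.
    by move: z0p; rewrite -E0 oppr_gt0 ltNge sqr_ge0.
  by case: (rem z0 L).
(* In [t(1) = 2 ^ m] the factors [1 + b] and [1 - z0^-1] are positive, which fixes the sign of
   [t(0)]. *)
- have E1 := t_horner1; rewrite tE hornerZ hornerM horner_node mulr1 horner_prod in E1.
  move: E1; set p := \prod_(_ <- _) _.
  have p0 : 0 < p.
    rewrite /p big_seq; apply: prodr_gt0 => b /bpos b0.
    by rewrite horner_node mulr1 addr_gt0.
  have q0 : 0 < 1 - z0^-1 by rewrite subr_gt0 invf_lt1.
  move=> H; have : 0 < t`_0 * ((1 - z0^-1) * p) by rewrite H exprn_gt0.
  by rewrite (pmulr_lgt0 _ (mulr_gt0 q0 p0)).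
Qed.

End SalemNodes.

(** * Integer points of P_T^- *)

(* Up to the factor [2 ^ (m - 1)], the transform sends this polynomial to [(z + 1) z ^ 2j]. *)
Definition anti_basis (A : comNzRingType) (m j : nat) : {poly A} :=
  (1 + 'X) ^+ j.*2 * (1 - 'X) ^+ (m.-1 - j.*2).

Lemma anti_basis_map (A B : comNzRingType) (phi : {rmorphism A -> B}) m j :
  map_poly phi (anti_basis A m j) = anti_basis B m j.
Proof. by rewrite /anti_basis rmorphM !rmorphXn rmorphB rmorphD /= map_polyX rmorph1. Qed.

Lemma size_anti_basis (A : comNzRingType) m j : (0 < m)%N -> ~~ odd m -> (j < m./2)%N ->
  (size (anti_basis A m j) <= m)%N.
Proof.
move=> m0 em jm; rewrite (leq_trans (size_polyMleq _ _)) //.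
have s1 : (size (1 + 'X : {poly A})%R <= 2)%N.
  by rewrite (leq_trans (size_polyD _ _)) // geq_max size_poly1 size_polyX.
have s2 : (size (1 - 'X : {poly A})%R <= 2)%N.
  by rewrite (leq_trans (size_polyD _ _)) // geq_max size_poly1 size_polyN size_polyX.
have e1 k : (size ((1 + 'X : {poly A}) ^+ k)%R <= k.+1)%N.
  rewrite (leq_trans (size_poly_exp_leq _ _)) // ltnS.
  by move: s1; move: (size _) => x; clear; nia.
have e2 k : (size ((1 - 'X : {poly A}) ^+ k)%R <= k.+1)%N.
  rewrite (leq_trans (size_poly_exp_leq _ _)) // ltnS.
  by move: s2; move: (size _) => x; clear; nia.
move: (e1 j.*2) (e2 (m.-1 - j.*2)%N); move: (size _) (size _) => x y.
by move: em jm m0; clear; lia.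
Qed.

Lemma hur_anti_basis (F : numFieldType) m j : (0 < m)%N -> ~~ odd m -> (j < m./2)%N ->
  hur m (anti_basis F m j) = 2 ^+ m.-1 *: eo 'X^j 'X^j.
Proof.
move=> m0 em jm; apply: (@poly_eq_eval _ [:: -1]) => z; rewrite inE => z1.
have {}z1 : z + 1 != 0 by rewrite -[1]opprK subr_eq0.
rewrite hur_eval //; last by rewrite (leq_trans (size_anti_basis _ _ _ _)).
rewrite hornerM !horner_exp !(hornerD, hornerN, hornerX, hornerC).
have -> : 1 + (z - 1) / (z + 1) = 2 * z / (z + 1) by field.
have -> : 1 - (z - 1) / (z + 1) = 2 / (z + 1) by field.
rewrite hornerZ horner_eo hornerXn.
have [k Ek] : exists k, m = (j.*2 + k).+1.
  by exists (m.-1 - j.*2)%N; move: em jm m0; clear; lia.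
have -> : (m.-1 - j.*2)%N = k by rewrite Ek /= addKn.
rewrite Ek /= exprS !exprD !expr_div_n exprMn -!mul2n !exprM.
have h1 : (z + 1) ^+ 2 ^+ j != 0 by rewrite !expf_neq0.
have h2 : (z + 1) ^+ k != 0 by rewrite !expf_neq0.
move: ((z + 1) ^+ 2 ^+ j) ((z + 1) ^+ k) h1 h2 => a b a0 b0.
by field; rewrite a0 b0.
Qed.

(** It solves [X A + A^* = 0], the homogeneous form of the equation of [P_T^-], of which [T] itself
    is a particular solution. *)
Lemma rev_anti_basis (F : numFieldType) m j : (0 < m)%N -> ~~ odd m -> (j < m./2)%N ->
  rev_poly m (anti_basis F m j) = - ('X * anti_basis F m j).
Proof.
move=> m0 em jm; apply: (@poly_eq_eval _ [:: 0]) => z; rewrite inE => z0.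
rewrite rev_poly_eval //; last by rewrite (leq_trans (size_anti_basis _ _ _ _)).
rewrite hornerN [('X * _).[z]]hornerM hornerX !hornerM !horner_exp !(hornerD, hornerN, hornerX, hornerC).
have [k Ek ok] : exists2 k, m = (j.*2 + k).+1 & odd k.
  by exists (m.-1 - j.*2)%N; move: em jm m0; clear; lia.
have -> : (m.-1 - j.*2)%N = k by rewrite Ek /= addKn.
have -> : 1 + z^-1 = (1 + z) / z by field.
have -> : 1 - z^-1 = - (1 - z) / z by field.
rewrite Ek exprS exprD !expr_div_n [(- (1 - z)) ^+ k]exprNn -signr_odd ok expr1.
have h1 : z ^+ j.*2 != 0 by rewrite !expf_neq0.
have h2 : z ^+ k != 0 by rewrite !expf_neq0.
move: (z ^+ j.*2) (z ^+ k) h1 h2 => a b a0 b0.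
by field; rewrite a0 b0.
Qed.

Section Lattice.
Variables (R : realType) (m : nat) (T : {poly int}).
Hypotheses (m0 : (0 < m)%N) (em : ~~ odd m) (sT : size T = m.+1).
Hypotheses (hT : salem_poly R T).

Let TR := polyR_of_int R T.
Let t := even_poly (hur m TR).

Definition anti_part (K : {poly int}) : {poly int} :=
  \sum_(j < m./2) K`_j *: anti_basis int m j.

Lemma size_anti_part K : (size (anti_part K) <= m)%N.
Proof.
rewrite (leq_trans (size_sum _ _ _)) //; apply/bigmax_leqP => j _.
by rewrite (leq_trans (size_scale_leq _ _)) // size_anti_basis.
Qed.

Lemma anti_partR K : polyR_of_int R (anti_part K) =
  \sum_(j < m./2) (K`_j)%:~R *: anti_basis R m j.
Proof.
rewrite /polyR_of_int /anti_part rmorph_sum; apply: eq_bigr => j _.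
by rewrite /= map_polyZ anti_basis_map.
Qed.

Lemma rev_anti_part K : rev_poly m (anti_part K) = - ('X * anti_part K).
Proof.
apply: (@polyR_of_int_inj R); rewrite polyR_rev /polyR_of_int rmorphN rmorphM /= map_polyX.
rewrite -/(polyR_of_int R _) anti_partR mulr_sumr -sumrN.
have rev_sum (I : Type) (r : seq I) (f : I -> {poly R}) :
    rev_poly m (\sum_(i <- r) f i) = \sum_(i <- r) rev_poly m (f i).
  elim: r => [|i r IH]; last by rewrite !big_cons rev_polyD IH.
  by rewrite !big_nil; apply/polyP => i; rewrite coef_poly !coef0 if_same.
rewrite rev_sum; apply: eq_bigr => j _.
by rewrite rev_polyZ rev_anti_basis // -scalerAr scalerN.
Qed.

Lemma hur_anti_part (K : {poly int}) : (size K <= m./2)%N ->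
  hur m (polyR_of_int R (anti_part K)) =
  2 ^+ m.-1 *: eo (polyR_of_int R K) (polyR_of_int R K).
Proof.
move=> sK; rewrite anti_partR.
have hur_sum (I : Type) (r : seq I) (f : I -> {poly R}) :
    hur m (\sum_(i <- r) f i) = \sum_(i <- r) hur m (f i).
  elim: r => [|i r IH]; last by rewrite !big_cons hurD IH.
  by rewrite !big_nil -(scale0r (0 : {poly R})) hurZ !scale0r.
have eo_sum (I : Type) (r : seq I) (f : I -> {poly R}) :
    eo (\sum_(i <- r) f i) (\sum_(i <- r) f i) = \sum_(i <- r) eo (f i) (f i).
  elim: r => [|i r IH]; last by rewrite !big_cons -eoD IH.
  by rewrite !big_nil /eo !comp_poly0 mul0r addr0.
have KE : polyR_of_int R K = \sum_(j < m./2) (K`_j)%:~R *: 'X^j.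
  apply/polyP => i; rewrite coef_sum.
  have [im|mi] := ltnP i m./2.
    rewrite coef_map (bigD1 (Ordinal im)) //= coefZ coefXn eqxx mulr1 big1 ?addr0 // => j ji.
    rewrite coefZ coefXn; case: eqP => [E|]; last by rewrite mulr0.
    by move/eqP: ji; case; apply/val_inj.
  rewrite nth_default ?size_polyR ?(leq_trans sK) // big1 // => j _.
  rewrite coefZ coefXn; case: eqP => [E|]; last by rewrite mulr0.
  by have := ltn_ord j; rewrite -E ltnNge mi.
rewrite KE eo_sum hur_sum scaler_sumr; apply: eq_bigr => j _.
by rewrite hurZ hur_anti_basis // !scalerA mulrC -eoZ scalerA.
Qed.

(** The point comes from [P = T + anti_part K], whose transform has odd part [K2] and even part
    [t + K2]. As [t(0) > 0] and [s2 < 0], a negative [t(0) + k] makes the first two terms positive;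
    the tail [l] is unchanged. *)
Lemma lattice_tuple (K : {poly int}) (s2 : R) (l : seq R) :
  (size K <= m./2)%N -> (size l).+2 = m -> s2 < 0 -> {in l, forall a, 0 < a} ->
  0 < t`_0 -> let k := 2 ^+ m.-1 * (K`_0)%:~R in
  t = t`_0 *: cfD [:: 1, s2 & l] ->
  polyR_of_int R K = (K`_0)%:~R *: cfN [:: 1, s2 & l] ->
  t`_0 + k < 0 ->
  FT R m T (seq_col m [:: k / (t`_0 + k), t`_0 * s2 / (t`_0 + k) & l]).
Proof.
move=> sK sl s20 lpos t0 k tE KE d0.
set f := [:: _, _ & l]; set d := t`_0 + k in d0 f *.
have dn0 : d != 0 by rewrite lt_eqF.
have k0 : k < 0 by move: d0; rewrite /d; lra.
have fpos : {in f, forall a, 0 < a}.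
  move=> a; rewrite !inE => /or3P[/eqP ->|/eqP ->|/lpos //].
    by rewrite nmulr_rgt0 // invr_lt0.
  by rewrite -mulrA pmulr_rgt0 // nmulr_rgt0 // invr_lt0.
have sf : size f = m by rewrite /= sl.
set K2 := 2 ^+ m.-1 *: polyR_of_int R K.
pose A := cfD l + 'X * cfN l; pose B := cfD l.
have K2E : K2 = k *: A by rewrite /K2 KE cfN_cons cfD_cons !scalerA mulr1.
have tE' : t = t`_0 *: (A + 'X * (s2 *: B)).
  rewrite [LHS]tE; congr (_ *: _).
have f2d : d * (t`_0 * s2 / d) = t`_0 * s2 by rewrite mulrC divfK.
have EN : K2 = d *: cfN f.
  by rewrite K2E /f cfN_cons cfD_cons scalerA [d * _]mulrC divfK.
have ED : t + K2 = d *: cfD f.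
  have gen (V W : {poly R}) : t`_0 *: (V + 'X * (s2 *: W)) + k *: V =
      d *: (V + 'X * ((t`_0 * s2 / d) *: W)).
    by rewrite !scalerDr -!scalerAr !scalerA f2d /d scalerDl addrAC.
  by rewrite K2E [in LHS]tE' gen.
pose P := T + anti_part K.
have sA := size_anti_part K.
have Tm : T`_m = 1 by apply: (salem_coef sT hT).
have Pm : P`_m = 1 by rewrite coefD Tm [X in _ + X]nth_default ?addr0.
have sP : size P = m.+1.
  apply: size_eq_of_coef; last by rewrite Pm.
  by rewrite (leq_trans (size_polyD _ _)) // sT geq_max leqnn /= (leq_trans sA).
have sPR : size (polyR_of_int R P) = m.+1 by rewrite size_polyR.
have HP : hur m (polyR_of_int R P) = eo (d *: cfD f) (d *: cfN f).
  rewrite /P {1}/polyR_of_int rmorphD /= hurD -/(polyR_of_int R T) -/TR (salem_hur em sT hT).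
  by rewrite -/(polyR_of_int R _) hur_anti_part // eoZ eoD add0r -/t -/K2 ED EN.
have cfm : 0 < (cfD f)`_(m./2) by have [_] := cf_lead_gt0 fpos; rewrite sf.
have exP : expansive (polyR_of_int R P).
  apply/(expansive_stable m0 sPR); rewrite HP -eoZ; split.
    move=> z z0; rewrite map_polyZ hornerZ mulf_neq0 ?cf_stable //.
    by rewrite rc_eq0.
  by rewrite coefZ coef_eo (negbTE em) mulf_neq0 // gt_eqF.
exists P.
  right; split=> //.
  - by apply/monicP; rewrite lead_coefE sP.
  - by rewrite sP sT.
  (* [P(0)] has the sign of the scale [d], by the value of [H_P] at 1. *)
  - rewrite horner_coef0 -(ltrz0 R).
    have := hur_eval1 m (polyR_of_int R P).
    rewrite HP -eoZ hornerZ horner_eo expr1n mulr1 coef_map => E.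
    have [n0 d1] := cf_horner1_gt0 fpos.
    have : 2 ^+ m * (P`_0)%:~R < 0 :> R by rewrite -E nmulr_rlt0 // ltr_pwDl.
    by rewrite pmulr_rlt0 // exprn_gt0.
  - have [_ rT _ _] := hT.
    rewrite (reciprocalE sP) rev_polyD -(reciprocalE sT) rT rev_anti_part /P; ring.
apply/(stieltjes_tuple_ofP _ m0 sP); split.
  by apply/(col_seqP _ (fun a => 0 < a)); rewrite seq_colK.
by exists d; rewrite // seq_colK // HP even_eo odd_eo.
Qed.

End Lattice.

(** A ceiling divided by [n + 1], squeezed between [a] and [a + 1 / (n + 1)]. *)
Lemma floor_approx (R : realType) (a : R) :
  - (Num.floor (- (n.+1%:R * a)))%:~R / n.+1%:R @[n --> \oo] --> a.
Proof.
apply: (@squeeze_cvgr _ _ _ _ (fun=> a) (fun n => a + harmonic n)).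
- near=> n.
  have y0 : 0 < n.+1%:R :> R by rewrite ltr0Sn.
  have h1 : (Num.floor (- (n.+1%:R * a)))%:~R <= - (n.+1%:R * a) by exact: Num.Theory.floor_le.
  have h2 : - (n.+1%:R * a) < (Num.floor (- (n.+1%:R * a)))%:~R + 1.
    by have := floorD1_gt (- (n.+1%:R * a)); rewrite intrD1.
  apply/andP; split.
    by rewrite ler_pdivlMr //; lra.
  rewrite ler_pdivrMr // mulrDl /harmonic mulVf ?gt_eqF //; lra.
- exact: cvg_cst.
- rewrite -[X in _ --> X]addr0; apply: cvgD; first exact: cvg_cst.
  exact: cvg_harmonic.
Unshelve. all: by end_near.
Qed.

Lemma coef_polyR (R : realType) (P : {poly int}) i :
  (polyR_of_int R P)`_i = (P`_i)%:~R.
Proof. exact: coef_map. Qed.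

(** * Affine relations on [F_T] *)

Section Relation.
Variables (R : realType) (m : nat) (T : {poly int}).
Hypotheses (m0 : (0 < m)%N) (em : ~~ odd m) (sT : size T = m.+1).
Hypotheses (hT : salem_poly R T) (hsimple : simple_roots R T).
Hypotheses (hN1 : ~~ root T (-1)) (h1 : ~~ root T 1).

Let t := even_poly (hur m (polyR_of_int R T)).
Variables (c0 : R) (a : nat -> R).
Hypothesis Hrel : forall x, FT R m T x -> c0 + \sum_(j < m) a j * x j 0 = 0.

(* Comparing [K] with [2 K], which has the same [s2] and [l], separates the two
   equations. *)
Lemma lattice_relation (D : {poly R}) p (K : {poly int}) (s2 : R) (l : seq R) :
  m = p.+2 -> t = t`_0 *: D -> 0 < t`_0 ->
  (size K <= m./2)%N -> size l = p -> admissible D s2 l ->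
  polyR_of_int R K = (K`_0)%:~R *: cfN [:: 1, s2 & l] ->
  t`_0 + (K`_0)%:~R < 0 ->
  a 1%N * s2 = a 0%N /\ c0 + a 0%N + \sum_(i < p) a i.+2 * l`_i = 0.
Proof.
move=> mp tE t0 sK sl [s20 lpos DE] KE d0.
(* After multiplication by [t(0) + k] the relation is affine in [k], with coefficients independent
   of [k]. *)
have rel (k : R) : t`_0 + k < 0 ->
    FT R m T (seq_col m [:: k / (t`_0 + k), t`_0 * s2 / (t`_0 + k) & l]) ->
    (c0 + a 0%N + \sum_(i < p) a i.+2 * l`_i) * (t`_0 + k) + (a 1%N * s2 - a 0%N) * t`_0 = 0.
  move=> k0 /Hrel; have kn0 : t`_0 + k != 0 by rewrite lt_eqF.
  have -> : \sum_(j < m) a j * (seq_col m [:: k / (t`_0 + k), t`_0 * s2 / (t`_0 + k) & l]) j 0 =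
    a 0%N * (k / (t`_0 + k)) + (a 1%N * (t`_0 * s2 / (t`_0 + k)) + \sum_(i < p) a i.+2 * l`_i).
    under eq_bigr => j _ do rewrite mxE.
    by clear -mp; subst m; rewrite !big_ord_recl.
  move/(congr1 ( *%R^~ (t`_0 + k))); rewrite mul0r => E; rewrite -[RHS]E.
  by move: (\sum_(_ < _) _) => S; field.
have tE' : t = t`_0 *: cfD [:: 1, s2 & l] by rewrite DE.
have slm : (size l).+2 = m by rewrite sl.
pose k1 : R := 2 ^+ m.-1 * (K`_0)%:~R.
have K0 : (K`_0)%:~R < 0 :> R by lra.
have two1 : 1 <= 2 ^+ m.-1 :> R by rewrite exprn_ege1 // ler1n.
have d1 : t`_0 + k1 < 0 by rewrite /k1; nra.
have r1 := rel k1 d1 (lattice_tuple m0 em sT hT sK slm s20 lpos t0 tE' KE d1).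
have sK2 : (size (2 *: K) <= m./2)%N by rewrite (leq_trans (size_scale_leq _ _)).
have K2E : polyR_of_int R (2 *: K) = ((2 *: K)`_0)%:~R *: cfN [:: 1, s2 & l].
  by rewrite coefZ intrM /polyR_of_int map_polyZ -/(polyR_of_int R K) KE scalerA.
pose k2 : R := 2 ^+ m.-1 * ((2 *: K)`_0)%:~R.
have k2E : k2 = 2 * k1 by rewrite /k2 /k1 coefZ intrM; ring.
have d2 : t`_0 + k2 < 0 by rewrite k2E; lra.
have r2 := rel k2 d2 (lattice_tuple m0 em sT hT sK2 slm s20 lpos t0 tE' K2E d2).
set X := c0 + a 0%N + _ in r1 r2 *; set Y := a 1%N * s2 - a 0%N in r1 r2.
have X0 : X = 0.
  have : X * k1 = 0 by rewrite k2E in r2; lra.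
  have k1n : k1 != 0 by rewrite lt_eqF //; lra.
  by move/eqP; rewrite mulf_eq0 (negbTE k1n) orbF => /eqP.
split=> //; move: r1; rewrite X0 mul0r add0r => /eqP; rewrite mulf_eq0 => /orP[|].
  by rewrite subr_eq0 => /eqP.
by rewrite gt_eqF.
Qed.

(** The real numerator is approximated by integer polynomials divided by [- (n + 1)]; the terms
    depend continuously on it, and both equations pass to the limit. *)
Lemma real_relation (D : {poly R}) p (s2 : R) (l : seq R) :
  m = p.+2 -> t = t`_0 *: D -> 0 < t`_0 -> size l = p -> admissible D s2 l ->
  a 1%N * s2 = a 0%N /\ c0 + a 0%N + \sum_(i < p) a i.+2 * l`_i = 0.
Proof.
move=> mp tE t0 sl [s20 lpos DE].
pose s := [:: 1, s2 & l]; pose k := cfN s.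
have sne : {in s, forall b, b != 0}.
  move=> b; rewrite !inE => /or3P[/eqP ->|/eqP ->|/lpos /lt0r_neq0 //].
    by rewrite oner_eq0.
  by rewrite lt_eqF.
have ss : size s = m by rewrite /= sl mp.
have k0 : k`_0 = 1 by rewrite /k cfN_coef0.
(* The minus sign makes the constant coefficient [- (n + 1)], eventually below [- t(0)] as
   [lattice_relation] requires. It is exact since [k(0) = 1], so [N n] is normalised too. *)
pose K n : {poly int} := \poly_(i < m./2) Num.floor (- (n.+1%:R * k`_i)).
pose N n : {poly R} := (- n.+1%:R)^-1 *: polyR_of_int R (K n).
have hm2 : (0 < m./2)%N by rewrite mp.
have K0 n : (K n)`_0 = - n.+1%:Z.
  by rewrite coef_poly hm2 k0 mulr1 pmulrn -intrN intrKfloor.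
have sK n : (size (K n) <= m./2)%N by exact: size_poly.
have sN n : (size (N n) <= uphalf m)%N.
  by rewrite (leq_trans (size_scale_leq _ _)) // size_polyR uphalf_half (negbTE em).
have N0 n : (N n)`_0 = 1.
  by rewrite coefZ coef_polyR K0 intrN mulVf // oppr_eq0 pnatr_eq0.
have [skN skD] := size_cf s; rewrite ss in skN skD; rewrite DE in skD.
have cN i : (N n)`_i @[n --> \oo] --> k`_i.
  have [im|mi] := ltnP i m./2.
    have := @floor_approx R k`_i.
    apply: cvg_trans; apply: near_eq_cvg; near=> n.
    by rewrite [RHS]coefZ coef_polyR coef_poly im invrN !mulNr; congr (- _); rewrite mulrC.
  rewrite [k`_i]nth_default; last by rewrite (leq_trans skN) // uphalf_half (negbTE em).
  under eq_fun do rewrite nth_default ?(leq_trans (sN _)) ?uphalf_half ?(negbTE em) //.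
  exact: cvg_cst.
have D0 : D`_0 = 1 by rewrite -DE cfD_coef0.
have D00 : D`_0 != 0 by rewrite D0 oner_eq0.
pose cf n := cf_expand m (N n) D.
have E0 : cf_expand m k D = s.
  have c1 : (1 : {poly R})`_0 != 0 by rewrite coefC oner_eq0.
  by have := cf_expand_cf 0 c1 sne; rewrite addn0 ss !mul1r cats0 DE.
have scf n : size (cf n) = m by rewrite size_cf_expand.
have ccf i : (i < m)%N -> (cf n)`_i @[n --> \oo] --> s`_i.
  move=> im; rewrite -E0; apply: cf_expand_cvg => //.
    by move=> j; exact: cvg_cst.
  by move=> b; rewrite (cf_expand_take _ _ (ltnW im)) E0 => /mem_take /sne.
pose S n := (cf n)`_1; pose L n := drop 2 (cf n).
have cf0 n : (cf n)`_0 = 1.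
  by rewrite /cf nth_cf_expand // /= N0 D0 divr1.
have cfE n : cf n = [:: 1, S n & L n].
  rewrite /S /L; have := scf n; have := cf0 n; rewrite mp; case: (cf n) => [//|b [//|d r]] /= -> _.
  by rewrite drop0.
have sL n : size (L n) = p by rewrite size_drop scf mp subSS subSS subn0.
have nL n i : (L n)`_i = (cf n)`_i.+2 by rewrite nth_drop.
have cS : S n @[n --> \oo] --> s2 by apply: (ccf 1%N); rewrite mp.
have cL i : (i < p)%N -> (L n)`_i @[n --> \oo] --> l`_i.
  by move=> ip; under eq_fun do rewrite nL; apply: (ccf i.+2); rewrite mp.
have good : \forall n \near \oo, a 1%N * S n = a 0%N /\
    c0 + a 0%N + \sum_(i < p) a i.+2 * (L n)`_i = 0.
  have posL : \forall n \near \oo, forall i : 'I_p, 0 < (L n)`_i.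
    apply: filter_forall => i; apply: (cvgr_gt _ (cL i (ltn_ord i))).
    by apply: lpos; rewrite mem_nth // sl.
  have negS : \forall n \near \oo, S n < 0 by apply: (cvgr_lt _ cS).
  near=> n.
  have Sn : S n < 0 by near: n.
  have Ln : forall i : 'I_p, 0 < (L n)`_i by near: n.
  have Lpos : {in L n, forall b, 0 < b} by exact: seq_pos (sL n) Ln.
  have cfne : {in cf n, forall b, b != 0}.
    move=> b; rewrite cfE !inE => /or3P[/eqP ->|/eqP ->|/Lpos /lt0r_neq0 //].
      by rewrite oner_eq0.
    by rewrite lt_eqF.
  have [EN ED] := cf_expandP D00 (sN n) skD cfne.
  rewrite D0 !scale1r -/(cf n) cfE in EN ED.
  apply: (lattice_relation mp tE t0 (sK n) (sL n)).
  - by split=> //; rewrite -ED.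
  - rewrite K0 -EN /N scalerA intrN divff ?scale1r // oppr_eq0 pnatr_eq0 //.
  rewrite K0 intrN subr_lt0.
  have : (Num.bound t`_0 <= n)%N by near: n; exact: nbhs_infty_ge.
  rewrite -(ler_nat R) => h; apply: lt_le_trans (archi_boundP (ltW t0)) _.
  by rewrite (le_trans h) // ler_nat.
split.
  have cl : a 1%N * S n @[n --> \oo] --> a 1%N * s2 by apply: cvgM => //; exact: cvg_cst.
  have cl' : a 1%N * S n @[n --> \oo] --> a 0%N.
    by apply: cvg_near_cst; apply: filterS good => n [].
  exact: norm_cvg_unique cl cl'.
have cl : c0 + a 0%N + \sum_(i < p) a i.+2 * (L n)`_i @[n --> \oo] -->
    c0 + a 0%N + \sum_(i < p) a i.+2 * l`_i.
  apply: cvgD; first exact: cvg_cst.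
  by apply: cvg_sum_seq => i; apply: cvgM; [exact: cvg_cst|exact: cL].
have cl' : c0 + a 0%N + \sum_(i < p) a i.+2 * (L n)`_i @[n --> \oo] --> (0 : R).
  by apply: cvg_near_cst; apply: filterS good => n [].
exact: norm_cvg_unique cl cl'.
Unshelve. all: by end_near.
Qed.

Lemma FT_relation_trivial : c0 = 0 /\ forall j, (j < m)%N -> a j = 0.
Proof.
have [b0 [bs [[b00 bpos ubs sbs] [bs0 t0 tE]]]] := salem_nodes em sT hT hsimple hN1 h1.
rewrite -/t in t0 tE.
case sbs' : (size bs) sbs bs0 => [|n] // sbs _.
have mp : m = n.+1.*2.+2 by move: sbs em; clear; lia.
have [ex indep] := cf_independent b00 sbs' ubs bpos.
have rel s2 l sl ad := @real_relation _ _ s2 l mp tE t0 sl ad.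
have [c00 aE] := indep (c0 + a 0%N) (fun i => a i.+2) (fun s2 l sl ad => (rel s2 l sl ad).2).
(* The equation between [a 1 * s2] and [a 0] becomes an affine relation on [l], since [s2] plus the
   sum of [l] is the coefficient of ['X] in [nodes b0 bs]. *)
have [|E1 E2] := indep (a 1%N * (nodes b0 bs)`_1 - a 0%N) (fun=> - a 1%N).
  move=> s2 l sl ad; have [<- _] := rel s2 l sl ad.
  have [_ _ <-] := ad; rewrite cfD_coef1 big_cons (big_nth 0) big_mkord sl.
  by rewrite -mulr_sumr; ring.
have a1 : a 1%N = 0 by have := E2 0%N isT; move/eqP; rewrite oppr_eq0 => /eqP.
have a0 : a 0%N = 0 by move: E1; rewrite a1 mul0r sub0r => /eqP; rewrite oppr_eq0 => /eqP.
split; first by rewrite a0 addr0 in c00.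
move=> [|[|j]] //; rewrite mp !ltnS; exact: aE.
Qed.

End Relation.

(** The rows [(1, y)] with [y] in [A] span: while the rank is at most [m], a nonzero column of the
    cokernel is an affine form vanishing at the chosen points but, by hypothesis, not on all of [A].
    The first coordinate of a combination equal to [(1, x)] says that its coefficients sum to 1. *)
Lemma affine_hull_full (R : realType) m (A : set 'cV[R]_m) :
  (forall (c0 : R) (a : nat -> R),
    (forall x, A x -> c0 + \sum_(j < m) a j * x j 0 = 0) ->
    c0 = 0 /\ forall j, (j < m)%N -> a j = 0) ->
  affine_hull A = [set: 'cV[R]_m].
Proof.
move=> Hindep.
pose r (y : 'cV[R]_m) : 'rV[R]_(1 + m) := row_mx 1%:M y^T.
pose mat n (Y : 'I_n -> 'cV[R]_m) : 'M[R]_(n, 1 + m) := \matrix_(i < n) r (Y i).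
have full k : (k <= 1 + m)%N -> exists n (Y : 'I_n -> 'cV[R]_m),
    (forall i, A (Y i)) /\ (k <= \rank (mat n Y))%N.
  elim: k => [|k IH] km; first by exists 0%N, (fun=> 0); split=> // -[].
  have [n [Y [AY rk]]] := IH (ltnW km).
  have [gt|le] := ltnP k (\rank (mat n Y)); first by exists n, Y.
  have {rk le} rkE : \rank (mat n Y) = k by apply/eqP; rewrite eqn_leq le.
  have : cokermx (mat n Y) != 0 by rewrite -mxrank_eq0 mxrank_coker rkE subn_eq0 -ltnNge.
  case/matrix0Pn => i [j vij].
  pose v := cokermx (mat n Y).
  have [y [Ay ryv]] : exists y, A y /\ (r y *m v) 0 j != 0.
    apply: contrapT => H.
    pose a (l : nat) : R := if insub l is Some q then v (rshift 1 (q : 'I_m)) j else 0.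
    have [|c00 a0] := Hindep (v (lshift m 0) j) a.
      move=> x Ax; have : (r x *m v) 0 j = 0.
        by apply: contrapT => /eqP h; apply: H; exists x.
      rewrite mxE big_split_ord big_ord1 /= row_mxEl mxE eqxx mul1r => E.
      rewrite -[RHS]E; congr (_ + _); apply: eq_bigr => l _.
      by rewrite row_mxEr mxE /a valK mulrC.
    move: vij; rewrite -/v; case: (splitP i) => l il.
      have -> : i = lshift m 0 by apply: val_inj; rewrite /= il (ord1 l).
      by rewrite c00 eqxx.
    have -> : i = rshift 1 l by apply: val_inj.
    by have := a0 l (ltn_ord l); rewrite /a valK => ->; rewrite eqxx.
  exists (n + 1)%N, (fun i : 'I_(n + 1) => match fintype.split i with inl l => Y l | inr _ => y end); split.
    by move=> l; case: (fintype.split l).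
  set M' := mat _ _.
  have E : M' = col_mx (mat n Y) (r y).
    apply/matrixP => a b; rewrite [LHS]mxE [RHS]mxE; case: splitP => l _.
      by rewrite [RHS]mxE.
    by rewrite (ord1 l).
  have sub : (mat n Y <= M')%MS by rewrite E -addsmxE addsmxSl.
  rewrite ltn_neqAle -{1 2}rkE mxrankS // andbT.
  have [_ ->] := mxrank_leqif_sup sub.
  apply/negP => sub'.
  have /submxP [u ru] : (r y <= mat n Y)%MS.
    by apply: submx_trans sub'; rewrite E -addsmxE addsmxSr.
  by move: ryv; rewrite ru -mulmxA mulmx_coker mulmx0 mxE eqxx.
apply/seteqP; split=> // x _.
have [n [Y [AY rk]]] := full (1 + m)%N (leqnn _).
have fullM : row_full (mat n Y) by rewrite /row_full eqn_leq rank_leq_col.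
have /submxP [u ru] : (r x <= mat n Y)%MS by exact: submx_full.
have r0 y : (r y) 0 (lshift m 0) = 1 by rewrite row_mxEl mxE eqxx.
have r1 y l : (r y) 0 (rshift 1 l) = y l 0 by rewrite row_mxEr mxE.
exists n, (u 0), Y; split=> //.
  rewrite -[RHS](r0 x) ru mxE; apply: eq_bigr => i _.
  by rewrite [X in _ * X]mxE r0 mulr1.
apply/matrixP => l q; rewrite ord1 -r1 ru mxE summxE; apply: eq_bigr => i _.
by rewrite [X in _ * X]mxE r1 mxE.
Qed.

Unset Implicit Arguments.

Theorem theorem1p2 (R : realType) (m : nat) (T : {poly int})
  (hT : salem_poly R T) (hm : size T = m.+1)
  (hsimple : simple_roots R T)
  (h1 : ~~ root T 1) (hN1 : ~~ root T (-1)) :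
  [/\ (* (i) *)
      isolated (FT R m T) = FT R m T /\
      limit_point (FT R m T) `&` positive_orthant R m = set0,
      (* (ii) *)
      affine_hull (FT R m T) = [set: 'cV[R]_m],
      (* (iii) *)
      (forall P, (PTplus R T `|` [set T]) P ->
         exists! x : 'cV[R]_m, salem_tuple T P x) /\
      (exists op : 'cV[R]_m -> 'cV[R]_m -> 'cV[R]_m,
         commutative_semigroup_on (FTplus R m T `|` [set 0]) op 0 /\
         forall P P', (PTplus R T `|` [set T]) P ->
           (PTplus R T `|` [set T]) P' ->
           (PTplus R T `|` [set T]) (oplus T P P') /\
           forall x y : 'cV[R]_m, salem_tuple T P x -> salem_tuple T P' y ->
             salem_tuple T (oplus T P P') (op x y)) &
      (* (iv) *)
      FT R m T `&` hypersurface R m = set0].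
Proof.
have [mT rT _ T1] := hT.
have em := even_degree hm rT hN1.
(* Degree 0 would mean [T = 1], which has no root on the unit circle. *)
have m0 : (0 < m)%N.
  rewrite lt0n; apply/eqP => mE; have [z rz _] := T1.
  move: rz; have sT1 : (size T <= 1)%N by rewrite hm mE.
  rewrite (size1_polyC sT1) /polyC_of_int map_polyC /root hornerC (salem_coef0 hm hT).
  by rewrite oner_eq0.
split.
- exact: FT_discrete m0 em hm.
- apply: affine_hull_full => c0 a Hrel.
  exact: FT_relation_trivial m0 em hm hT hsimple hN1 h1 _ _ Hrel.
- split; first exact: salem_tuple_unique_exists m0 hm T1.
  exact: FTplus_semigroup m0 em hm mT rT T1.
- exact: FT_hypersurface m0 hm.
Qed.
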